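(* Assume $\mu_0=\nu$ (stationary chain), $\sigma^2>0$, and that hypothesis $(\mathcal H)$ holds. Then $S_n/\sqrt n$ converges in law to $\mathcal N(0,\sigma^2)$, and for every $\tau<1$, $$\sup_{x\in\mathbb R}\Big|\mathbb P\Big(\frac{S_n}{\sigma\sqrt n}\le x\Big)-\mathcal N(0,1)(]-\infty,x])\Big| = O(n^{-\tau/2}).$$
   Context: Let $(E,\mathcal E)$ be a measurable space, $Q$ a transition probability on $E$ admitting an invariant probability $\nu$, $(X_n)_{n\ge0}$ a Markov chain with transition $Q$ and initial law $\mu_0$, and $\xi:E\to\mathbb R$ a measurable $\nu$-integrable function with $\nu(\xi)=0$; put $S_n=\sum_{k=1}^n\xi(X_k)$. $\mathbf 1$ is the constant function $1$ on $E$. For $t\in\mathbb R$, $Q(t)$ is the Fourier kernel $Q(t)f(x)=\int e^{it\xi(y)}f(y)\,Q(x,dy)$. For a Banach space $(\mathcal B,\|\cdot\|)$ of measurable complex functions on $E$, $Q$ is called $\mathcal B$-geometrically ergodic if $\mathbf 1\in\mathcal B$, $\mathcal B$ embeds continuously in $L^1(\nu)$, $Q$ is a bounded operator on $\mathcal B$, and there are $\kappa_0<1$, $C\ge0$ with $\|Q^nf-\nu(f)\mathbf 1\|\le C\kappa_0^n\|f\|$ for all $n\ge1$, $f\in\mathcal B$. If so and $\xi\in\mathcal B$, set $\check\xi=\sum_{n\ge0}Q^n\xi$ (absolutely convergent in $\mathcal B$), and if moreover $\mathcal B\subset L^2(\nu)$, set $\sigma^2=\nu(\check\xi^2)-\nu((Q\check\xi)^2)$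 and $\psi=Q(\check\xi^2)-(Q\check\xi)^2-\sigma^2\mathbf 1$. Hypothesis $(\mathcal H)$: there is a Banach space $(\mathcal B,\|\cdot\|)$ of measurable complex functions with $\mathcal B\subset L^3(\nu)$, $\xi\in\mathcal B$, such that: (H1) $Q$ is $\mathcal B$-geometrically ergodic; (H2) $\sum_{p\ge0}\nu(|Q^p\psi|^{3/2})^{2/3}<\infty$; (H3) $\sup\{\nu(|e^{it\xi}-1|\,|f|): f\in\mathcal B,\|f\|\le1\}=O(|t|)$ as $t\to0$; (H4) there is an open interval $I\ni0$ such that for $t\in I$, $Q(t)$ is a bounded operator on $\mathcal B$, there are constants $\kappa<1$, $C\ge0$ with $\|Q(t)^nf\|\le C\kappa^n\|f\|+C\nu(|f|)$ for all $n\ge1$, $t\in I$, $f\in\mathcal B$, and the essential spectral radius of $Q(t)$ acting on $\mathcal B$ is $\le\kappa$ for all $t\in I$. *)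

(* Defs.v *)
From HB Require Import structures.
From mathcomp Require Import all_boot all_order all_algebra.
From mathcomp Require Import all_classical all_reals all_analysis.
From mathcomp Require Import complex.
Set Implicit Arguments.
Unset Strict Implicit.
Unset Printing Implicit Defensive.
Import Order.TTheory GRing.Theory Num.Theory.
Import numFieldNormedType.Exports.
Local Open Scope classical_set_scope.
Local Open Scope ring_scope.
Local Open Scope complex_scope.

Section Defs.
Context {R : realType} {d : measure_display} {E : measurableType d}.

Definition cabs (z : R[i]) : R := Num.sqrt (complex.Re z ^+ 2 + complex.Im z ^+ 2).

Definition cexpi (a : R) : R[i] := (cos a)%:C + 'i * (sin a)%:C.

Definition cint (mu : {measure set E -> \bar R}) (f : E -> R[i]) : R[i] :=
  (Rintegral mu setT (fun x => complex.Re (f x)))%:C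
  + 'i * (Rintegral mu setT (fun x => complex.Im (f x)))%:C.

Definition kop (Q : R.-pker E ~> E) (f : E -> R[i]) : E -> R[i] :=
  fun x => cint (Q x) f.

Definition kopt (Q : R.-pker E ~> E) (xi : E -> R) (t : R)
    (f : E -> R[i]) : E -> R[i] :=
  kop Q (fun y => cexpi (t * xi y) * f y).

Definition cmeasurable (f : E -> R[i]) : Prop :=
  measurable_fun setT (fun x => complex.Re (f x)) /\
  measurable_fun setT (fun x => complex.Im (f x)).

Definition ncauchy (nB : (E -> R[i]) -> R) (u : nat -> E -> R[i]) : Prop :=
  forall e : R, 0 < e -> exists N : nat, forall m n : nat, (N <= m)%N -> (N <= n)%N ->
    nB (fun x => u m x - u n x) < e.

Definition banach_fun_space (B : set (E -> R[i])) (nB : (E -> R[i]) -> R) : Prop :=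
  [/\ (forall f, B f -> cmeasurable f),
      B (fun _ => 0),
      (forall f g, B f -> B g -> B (fun x => f x + g x)),
      (forall (a : R[i]) f, B f -> B (fun x => a * f x)) &
      (forall f, B f -> 0 <= nB f)] /\
  [/\
      (forall f, B f -> nB f = 0 -> f = (fun _ => 0)),
      (forall f g, B f -> B g -> nB (fun x => f x + g x) <= nB f + nB g),
      (forall (a : R[i]) f, B f -> nB (fun x => a * f x) = cabs a * nB f) &
      (forall u : nat -> E -> R[i], (forall n, B (u n)) -> ncauchy nB u ->
         exists g, B g /\ (fun n => nB (fun x => u n x - g x)) @ \oo --> (0 : R))].

Definition bounded_op (B : set (E -> R[i])) (nB : (E -> R[i]) -> R)
    (T : (E -> R[i]) -> (E -> R[i])) : Prop :=
  [/\ (forall f, B f -> B (T f)),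
      (forall (a : R[i]) f g, B f -> B g ->
         T (fun x => a * f x + g x) = (fun x => a * T f x + T g x)) &
      exists c : R, forall f, B f -> nB (T f) <= c * nB f].

(** compact operator on B: bounded, and maps the unit ball to a relatively
    compact set (every bounded sequence has an image subsequence that is
    Cauchy, hence convergent since B is complete) *)
Definition compact_op (B : set (E -> R[i])) (nB : (E -> R[i]) -> R)
    (K : (E -> R[i]) -> (E -> R[i])) : Prop :=
  bounded_op B nB K /\
  forall u : nat -> E -> R[i], (forall n, B (u n) /\ nB (u n) <= 1) ->
    exists phi : nat -> nat, (forall n, (phi n < phi n.+1)%N) /\
      ncauchy nB (fun n => K (u (phi n))).

Definition opnorm (B : set (E -> R[i])) (nB : (E -> R[i]) -> R)
    (T : (E -> R[i]) -> (E -> R[i])) : R :=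
  sup [set nB (T f) | f in [set f | B f /\ nB f <= 1]].

Definition ess_norm (B : set (E -> R[i])) (nB : (E -> R[i]) -> R)
    (T : (E -> R[i]) -> (E -> R[i])) : R :=
  inf [set opnorm B nB (fun f x => T f x - K f x) | K in compact_op B nB].

(** essential spectral radius (spectral radius in the Calkin algebra,
    Gelfand formula  r_ess(T) = lim_n ||T^n||_ess^{1/n} = inf_n ||T^n||_ess^{1/n}) *)
Definition ess_spectral_radius (B : set (E -> R[i])) (nB : (E -> R[i]) -> R)
    (T : (E -> R[i]) -> (E -> R[i])) : R :=
  inf [set powR (ess_norm B nB (iter n T)) (n%:R^-1) | n in [set n : nat | (0 < n)%N]].

Definition geom_ergodic (B : set (E -> R[i])) (nB : (E -> R[i]) -> R)
    (Q : R.-pker E ~> E) (nu : probability E R) : Prop :=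
  [/\ B (fun _ => 1),
      (exists c : R, forall f, B f ->
          (\int[nu]_x (cabs (f x))%:E <= (c * nB f)%:E)%E),
      bounded_op B nB (kop Q) &
      exists (kappa0 c : R), kappa0 < 1 /\ 0 <= c /\
        forall (n : nat) f, (0 < n)%N -> B f ->
          nB (fun x => iter n (kop Q) f x - cint nu f) <= c * kappa0 ^+ n * nB f].

Fixpoint fdd (Q : R.-pker E ~> E) (As : seq (set E)) (x : E) : \bar R :=
  match As with
  | [::] => 1%E
  | A :: As' => (\int[Q x]_(y in A) fdd Q As' y)%E
  end.

Definition markov_chain {dO : measure_display} {Omega : measurableType dO}
    (P : probability Omega R) (X : nat -> Omega -> E)
    (Q : R.-pker E ~> E) (mu0 : probability E R) : Prop :=
  (forall n, measurable_fun setT (X n)) /\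
  forall (A0 : set E) (As : seq (set E)),
    measurable A0 -> (forall k, (k < size As)%N -> measurable (nth setT As k)) ->
    P [set w | A0 (X 0%N w) /\
               forall k, (k < size As)%N -> nth setT As k (X k.+1 w)]
    = (\int[mu0]_(x in A0) fdd Q As x)%E.

Definition partial_sum {dO : measure_display} {Omega : measurableType dO}
    (X : nat -> Omega -> E) (xi : E -> R) (n : nat) (w : Omega) : R :=
  \sum_(1 <= k < n.+1) xi (X k w).

End Defs.

Definition conv_in_law {R : realType} {dO : measure_display}
    {Omega : measurableType dO} (P : probability Omega R)
    (Y : nat -> Omega -> R) (mu : probability (measurableTypeR R) R) : Prop :=
  forall h : R -> R, continuous h -> (exists M : R, forall x, `|h x| <= M) ->
    (fun n => Rintegral P setT (fun w => h (Y n w))) @ \oo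
      --> Rintegral mu setT h.

(* Main.v *)
(** Write [xi = g - Q g] with [g] the real part of [xic] and let
    [a_n(u) = nu (Q(u)^n 1)], which is the characteristic function of [S_n] by
    stationarity and the Markov property. No perturbation theory of the spectrum
    of [Q(u)] is needed; two estimates on [a_n] suffice.

    Small frequencies. Conjugating [Q(u)] by [exp (i u Q g)] turns the coboundary
    into martingale increments [g(y) - Q g(x)], whose conditional variance is
    [sigma2 + psi]. A third order Taylor expansion gives
    [b_{k+1} = (1 - u^2 sigma2 / 2) b_k - (u^2 / 2) nu (R^k psi) + O(|u|^3)], where
    [R] is the conjugated kernel. Since [R] differs from [Q] by [O(|u|)] on each
    [Q^p psi], the corrector [sum_p nu (R^k Q^p psi)] absorbs the middle term by
    (H2) and Young's inequality. Hence
    [|a_n(u) - exp (- n u^2 sigma2 / 2)| <= C (|u| + n |u|^3)].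

    Moderate frequencies. Over [M ~ u^-2] steps the function
    [V f = nu |f| + eta * ||f||] is contracted by [Q(u)^M]: geometric ergodicity and
    (H3) make [Q(u)^l f] close to [nu(f) 1] in [L^1], the first estimate bounds
    [a_M(u)] away from [1], and the Doeblin-Fortet inequality (H4) controls the
    norm. Hence [|a_n(u)| <= K exp (- c n u^2)] for [|u| <= delta].

    Esseen's smoothing inequality, with the Fejer kernel and a cut-off at
    [n^(-1/2 + eta)] between the two estimates, gives the rate. *)

Require Import Defs.
From HB Require Import structures.
From mathcomp Require Import all_boot all_order all_algebra.
From mathcomp Require Import all_classical all_reals all_analysis.
From mathcomp Require Import complex measurable_realfun.
From mathcomp Require Import ring lra.
Import Order.TTheory GRing.Theory Num.Theory.
Import numFieldNormedType.Exports.
Local Open Scope classical_set_scope.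
Local Open Scope ring_scope.
Local Open Scope complex_scope.
Set Implicit Arguments.
Unset Strict Implicit.

(** * Complex-valued functions and kernels *)

Section ComplexModulus.
Context {R : realType}.
Implicit Types z w : R[i].

(** (H3) makes [Q(u) - Q] small only from [B] to [L^1(nu)], not as an operator on [B]. Every
    comparison of the two kernels therefore spends a [B]-norm and returns an [L^1] norm, and
    contraction has to be recovered from the pair of norms. Multiplication by [exp (i u Q g)] need
    not preserve [B], so the small-frequency estimate lives in [L^1(nu)], where invariance of [nu]
    makes every twisted kernel a contraction. There the kernels are linear only almost everywhere,
    since their integrals may diverge at exceptional points; this is why functionals
    [f -> nu (R^k f)] are used instead of operators. The exponent [3/2] in (H2) is dual to the third
    moments: the integral of [|g| |Q^p psi|] is bounded by a multiple of the [L^(3/2)] norm of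
    [Q^p psi], hence summably in [p]. The loss [tau < 1] stems from the error [n |u|^3], which
    carries no Gaussian factor. Divided by [|u|] and integrated up to [y / sqrt n] it yields
    [y^3 / sqrt n], where [y] is a small positive power of [n], large enough for the Gaussian decay
    to win beyond the cut-off. *)

Lemma cabsE z : cabs z = Normc.normc z.
Proof. by case: z. Qed.

Lemma cabs_ge0 z : 0 <= cabs z.
Proof. exact: sqrtr_ge0. Qed.

Lemma cabsM z w : cabs (z * w) = cabs z * cabs w.
Proof. by rewrite !cabsE Normc.normcM. Qed.

Lemma cabsD z w : cabs (z + w) <= cabs z + cabs w.
Proof. by rewrite !cabsE le_normcD. Qed.

Lemma cabsN z : cabs (- z) = cabs z.
Proof. by rewrite !cabsE normcN. Qed.

Lemma cabsB z w : cabs (z - w) = cabs (w - z).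
Proof. by rewrite -cabsN opprB. Qed.

Lemma cabs0 : cabs (0 : R[i]) = 0.
Proof. by rewrite /cabs /= expr0n /= addr0 sqrtr0. Qed.

Lemma cabs1 : cabs (1 : R[i]) = 1.
Proof. by rewrite /cabs /= expr0n /= addr0 expr1n sqrtr1. Qed.

Lemma cabs_eq0 z : cabs z = 0 -> z = 0.
Proof. by rewrite cabsE => /Normc.eq0_normc. Qed.

Lemma cabs_real (a : R) : cabs a%:C = `|a|.
Proof. by rewrite /cabs /= expr0n /= addr0 sqrtr_sqr. Qed.

Lemma cabs_triangle z v w : cabs (z - w) <= cabs (z - v) + cabs (v - w).
Proof. by apply: le_trans (cabsD _ _); rewrite addrA subrK. Qed.

Lemma le_cabs_Re z : `|complex.Re z| <= cabs z.
Proof.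
by rewrite /cabs -[X in X <= _]sqrtr_sqr ler_sqrt ?lerDl ?addr_ge0 ?sqr_ge0.
Qed.

Lemma le_cabs_Im z : `|complex.Im z| <= cabs z.
Proof.
by rewrite /cabs -[X in X <= _]sqrtr_sqr ler_sqrt ?lerDr ?addr_ge0 ?sqr_ge0.
Qed.

Lemma cabs_le_ReIm z : cabs z <= `|complex.Re z| + `|complex.Im z|.
Proof.
rewrite {1}(complexE z) (le_trans (cabsD _ _))// cabsM !cabs_real.
by rewrite {1}/cabs /= expr0n /= add0r expr1n sqrtr1 mul1r.
Qed.

Lemma complex_eq z w :
  complex.Re z = complex.Re w -> complex.Im z = complex.Im w -> z = w.
Proof. by case: z; case: w => a b c d /= -> ->. Qed.

Lemma ReD z w : complex.Re (z + w) = complex.Re z + complex.Re w.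
Proof. by case: z; case: w. Qed.
Lemma ImD z w : complex.Im (z + w) = complex.Im z + complex.Im w.
Proof. by case: z; case: w. Qed.
Lemma ReN z : complex.Re (- z) = - complex.Re z. Proof. by case: z. Qed.
Lemma ImN z : complex.Im (- z) = - complex.Im z. Proof. by case: z. Qed.
Lemma ReM z w : complex.Re (z * w) =
  complex.Re z * complex.Re w - complex.Im z * complex.Im w.
Proof. by case: z; case: w. Qed.
Lemma ImM z w : complex.Im (z * w) =
  complex.Re z * complex.Im w + complex.Im z * complex.Re w.
Proof. by case: z; case: w. Qed.

Lemma Re_cexpi (a : R) : complex.Re (cexpi a) = cos a.
Proof. by rewrite /cexpi ReD ReM /= !mul0r mulr0 subrr addr0. Qed.
Lemma Im_cexpi (a : R) : complex.Im (cexpi a) = sin a.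
Proof. by rewrite /cexpi ImD ImM /= mul0r mul1r !add0r. Qed.

Lemma cexpi0 : cexpi (0 : R) = 1.
Proof. by apply: complex_eq; rewrite ?Re_cexpi ?Im_cexpi ?cos0 ?sin0. Qed.

Lemma cexpiD (a b : R) : cexpi (a + b) = cexpi a * cexpi b.
Proof.
apply: complex_eq; rewrite ?ReM ?ImM !(Re_cexpi, Im_cexpi).
  by rewrite cosD.
by rewrite sinD addrC.
Qed.

Lemma cabs_cexpi (a : R) : cabs (cexpi a) = 1.
Proof. by rewrite /cabs Re_cexpi Im_cexpi cos2Dsin2 sqrtr1. Qed.

Lemma cexpiN (a : R) : cexpi a * cexpi (- a) = 1.
Proof. by rewrite -cexpiD subrr cexpi0. Qed.

Lemma derive_ge0_ge0 (f f' : R -> R) (x : R) : f 0 = 0 ->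
  (forall t : R, is_derive t (1 : R) f (f' t)) -> (forall t, 0 <= t -> 0 <= f' t) ->
  0 <= x -> 0 <= f x.
Proof.
move=> f0 df f'0; rewrite le_eqVlt => /predU1P[<-|x0]; first by rewrite f0.
have [|c] := @MVT R f f' 0 x x0.
  apply: continuous_subspaceT => t; apply: differentiable_continuous.
  by apply/derivable1_diffP; case: (df t).
rewrite in_itv /= => /andP[c0 _] fE.
have -> : f x = f' c * (x - 0) by rewrite -fE f0 subr0.
by rewrite mulr_ge0 ?f'0 ?subr_ge0// ltW.
Qed.

(** A ladder of integrations: each difference vanishes at 0 and its derivative is nonnegative by an
    earlier bound. Sharp constants are irrelevant, hence the coefficient 1 in front of [x ^+ 3]. *)
Lemma cos_sin_taylor_ge0 (x : R) : 0 <= x ->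
  [/\ sin x <= x, 1 - cos x <= x, 0 <= cos x - 1 + x ^+ 2 / 2 <= x ^+ 3 &
      0 <= x - sin x <= x ^+ 3].
Proof.
have s1 (t : R) : 0 <= t -> sin t <= t.
  move=> t0; rewrite -subr_ge0; pose f (t : R) := t - sin t.
  have df (s : R) : is_derive s (1 : R) f (1 - cos s).
    by rewrite /f; apply: is_derive_eq; rewrite /GRing.scale /=; field.
  have f0 : f 0 = 0 by rewrite /f sin0 subrr.
  rewrite -[leRHS]/(f t); apply: (derive_ge0_ge0 f0 df) t0 => s _; by rewrite subr_ge0 cos_le1.
have c1 (t : R) : 0 <= t -> 1 - cos t <= t.
  move=> t0; rewrite -subr_ge0; pose f (t : R) := t - (1 - cos t).
  have df (s : R) : is_derive s (1 : R) f (1 - sin s).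
    by rewrite /f; apply: is_derive_eq; rewrite /GRing.scale /=; field.
  have f0 : f 0 = 0 by rewrite /f cos0 !subrr.
  rewrite -[leRHS]/(f t); apply: (derive_ge0_ge0 f0 df) t0 => s _; by rewrite subr_ge0 sin_le1.
have c2 (t : R) : 0 <= t -> 0 <= cos t - 1 + t ^+ 2 / 2.
  move=> t0; pose f (t : R) := cos t - 1 + t ^+ 2 / 2.
  have df (s : R) : is_derive s (1 : R) f (s - sin s).
    by rewrite /f; apply: is_derive_eq; rewrite /GRing.scale /=; field.
  have f0 : f 0 = 0 by rewrite /f cos0 expr0n /= mul0r subrr addr0.
  rewrite -[leRHS]/(f t); apply: (derive_ge0_ge0 f0 df) t0 => s s0; by rewrite subr_ge0 s1.
have s2 (t : R) : 0 <= t -> t - sin t <= t ^+ 2 / 2.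
  move=> t0; rewrite -subr_ge0; pose f (t : R) := t ^+ 2 / 2 - (t - sin t).
  have df (s : R) : is_derive s (1 : R) f (s - (1 - cos s)).
    by rewrite /f; apply: is_derive_eq; rewrite /GRing.scale /=; field.
  have f0 : f 0 = 0 by rewrite /f sin0 expr0n /= mul0r !subr0.
  rewrite -[leRHS]/(f t); apply: (derive_ge0_ge0 f0 df) t0 => s s0; by rewrite subr_ge0 c1.
have s3 (t : R) : 0 <= t -> t - sin t <= t ^+ 3.
  move=> t0; rewrite -subr_ge0; pose f (t : R) := t ^+ 3 - (t - sin t).
  have df (s : R) : is_derive s (1 : R) f (3 * s ^+ 2 - (1 - cos s)).
    by rewrite /f; apply: is_derive_eq; rewrite /GRing.scale /=; field.
  have f0 : f 0 = 0 by rewrite /f sin0 expr0n /= !subr0.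
  rewrite -[leRHS]/(f t); apply: (derive_ge0_ge0 f0 df) t0 => s s0; have := c2 _ s0; have := sqr_ge0 s; lra.
have c3 (t : R) : 0 <= t -> cos t - 1 + t ^+ 2 / 2 <= t ^+ 3.
  move=> t0; rewrite -subr_ge0.
  pose f (t : R) := t ^+ 3 - (cos t - 1 + t ^+ 2 / 2).
  have df (s : R) : is_derive s (1 : R) f (3 * s ^+ 2 - (s - sin s)).
    by rewrite /f; apply: is_derive_eq; rewrite /GRing.scale /=; field.
  have f0 : f 0 = 0 by rewrite /f cos0 !expr0n /= !mul0r; ring.
  rewrite -[leRHS]/(f t); apply: (derive_ge0_ge0 f0 df) t0 => s s0; have := s2 _ s0; have := sqr_ge0 s; lra.
move=> x0; split; [exact: s1|exact: c1|by rewrite c2//= c3|].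
by rewrite subr_ge0 s1//= s3.
Qed.

Lemma cos_sin_taylor (a : R) :
  [/\ `|sin a| <= `|a|, `|cos a - 1| <= `|a|, `|sin a - a| <= `|a| ^+ 3 &
      `|cos a - 1 + a ^+ 2 / 2| <= `|a| ^+ 3].
Proof.
wlog a0 : a / 0 <= a => [H|].
  have [/H//|/ltW] := leP 0 a; rewrite -oppr_ge0 => /H.
  by rewrite sinN cosN !normrN sqrrN -opprD normrN.
have [h1 h2 /andP[h3 h4] /andP[h5 h6]] := cos_sin_taylor_ge0 a0.
rewrite [`|a|]ger0_norm//; split.
- rewrite ler_norml h1 andbT.
  have [a1|/ltW a1] := leP a 1; last by have := sin_geN1 a; lra.
  have : 0 <= sin a; last by lra.
  by apply: sin_ge0_pi; rewrite a0/=; have := @pi_ge2 R; lra.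
- by rewrite distrC ger0_norm ?subr_ge0 ?cos_le1.
- by rewrite distrC ger0_norm.
- by rewrite ger0_norm.
Qed.

Lemma cabs_cexpi_sub1 (a : R) : cabs (cexpi a - 1) <= 2 * `|a|.
Proof.
have [h1 h2 _ _] := cos_sin_taylor a.
rewrite (le_trans (cabs_le_ReIm _))// ReD ImD ReN ImN Re_cexpi Im_cexpi /=.
by rewrite subr0; lra.
Qed.
End ComplexModulus.

(** * Integration of complex-valued functions and the [L^1] norm *)

Section ComplexIntegral.
Context {R : realType} {d : measure_display} {T : measurableType d}.
Implicit Types (mu : {measure set T -> \bar R}) (f g : T -> R[i]).

Definition cintegrable mu f : Prop :=
  mu.-integrable setT (fun x => (complex.Re (f x))%:E) /\
  mu.-integrable setT (fun x => (complex.Im (f x))%:E).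

Definition normL1 mu f : \bar R := (\int[mu]_x (cabs (f x))%:E)%E.

Lemma normL1_ge0 mu f : (0 <= normL1 mu f)%E.
Proof. by apply: integral_ge0 => x _; rewrite lee_fin cabs_ge0. Qed.

Lemma measurable_cabs f : cmeasurable f -> measurable_fun setT (fun x => cabs (f x)).
Proof.
move=> [mr mi]; rewrite /cabs.
have ms : measurable_fun [set: R] (@Num.sqrt R).
  by apply: continuous_measurable_fun; exact: sqrt_continuous.
apply: (measurableT_comp ms).
by apply: measurable_funD; apply: measurable_funX.
Qed.

Lemma cmeasurable_cst (c : R[i]) : cmeasurable (fun _ : T => c).
Proof. by split; exact: measurable_cst. Qed.

Lemma cmeasurableD f g : cmeasurable f -> cmeasurable g ->
  cmeasurable (fun x => f x + g x).
Proof.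
move=> [fr fi] [gr gi]; split.
  by under eq_fun do rewrite ReD; exact: measurable_funD.
by under eq_fun do rewrite ImD; exact: measurable_funD.
Qed.

Lemma cmeasurableM f g : cmeasurable f -> cmeasurable g ->
  cmeasurable (fun x => f x * g x).
Proof.
move=> [fr fi] [gr gi]; split.
  under eq_fun do rewrite ReM.
  by apply: measurable_funB; exact: measurable_funM.
under eq_fun do rewrite ImM.
by apply: measurable_funD; exact: measurable_funM.
Qed.

Lemma cmeasurableB f g : cmeasurable f -> cmeasurable g ->
  cmeasurable (fun x => f x - g x).
Proof.
move=> mf mg; rewrite (_ : (fun x => _) = fun x => f x + (-1) * g x).
  by apply: cmeasurableD => //; apply: cmeasurableM => //; exact: cmeasurable_cst.
by apply/funext => x; rewrite mulN1r.
Qed.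

Lemma cmeasurable_real (h : T -> R) : measurable_fun setT h ->
  cmeasurable (fun x => (h x)%:C).
Proof. by move=> mh; split => //=; exact: measurable_cst. Qed.

Lemma cmeasurable_cexpi (h : T -> R) : measurable_fun setT h ->
  cmeasurable (fun x => cexpi (h x)).
Proof.
move=> mh; split.
  under eq_fun do rewrite Re_cexpi.
  apply: (measurableT_comp _ mh); apply: continuous_measurable_fun.
  exact: continuous_cos.
under eq_fun do rewrite Im_cexpi.
apply: (measurableT_comp _ mh); apply: continuous_measurable_fun.
exact: continuous_sin.
Qed.

Lemma fin_integrableZ mu (c : R) (h : T -> R) :
  mu.-integrable setT (fun x => (h x)%:E) ->
  mu.-integrable setT (fun x => (c * h x)%:E).
Proof. by move=> hi; under eq_fun do rewrite EFinM; exact: integrableZl. Qed.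

Lemma fin_integrableD mu (h k : T -> R) :
  mu.-integrable setT (fun x => (h x)%:E) ->
  mu.-integrable setT (fun x => (k x)%:E) ->
  mu.-integrable setT (fun x => (h x + k x)%:E).
Proof. by move=> hi ki; under eq_fun do rewrite EFinD; exact: integrableD. Qed.

Lemma fin_integrableB mu (h k : T -> R) :
  mu.-integrable setT (fun x => (h x)%:E) ->
  mu.-integrable setT (fun x => (k x)%:E) ->
  mu.-integrable setT (fun x => (h x - k x)%:E).
Proof. by move=> hi ki; under eq_fun do rewrite EFinB; exact: integrableB. Qed.

Lemma cintegrable_measurable mu f : cintegrable mu f -> cmeasurable f.
Proof.
by move=> [/measurable_int/measurable_EFinP ? /measurable_int/measurable_EFinP ?].
Qed.

Lemma cintegrable_norm mu f : cintegrable mu f -> (normL1 mu f < +oo)%E.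
Proof.
move=> fi; have [mr mi] := cintegrable_measurable fi.
have [/integrableP[_ fr] /integrableP[_ fim]] := fi.
apply: (@le_lt_trans _ _ (\int[mu]_x (`|(complex.Re (f x))%:E| + `|(complex.Im (f x))%:E|))%E).
  apply: ge0_le_integral => //.
  - by move=> x _; rewrite lee_fin cabs_ge0.
  - by apply/measurable_EFinP/measurable_cabs; exact: cintegrable_measurable fi.
  - apply: emeasurable_funD; apply: measurableT_comp => //; exact/measurable_EFinP.
  - by move=> x _; rewrite /= -EFinD lee_fin cabs_le_ReIm.
rewrite ge0_integralD//; first by rewrite lte_add_pinfty.
  by apply: measurableT_comp => //; exact/measurable_EFinP.
by apply: measurableT_comp => //; exact/measurable_EFinP.
Qed.

Lemma cintegrableP mu f : cmeasurable f -> (normL1 mu f < +oo)%E -> cintegrable mu f.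
Proof.
move=> mf fi; have [mr mi] := mf.
have I (h : T -> R) : measurable_fun setT h -> (forall x, `|h x| <= cabs (f x)) ->
    mu.-integrable setT (fun x => (h x)%:E).
  move=> mh hf; apply/integrableP; split; first exact/measurable_EFinP.
  apply: le_lt_trans fi; apply: ge0_le_integral => //.
  - by apply: measurableT_comp => //; exact/measurable_EFinP.
  - by apply/measurable_EFinP; exact: measurable_cabs.
  - by move=> x _; rewrite /= lee_fin.
by split; apply: I => // x; [exact: le_cabs_Re|exact: le_cabs_Im].
Qed.

Lemma normL1_le mu f (h : T -> R) : cmeasurable f -> measurable_fun setT h ->
  (forall x, cabs (f x) <= h x) -> (normL1 mu f <= \int[mu]_x (h x)%:E)%E.
Proof.
move=> mf mh fh; apply: ge0_le_integral => //.
- by move=> x _; rewrite lee_fin cabs_ge0.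
- by apply/measurable_EFinP; exact: measurable_cabs.
- exact/measurable_EFinP.
- by move=> x _; rewrite lee_fin.
Qed.

Lemma normL1D mu f g : cmeasurable f -> cmeasurable g ->
  (normL1 mu (fun x => (f x + g x)%R) <= normL1 mu f + normL1 mu g)%E.
Proof.
move=> mf mg; rewrite -ge0_integralD//; first last.
- by apply/measurable_EFinP; exact: measurable_cabs.
- by move=> x _; rewrite lee_fin cabs_ge0.
- by apply/measurable_EFinP; exact: measurable_cabs.
- by move=> x _; rewrite lee_fin cabs_ge0.
apply: (@normL1_le _ _ (fun x => cabs (f x) + cabs (g x))).
- exact: cmeasurableD.
- by apply: measurable_funD; exact: measurable_cabs.
- by move=> x; exact: cabsD.
Qed.

Lemma normL1Z mu (a : R[i]) f : cmeasurable f ->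
  normL1 mu (fun x => a * f x) = ((cabs a)%:E * normL1 mu f)%E.
Proof.
move=> mf; rewrite /normL1; under eq_integral do rewrite cabsM EFinM.
rewrite ge0_integralZl_EFin ?cabs_ge0//.
  by move=> x _; rewrite lee_fin cabs_ge0.
by apply/measurable_EFinP; exact: measurable_cabs.
Qed.

Lemma normL1_triangle mu f g h : cmeasurable f -> cmeasurable g -> cmeasurable h ->
  (normL1 mu (fun x => (f x - h x)%R) <=
   normL1 mu (fun x => (f x - g x)%R) + normL1 mu (fun x => (g x - h x)%R))%E.
Proof.
move=> mf mg mh; rewrite (_ : (fun x => f x - h x) = fun x => (f x - g x) + (g x - h x)).
  by apply: normL1D; exact: cmeasurableB.
by apply/funext => x; rewrite addrA subrK.
Qed.

Lemma cintegrableD mu (a : R[i]) f g : cintegrable mu f -> cintegrable mu g ->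
  cintegrable mu (fun x => a * f x + g x).
Proof.
move=> fi gi; have mf := cintegrable_measurable fi.
have mg := cintegrable_measurable gi.
have maf : cmeasurable (fun x => a * f x).
  by apply: cmeasurableM => //; exact: cmeasurable_cst.
apply: cintegrableP; first exact: cmeasurableD.
apply: (le_lt_trans (normL1D mu maf mg)); rewrite normL1Z//.
apply: lte_add_pinfty; last exact: cintegrable_norm.
by rewrite lte_mul_pinfty ?lee_fin ?cabs_ge0// cintegrable_norm.
Qed.

Lemma cint_ReE mu f : complex.Re (cint mu f) = Rintegral mu setT (fun x => complex.Re (f x)).
Proof. by rewrite /cint ReD ReM /= !mul0r mulr0 subrr addr0. Qed.

Lemma cint_ImE mu f : complex.Im (cint mu f) = Rintegral mu setT (fun x => complex.Im (f x)).
Proof. by rewrite /cint ImD ImM /= mul0r mul1r !add0r. Qed.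

Lemma cint_lin mu (a : R[i]) f g : cintegrable mu f -> cintegrable mu g ->
  cint mu (fun x => a * f x + g x) = a * cint mu f + cint mu g.
Proof.
move=> [fr fi] [gr gi].
apply: complex_eq.
  rewrite cint_ReE [RHS]ReD ReM !cint_ReE cint_ImE.
  under eq_Rintegral do rewrite ReD ReM.
  by rewrite RintegralD ?RintegralB ?RintegralZl//; [exact: fin_integrableZ|exact: fin_integrableZ|apply: fin_integrableB; exact: fin_integrableZ].
rewrite cint_ImE [RHS]ImD ImM !cint_ImE cint_ReE.
under eq_Rintegral do rewrite ImD ImM.
by rewrite RintegralD ?RintegralD ?RintegralZl//; [exact: fin_integrableZ|exact: fin_integrableZ|apply: fin_integrableD; exact: fin_integrableZ].
Qed.

Lemma cintZ mu (a : R[i]) f : cintegrable mu f ->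
  cint mu (fun x => a * f x) = a * cint mu f.
Proof.
move=> fi; have z : cintegrable mu (fun _ => 0) by split; exact: integrable0.
have := @cint_lin mu a f _ fi z; under [in LHS]eq_fun do rewrite addr0.
move=> ->; rewrite (_ : cint mu (fun=> 0) = 0) ?addr0//.
by apply: complex_eq; rewrite ?cint_ReE ?cint_ImE /= /Rintegral integral0.
Qed.

Lemma cintB mu f g : cintegrable mu f -> cintegrable mu g ->
  cint mu (fun x => f x - g x) = cint mu f - cint mu g.
Proof.
move=> fi gi; have := @cint_lin mu (-1) g f gi fi.
by under [in LHS]eq_fun do rewrite mulN1r addrC; rewrite mulN1r addrC.
Qed.

(* Cauchy-Schwarz in the plane: |z|^2 = int (Re z Re f + Im z Im f) for z = int f *)
Lemma cabs_cint mu f : cintegrable mu f -> ((cabs (cint mu f))%:E <= normL1 mu f)%E.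
Proof.
move=> fi; have := fi => -[fr fim]; set z := cint mu f.
have [z0|zn0] := eqVneq (cabs z) 0; first by rewrite z0 normL1_ge0.
have zp : 0 < cabs z by rewrite lt0r zn0 cabs_ge0.
have nf : normL1 mu f = (fine (normL1 mu f))%:E.
  by rewrite fineK// ge0_fin_numE ?normL1_ge0// cintegrable_norm.
rewrite nf lee_fin -(ler_pM2l zp) -expr2.
have -> : cabs z ^+ 2 = Rintegral mu setT
    (fun x => complex.Re z * complex.Re (f x) + complex.Im z * complex.Im (f x)).
  rewrite RintegralD//; first last.
  - exact: fin_integrableZ.
  - exact: fin_integrableZ.
  rewrite !RintegralZl// -cint_ReE -cint_ImE -/z /cabs sqr_sqrtr ?addr_ge0 ?sqr_ge0//.
have ni : mu.-integrable setT (fun x => (cabs (f x))%:E).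
  apply/integrableP; split.
    by apply/measurable_EFinP/measurable_cabs/(cintegrable_measurable fi).
  under eq_integral => x _ do rewrite gee0_abs ?lee_fin ?cabs_ge0//.
  exact: cintegrable_norm.
rewrite -[fine _]/(Rintegral mu setT (fun x => cabs (f x))) -RintegralZl//.
apply: le_Rintegral => //.
- by apply: fin_integrableD; exact: fin_integrableZ.
- exact: fin_integrableZ.
- move=> x _; rewrite -cabsM.
  (* [w] is the conjugate of [z], so that the integrand is the real part of [w * f x]. *)
  pose w := complex.Complex (complex.Re z) (- complex.Im z).
  have -> : cabs (z * f x) = cabs (w * f x).
    by rewrite !cabsM /cabs /w /= sqrrN.
  apply: le_trans (le_cabs_Re _); rewrite ReM /= mulNr opprK; exact: ler_norm.
Qed.

Lemma le_cint_sub mu f g : cintegrable mu f -> cintegrable mu g ->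
  ((cabs (cint mu f - cint mu g)%R)%:E <= normL1 mu (fun x => (f x - g x)%R))%E.
Proof.
move=> fi gi; rewrite -cintB//; apply: cabs_cint.
rewrite (_ : (fun x => f x - g x) = fun x => (-1) * g x + f x); last first.
  by apply/funext => x; rewrite mulN1r addrC.
exact: cintegrableD.
Qed.

Lemma cintegrable_bounded mu f (M : R) : (mu setT < +oo)%E -> cmeasurable f ->
  (forall x, cabs (f x) <= M) -> cintegrable mu f.
Proof.
move=> mufin mf fM; apply: cintegrableP => //.
apply: le_lt_trans (_ : \int[mu]_x (`|M|)%:E < +oo)%E.
  apply: normL1_le => // x; exact: le_trans (fM x) (ler_norm _).
by rewrite integral_cst// lte_mul_pinfty// lee_fin.
Qed.

End ComplexIntegral.

(** * The transition kernel as a contraction of [L^1(nu)] *)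

Section Kernel.
Context {R : realType} {d : measure_display} {E : measurableType d}.
Variables (Q : R.-pker E ~> E).
Implicit Types (f g : E -> R[i]).

Lemma kernel_total x : Q x setT = 1%E.
Proof. exact: prob_kernel. Qed.

Lemma measurable_kernel_integral (f : E -> \bar R) : (forall x, (0 <= f x)%E) ->
  measurable_fun setT f -> measurable_fun setT (fun x => (\int[Q x]_y f y)%E).
Proof.
move=> f0 mf; apply: measurable_fun_integral_kernel => // U mU.
exact: measurable_kernel.
Qed.

Lemma measurable_kernel_Rintegral (h : E -> R) : measurable_fun setT h ->
  measurable_fun setT (fun x => Rintegral (Q x) setT h).
Proof.
move=> mh; apply: (measurableT_comp (@fine_measurable R setT measurableT)).
under eq_fun do rewrite integralE.
apply: emeasurable_funB; apply: measurable_kernel_integral => //.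
- exact/measurable_funepos/measurable_EFinP.
- exact/measurable_funeneg/measurable_EFinP.
Qed.

Lemma cmeasurable_kop f : cmeasurable f -> cmeasurable (kop Q f).
Proof.
move=> [mr mi]; split; rewrite /kop.
  under eq_fun do rewrite cint_ReE; exact: measurable_kernel_Rintegral.
under eq_fun do rewrite cint_ImE; exact: measurable_kernel_Rintegral.
Qed.

Lemma cmeasurable_iter_kop n f : cmeasurable f -> cmeasurable (iter n (kop Q) f).
Proof. by move=> mf; elim: n => //= n; exact: cmeasurable_kop. Qed.

Lemma measurable_normL1_kernel f : cmeasurable f ->
  measurable_fun setT (fun x => normL1 (Q x) f).
Proof.
move=> mf; apply: measurable_kernel_integral.
  by move=> x; rewrite lee_fin cabs_ge0.
by apply/measurable_EFinP; exact: measurable_cabs.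
Qed.

(** No integrability is required: where [f] is not integrable under [Q x] the right-hand side is
    infinite, whatever default value [kop] takes. *)
Lemma cabs_kop_le f x : cmeasurable f -> ((cabs (kop Q f x))%:E <= normL1 (Q x) f)%E.
Proof.
move=> mf; have [foo|] := ltP (normL1 (Q x) f) +oo%E; last exact: le_trans (leey _).
exact/cabs_cint/cintegrableP.
Qed.

Lemma cabs_kop_bounded f x (M : R) : cmeasurable f -> (forall y, cabs (f y) <= M) ->
  cabs (kop Q f x) <= M.
Proof.
move=> mf fM; rewrite -lee_fin (le_trans (cabs_kop_le x mf))//.
apply: (le_trans (normL1_le (Q x) mf (measurable_cst M) fM)).
by rewrite /= integral_cst// kernel_total mule1.
Qed.

Variables (nu : probability E R).
Hypothesis Hinv : forall A : set E, measurable A -> nu A = (\int[nu]_x Q x A)%E.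

Import HBNNSimple.

Lemma integral_kernel_nnsfun (f : {nnsfun E >-> R}) :
  (\int[nu]_x \int[Q x]_y (f y)%:E = \int[nu]_x (f x)%:E)%E.
Proof.
have Qm A : measurable A -> measurable_fun setT (fun x => Q x A).
  by move=> mA; exact: measurable_kernel.
have sE (m : {measure set E -> \bar R}) :
    (\int[m]_y (f y)%:E = \sum_(r \in range f) r%:E * m (f @^-1` [set r]))%E.
  under eq_integral do rewrite fimfunE -fsumEFin//.
  rewrite ge0_integral_fsum//; last 2 first.
  - by move=> r; exact/measurable_EFinP/measurableT_comp.
  - by move=> r z _; rewrite EFinM nnfun_muleindic_ge0.
  apply: eq_fsbigr => r _.
  rewrite (integralZl_indic _ (fun r => f @^-1` [set r]))//; last first.
    by move=> r0; rewrite preimage_nnfun0.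
  by rewrite integral_indic// setIT.
under eq_integral do rewrite sE.
rewrite sE ge0_integral_fsum//; last 2 first.
- by move=> r; apply: measurable_funeM; exact: Qm.
- move=> n y _; have := mulemu_ge0 (fun n => f @^-1` [set n]).
  by apply; exact: preimage_nnfun0.
apply: eq_fsbigr => r _.
have [r0|r0] := leP 0 r.
  by rewrite ge0_integralZl//; [rewrite -Hinv|exact: Qm].
rewrite preimage_nnfun0// measure0 mule0 integral0_eq// => x _.
by rewrite measure0 mule0.
Qed.

(** Invariance on sets gives the simple functions; monotone convergence, applied under [Q x] and
    then under [nu], gives the rest. *)
Lemma integral_kernel_inv (f : E -> \bar R) : (forall x, (0 <= f x)%E) ->
  measurable_fun setT f -> (\int[nu]_x \int[Q x]_y f y = \int[nu]_x f x)%E.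
Proof.
move=> f0 mf; pose f_ := nnsfun_approx measurableT mf.
have mf_ n : measurable_fun setT (fun y => (f_ n y)%:E) by exact/measurable_EFinP.
have nd x : {homo (fun n => (f_ n x)%:E) : n m / (n <= m)%N >-> (n <= m)%E}.
  by move=> a b ab; rewrite lee_fin; exact/lefP/nd_nnsfun_approx.
have fE (m : {measure set E -> \bar R}) :
    (\int[m]_y f y)%E = limn (fun n => (\int[m]_y (f_ n y)%:E)%E).
  rewrite -monotone_convergence//; last by move=> n x _; rewrite lee_fin.
  by apply: eq_integral => y _; apply/esym/cvg_lim => //; exact: cvg_nnsfun_approx.
under eq_integral do rewrite fE.
rewrite monotone_convergence//; last 3 first.
- move=> n; apply: measurable_kernel_integral => // y; first by rewrite lee_fin.
- by move=> n y _; apply: integral_ge0 => z _; rewrite lee_fin.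
- move=> y _ a b ab; apply: ge0_le_integral => //.
  + by move=> z _; rewrite lee_fin.
  + by move=> z _; exact: nd.
rewrite fE (_ : (fun n => \int[nu]_x \int[Q x]_y (f_ n y)%:E)%E =
  (fun n => \int[nu]_x (f_ n x)%:E)%E)//.
by apply/funext => n; exact: integral_kernel_nnsfun.
Qed.

Lemma integral_normL1_kernel f : cmeasurable f ->
  (\int[nu]_x normL1 (Q x) f)%E = normL1 nu f.
Proof.
move=> mf; rewrite integral_kernel_inv//.
  by move=> x; rewrite lee_fin cabs_ge0.
by apply/measurable_EFinP; exact: measurable_cabs.
Qed.

Lemma normL1_kop f : cmeasurable f -> (normL1 nu (kop Q f) <= normL1 nu f)%E.
Proof.
move=> mf; rewrite -[leRHS]integral_normL1_kernel//; apply: ge0_le_integral => //.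
- by move=> x _; rewrite lee_fin cabs_ge0.
- by apply/measurable_EFinP/measurable_cabs/cmeasurable_kop.
- exact: measurable_normL1_kernel.
- by move=> x _; exact: cabs_kop_le.
Qed.

Lemma ae_kernel_fin (h : E -> \bar R) : (forall x, (0 <= h x)%E) ->
  measurable_fun setT h -> (\int[nu]_x h x < +oo)%E ->
  {ae nu, forall x, (\int[Q x]_y h y < +oo)%E}.
Proof.
move=> h0 mh hoo.
have hi : nu.-integrable setT (fun x => (\int[Q x]_y h y)%E).
  apply/integrableP; split; first exact: measurable_kernel_integral.
  under eq_integral => x _ do rewrite gee0_abs ?integral_ge0//.
  by rewrite integral_kernel_inv.
have := integrable_ae measurableT hi; apply: filterS => x /(_ I).
by rewrite ge0_fin_numE// integral_ge0.
Qed.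

Lemma ae_cintegrable f : cintegrable nu f -> {ae nu, forall x, cintegrable (Q x) f}.
Proof.
move=> fi; have mf := cintegrable_measurable fi.
have : {ae nu, forall x, (normL1 (Q x) f < +oo)%E}.
  apply: ae_kernel_fin.
  - by move=> x; rewrite lee_fin cabs_ge0.
  - by apply/measurable_EFinP; exact: measurable_cabs.
  - exact: cintegrable_norm.
by apply: filterS => x; exact: cintegrableP.
Qed.

Lemma normL1_ae_eq f g : cmeasurable f -> cmeasurable g ->
  {ae nu, forall x, f x = g x} -> normL1 nu (fun x => f x - g x) = 0%E.
Proof.
move=> mf mg fg; rewrite -(@integral0 _ _ _ nu setT).
apply: ge0_ae_eq_integral => //.
- by apply/measurable_EFinP/measurable_cabs/cmeasurableB.
- by move=> x _; rewrite lee_fin cabs_ge0.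
- by apply: filterS fg => x -> _; rewrite subrr cabs0.
Qed.

Lemma cintegrable_kop f : cintegrable nu f -> cintegrable nu (kop Q f).
Proof.
move=> fi; have mf := cintegrable_measurable fi.
apply: cintegrableP; first exact: cmeasurable_kop.
by apply: le_lt_trans (cintegrable_norm fi); exact: normL1_kop.
Qed.

(** Additivity can fail at points where one of the integrals diverges and [Rintegral] takes its
    default value. By invariance these points form a null set. *)
Lemma kop_lin_ae (a : R[i]) f g : cintegrable nu f -> cintegrable nu g ->
  {ae nu, forall x, kop Q (fun y => a * f y + g y) x = a * kop Q f x + kop Q g x}.
Proof.
move=> fi gi; move: (ae_cintegrable fi) (ae_cintegrable gi).
by apply: filterS2 => x fx gx; rewrite /kop cint_lin.
Qed.

Lemma normL1_le0_eq0 f : cmeasurable f -> (normL1 nu f <= 0)%E ->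
  {ae nu, forall x, f x = 0}.
Proof.
move=> mf f0; have {}f0 : normL1 nu f = 0%E by apply/eqP; rewrite eq_le f0 normL1_ge0.
have : ae_eq nu setT (fun x => (cabs (f x))%:E) (cst 0%E).
  apply/ae_eq_integral_abs => //.
    by apply/measurable_EFinP; exact: measurable_cabs.
  rewrite -[RHS]f0; apply: eq_integral => x _.
  by rewrite gee0_abs// lee_fin cabs_ge0.
by apply: filterS => x /(_ I) [] /cabs_eq0.
Qed.

(** The contraction property in [L^1(nu)] makes the kernel insensitive to the choice of a
    representative. This later allows [xic] to be replaced by its real part under [Q]. *)
Lemma kop_ae_eq f g : cintegrable nu f -> cmeasurable g ->
  {ae nu, forall x, f x = g x} -> {ae nu, forall x, kop Q f x = kop Q g x}.
Proof.
move=> fi mg fg; have mf := cintegrable_measurable fi.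
have d0 : normL1 nu (fun x => f x - g x) = 0%E by exact: normL1_ae_eq.
have gi : cintegrable nu g.
  apply: cintegrableP => //; rewrite (_ : g = fun x => f x + (-1) * (f x - g x)).
    have mfg : cmeasurable (fun x => (-1) * (f x - g x)).
      by apply: cmeasurableM; [exact: cmeasurable_cst|exact: cmeasurableB].
    apply: (le_lt_trans (normL1D nu mf mfg)).
    rewrite normL1Z; last exact: cmeasurableB.
    by rewrite d0 mule0 adde0; exact: cintegrable_norm.
  by apply/funext => x; rewrite mulN1r opprB addrC subrK.
have Kd : (normL1 nu (kop Q (fun x => (f x - g x)%R)) <= 0)%E.
  by rewrite -d0; apply: normL1_kop; exact: cmeasurableB.
have := normL1_le0_eq0 (cmeasurable_kop (cmeasurableB mf mg)) Kd.
move: (ae_cintegrable fi) (ae_cintegrable gi).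
apply: filterS3 => x fx gx; rewrite /kop cintB// => /eqP.
by rewrite subr_eq0 => /eqP.
Qed.

End Kernel.

(** * Fourier kernels and their conjugates *)

Section TwistedKernel.
Context {R : realType} {d : measure_display} {E : measurableType d}.
Variables (Q : R.-pker E ~> E).
Implicit Types (f : E -> R[i]) (a b : E -> R).

(** One form for both kernels in play: the Fourier kernel is the case [a = u * xi], [b = 0], and its
    conjugate, the kernel of the martingale increments, is the case [a = u * g], [b = - (u * h)]
    with [h = Q g]. *)
Definition twist a b f : E -> R[i] :=
  fun x => cexpi (b x) * kop Q (fun y => cexpi (a y) * f y) x.

Lemma cmeasurable_cexpiM a f : measurable_fun setT a -> cmeasurable f ->
  cmeasurable (fun y => cexpi (a y) * f y).
Proof. by move=> ma mf; apply: cmeasurableM => //; exact: cmeasurable_cexpi. Qed.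

Lemma normL1_cexpiM (mu : {measure set E -> \bar R}) a f :
  normL1 mu (fun y => cexpi (a y) * f y) = normL1 mu f.
Proof. by apply: eq_integral => x _; rewrite cabsM cabs_cexpi mul1r. Qed.

Lemma cintegrable_cexpiM (mu : {measure set E -> \bar R}) a f :
  measurable_fun setT a -> cintegrable mu f ->
  cintegrable mu (fun y => cexpi (a y) * f y).
Proof.
move=> ma fi; apply: cintegrableP; last by rewrite normL1_cexpiM cintegrable_norm.
by apply: cmeasurable_cexpiM => //; exact: cintegrable_measurable fi.
Qed.

Lemma cmeasurable_twist a b f : measurable_fun setT a -> measurable_fun setT b ->
  cmeasurable f -> cmeasurable (twist a b f).
Proof.
move=> ma mb mf; apply: cmeasurable_cexpiM => //.
by apply: cmeasurable_kop; exact: cmeasurable_cexpiM.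
Qed.

Lemma cabs_twist_bounded a b f (M : R) x : measurable_fun setT a -> cmeasurable f ->
  (forall y, cabs (f y) <= M) -> cabs (twist a b f x) <= M.
Proof.
move=> ma mf fM; rewrite cabsM cabs_cexpi mul1r.
apply: cabs_kop_bounded; first exact: cmeasurable_cexpiM.
by move=> y; rewrite cabsM cabs_cexpi mul1r.
Qed.

Lemma cabs_iter_twist_bounded n a b f (M : R) : measurable_fun setT a ->
  measurable_fun setT b -> cmeasurable f -> (forall y, cabs (f y) <= M) ->
  cmeasurable (iter n (twist a b) f) /\ forall x, cabs (iter n (twist a b) f x) <= M.
Proof.
move=> ma mb mf fM; elim: n => //= n [mfn fnM]; split.
  exact: cmeasurable_twist.
by move=> x; exact: cabs_twist_bounded.
Qed.

Lemma twist_kopt (xi : E -> R) (u : R) :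
  kopt Q xi u = twist (fun y => u * xi y) (fun _ => 0).
Proof.
by apply/funext => f; apply/funext => x; rewrite /twist cexpi0 mul1r.
Qed.

(* Adding the coboundary [h - Q h] conjugates the Fourier kernel by [exp (i u h)] *)
Lemma iter_twist_conj (xi g h : E -> R) (u : R) n f x :
  (forall y, xi y = g y - h y) ->
  iter n (twist (fun y => u * g y) (fun y => - (u * h y))) f x =
  cexpi (- (u * h x)) *
    iter n (kopt Q xi u) (fun y => cexpi (u * h y) * f y) x.
Proof.
move=> xiE; elim: n f x => [|n IH] f x.
  by rewrite /= mulrA [X in X * _]mulrC cexpiN mul1r.
rewrite /= /twist /kopt; congr (_ * _); congr (kop Q _ x); apply/funext => y.
by rewrite IH mulrA -cexpiD xiE mulrBr.
Qed.

Variables (nu : probability E R).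
Hypothesis Hinv : forall A : set E, measurable A -> nu A = (\int[nu]_x Q x A)%E.

Lemma normL1_twist a b f : measurable_fun setT a -> cmeasurable f ->
  (normL1 nu (twist a b f) <= normL1 nu f)%E.
Proof.
move=> ma mf; rewrite normL1_cexpiM -(normL1_cexpiM nu a f).
by apply: normL1_kop => //; exact: cmeasurable_cexpiM.
Qed.

Lemma cintegrable_twist a b f : measurable_fun setT a -> measurable_fun setT b ->
  cintegrable nu f -> cintegrable nu (twist a b f).
Proof.
move=> ma mb fi; apply: cintegrable_cexpiM => //.
by apply: cintegrable_kop => //; exact: cintegrable_cexpiM.
Qed.

(** Linear functionals of norm at most 1 on [L^1(nu)]. Such a functional ignores null sets, so
    [f -> nu (R^k f)] is exactly linear although [R^k] is linear only almost everywhere. *)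
Definition L1_contraction (L : (E -> R[i]) -> R[i]) : Prop :=
  (forall (c : R[i]) f g, cintegrable nu f -> cintegrable nu g ->
     L (fun x => c * f x + g x) = c * L f + L g) /\
  (forall f, cintegrable nu f -> ((cabs (L f))%:E <= normL1 nu f)%E).

Lemma L1_contraction_cint : L1_contraction (cint nu).
Proof. by split => [c f g fi gi|f fi]; [exact: cint_lin|exact: cabs_cint]. Qed.

Lemma cintegrableB (mu : {measure set E -> \bar R}) f g : cintegrable mu f ->
  cintegrable mu g -> cintegrable mu (fun x => f x - g x).
Proof.
move=> fi gi; rewrite (_ : (fun x => f x - g x) = fun x => (-1) * g x + f x).
  exact: cintegrableD.
by apply/funext => x; rewrite mulN1r addrC.
Qed.

Lemma L1_contraction_sub L f g : L1_contraction L -> cintegrable nu f ->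
  cintegrable nu g ->
  ((cabs (L f - L g)%R)%:E <= normL1 nu (fun x => (f x - g x)%R))%E.
Proof.
move=> [Ll Lb] fi gi; rewrite (_ : L f - L g = L (fun x => f x - g x)).
  by apply: Lb; exact: cintegrableB.
rewrite (_ : (fun x => f x - g x) = fun x => (-1) * g x + f x).
  by rewrite Ll// mulN1r addrC.
by apply/funext => x; rewrite mulN1r addrC.
Qed.

Lemma L1_contraction_ae L f g : L1_contraction L -> cintegrable nu f ->
  cintegrable nu g -> {ae nu, forall x, f x = g x} -> L f = L g.
Proof.
move=> Lc fi gi fg; apply/eqP; rewrite -subr_eq0; apply/eqP/cabs_eq0/eqP.
rewrite eq_le cabs_ge0 andbT -lee_fin.
apply: le_trans (L1_contraction_sub Lc fi gi) _.
by rewrite normL1_ae_eq//; [exact: cintegrable_measurable fi|exact: cintegrable_measurable gi].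
Qed.

Lemma twist_lin_ae a b (c : R[i]) f g : measurable_fun setT a ->
  cintegrable nu f -> cintegrable nu g ->
  {ae nu, forall x, twist a b (fun y => c * f y + g y) x =
                    c * twist a b f x + twist a b g x}.
Proof.
move=> ma fi gi.
have := kop_lin_ae Hinv c (cintegrable_cexpiM ma fi) (cintegrable_cexpiM ma gi).
apply: filterS => x; rewrite /twist => kE.
rewrite (_ : (fun y => cexpi (a y) * (c * f y + g y)) =
  fun y => c * (cexpi (a y) * f y) + cexpi (a y) * g y); last first.
  by apply/funext => y; ring.
by rewrite kE; ring.
Qed.

Lemma L1_contraction_twist L a b : measurable_fun setT a -> measurable_fun setT b ->
  L1_contraction L -> L1_contraction (fun f => L (twist a b f)).
Proof.
move=> ma mb Lc; have [Ll Lb] := Lc; split => [c f g fi gi|f fi].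
  rewrite -Ll; [|exact: cintegrable_twist|exact: cintegrable_twist].
  apply: L1_contraction_ae => //.
  - by apply: cintegrable_twist => //; exact: cintegrableD.
  - by apply: cintegrableD; exact: cintegrable_twist.
  - exact: twist_lin_ae.
apply: le_trans (Lb _ _) _; first exact: cintegrable_twist.
by apply: normL1_twist => //; exact: cintegrable_measurable fi.
Qed.

Lemma L1_contraction_iter n a b : measurable_fun setT a -> measurable_fun setT b ->
  L1_contraction (fun f => cint nu (iter n (twist a b) f)).
Proof.
move=> ma mb; elim: n => [|n IH]; first exact: L1_contraction_cint.
(* The new factor is peeled off next to [f], so that the induction hypothesis is a functional
   precomposed with [twist]. *)
by under eq_fun do rewrite iterSr; exact: L1_contraction_twist IH.
Qed.

End TwistedKernel.

(** * Gaussian approximation of the characteristic function *)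

Section ScalarRecursion.
Context {R : realType}.

Lemma cabs_sum (n : nat) (F : nat -> R[i]) :
  cabs (\sum_(i < n) F i) <= \sum_(i < n) cabs (F i).
Proof.
elim: n => [|n IH]; first by rewrite !big_ord0 cabs0.
by rewrite !big_ord_recr /= (le_trans (cabsD _ _))// lerD2r.
Qed.

Lemma affine_recursion_bound (b : nat -> R[i]) (s r : R) : 0 <= s <= 1 ->
  (forall k, cabs (b k.+1 - (1 - s)%:C * b k) <= r) ->
  forall n, cabs (b n - ((1 - s) ^+ n)%:C * b 0%N) <= n%:R * r.
Proof.
move=> s01 H; elim => [|n IH]; first by rewrite expr0 mul1r subrr cabs0 mul0r.
have -> : b n.+1 - ((1 - s) ^+ n.+1)%:C * b 0%N =
    (b n.+1 - (1 - s)%:C * b n) + (1 - s)%:C * (b n - ((1 - s) ^+ n)%:C * b 0%N).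
  by rewrite exprS rmorphM /=; ring.
rewrite (le_trans (cabsD _ _))// -natr1 mulrDl mul1r addrC lerD//.
rewrite cabsM cabs_real ger0_norm; last lra.
by rewrite (le_trans _ IH)// ler_piMl ?cabs_ge0//; lra.
Qed.

(* With [beta k = sum_(p < P) al k p], the sequence [b k - v * beta k] satisfies
   an affine recursion up to an error without the term [v * al k 0]. *)
Lemma coboundary_recursion_bound (b : nat -> R[i]) (al : nat -> nat -> R[i])
    (w : nat -> R) (s v r eps W : R) (P : nat) :
  0 <= s <= 1 -> 0 <= v -> (forall k p, cabs (al k p) <= 2 * w p) ->
  (forall k p, cabs (al k p.+1 - al k.+1 p) <= eps * w p) -> 0 <= eps ->
  \sum_(p < P) w p <= W -> b 0%N = 1 ->
  (forall k, cabs (b k.+1 - ((1 - s)%:C * b k - v%:C * al k 0%N)) <= r) ->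
  forall n, cabs (b n - ((1 - s) ^+ n)%:C) <=
    n%:R * (r + v * (2 * w P) + v * (eps * W) + s * (v * (2 * W))) + 4 * (v * W).
Proof.
move=> s01 v0 alw ale eps0 wW b0 Hb n.
pose be k := \sum_(p < P) al k p.
have beW k : cabs (be k) <= 2 * W.
  rewrite (le_trans (@cabs_sum P (al k)))//.
  apply: (@le_trans _ _ (\sum_(p < P) 2 * w p)); first by apply: ler_sum => p _.
  by rewrite -mulr_sumr ler_pM2l.
pose b' k := b k - v%:C * be k.
have W0 : 0 <= W by have := beW 0%N; have := cabs_ge0 (be 0%N); lra.
have Hb' k : cabs (b' k.+1 - (1 - s)%:C * b' k) <=
    r + v * (2 * w P) + v * (eps * W) + s * (v * (2 * W)).
  pose e := \sum_(p < P) (al k p.+1 - al k.+1 p).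
  have eW : cabs e <= eps * W.
    rewrite (le_trans (@cabs_sum P (fun p => al k p.+1 - al k.+1 p)))//.
    apply: (@le_trans _ _ (\sum_(p < P) eps * w p)); first by apply: ler_sum => p _.
    by rewrite -mulr_sumr ler_wpM2l.
  (* A telescoping identity. In the application [al k p = nu (R^k Q^p psi)], so [e] collects the
     cost of replacing one [Q] by [R], and [al k P] is the tail of the truncated corrector. *)
  have eE : al k 0%N = be k - be k.+1 + al k P - e.
    rewrite /e /be sumrB.
    have : \sum_(p < P) al k p + al k P = al k 0%N + \sum_(p < P) al k p.+1.
      transitivity (\sum_(p < P.+1) al k p); first by rewrite big_ord_recr.
      by rewrite big_ord_recl.
    set X := \sum_(p < P) al k p; set Y := \sum_(p < P) al k p.+1.
    by move=> XY; rewrite -(addKr X (al k P)) XY; ring.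
  (* The last term appears because the recursion multiplies [be k] by [1 - s], while the telescoping
     produces [be k] with coefficient 1. *)
  have -> : b' k.+1 - (1 - s)%:C * b' k =
      (b k.+1 - ((1 - s)%:C * b k - v%:C * al k 0%N)) - v%:C * al k P
      + v%:C * e - s%:C * (v%:C * be k).
    by rewrite /b' eE rmorphB rmorph1; ring.
  have N := @cabsN R.
  apply: (le_trans (cabsD _ _)); apply: lerD; last first.
    have s0 : 0 <= s by lra.
    by rewrite N !cabsM !cabs_real !ger0_norm// ler_wpM2l// ler_wpM2l.
  apply: (le_trans (cabsD _ _)); apply: lerD; last first.
    by rewrite cabsM cabs_real ger0_norm// ler_wpM2l.
  apply: (le_trans (cabsD _ _)); apply: lerD; first exact: Hb.
  by rewrite N cabsM cabs_real ger0_norm// ler_wpM2l.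
have := affine_recursion_bound s01 Hb' n.
have -> : b n - ((1 - s) ^+ n)%:C =
    (b' n - ((1 - s) ^+ n)%:C * b' 0%N) + (v%:C * be n - ((1 - s) ^+ n)%:C * (v%:C * be 0%N)).
  by rewrite /b' b0; ring.
move=> H; rewrite (le_trans (cabsD _ _))//; apply: lerD => //.
have H1 k : cabs (v%:C * be k) <= 2 * (v * W).
  by rewrite cabsM cabs_real ger0_norm// mulrCA ler_wpM2l.
have -> : 4 * (v * W) = 2 * (v * W) + 2 * (v * W) by ring.
rewrite (le_trans (cabsD _ _))// lerD// cabsN cabsM cabs_real.
rewrite (le_trans _ (H1 0%N))// ler_piMl ?cabs_ge0// ger0_norm ?exprn_ge0//; last lra.
by rewrite exprn_ile1//; lra.
Qed.

Lemma expR_taylor1 (s : R) : 0 <= s -> 0 <= expR (- s) - (1 - s) <= s ^+ 2.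
Proof.
move=> s0; have h1 := expR_ge1Dx (- s); apply/andP; split; first lra.
have h2 := expR_ge1Dx s.
have h3 : expR (- s) <= (1 + s)^-1 by rewrite expRN lef_pV2 ?posrE ?expR_gt0//; lra.
have h4 : (1 + s)^-1 - (1 - s) = s ^+ 2 / (1 + s) by field; lra.
have : s ^+ 2 / (1 + s) <= s ^+ 2.
  by rewrite ler_pdivrMr; [rewrite ler_peMr ?sqr_ge0//; lra|lra].
lra.
Qed.

Lemma expr_expR_bound (s : R) n : 0 <= s <= 1 ->
  `|(1 - s) ^+ n - expR (- (n%:R * s))| <= n%:R * s ^+ 2.
Proof.
move=> s01; have s0 : 0 <= s by lra.
have /andP[h1 h2] := expR_taylor1 s0.
elim: n => [|n IH]; first by rewrite expr0 mul0r oppr0 expR0 subrr normr0 mul0r.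
have -> : expR (- (n.+1%:R * s)) = expR (- s) * expR (- (n%:R * s)).
  by rewrite -expRD -natr1; congr expR; ring.
rewrite exprS.
have -> : (1 - s) * (1 - s) ^+ n - expR (- s) * expR (- (n%:R * s)) =
   (1 - s) * ((1 - s) ^+ n - expR (- (n%:R * s))) -
   (expR (- s) - (1 - s)) * expR (- (n%:R * s)) by ring.
have -> : n.+1%:R * s ^+ 2 = n%:R * s ^+ 2 + s ^+ 2 by rewrite -natr1; ring.
rewrite (le_trans (ler_normB _ _))// lerD//.
  rewrite normrM ger0_norm; last lra.
  by rewrite (le_trans _ IH)// ler_piMl//; lra.
rewrite normrM [X in X * _]ger0_norm// ger0_norm ?expR_ge0//.
rewrite (le_trans _ h2)// ler_piMr// expR_le1 oppr_le0.
by rewrite mulr_ge0.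
Qed.

End ScalarRecursion.

(** * Third-order expansion of a characteristic function *)

Section CharacteristicTaylor.
Context {R : realType} {d : measure_display} {E : measurableType d}.

(** Young's inequality with exponents 3 and 3/2, where [b * Num.sqrt b] is [b^(3/2)]; the cases
    [b <= w * a ^+ 2] and its converse each use one term. The weight [w] will be at least the
    [L^(3/2)] norm of [b], which makes both terms integrate to [O(w)]. *)
Lemma young_three_halves (a b w : R) : 0 <= a -> 0 <= b -> 0 < w ->
  a * b <= w * a ^+ 3 + b * Num.sqrt b / Num.sqrt w.
Proof.
move=> a0 b0 w0; have sw : 0 < Num.sqrt w by rewrite sqrtr_gt0.
have [bw|/ltW bw] := leP b (w * a ^+ 2).
  apply: (@le_trans _ _ (w * a ^+ 3)).
    have -> : w * a ^+ 3 = a * (w * a ^+ 2) by ring.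
    exact: ler_wpM2l.
  by rewrite lerDl !mulr_ge0 ?sqrtr_ge0// invr_ge0 sqrtr_ge0.
apply: (@le_trans _ _ (b * Num.sqrt b / Num.sqrt w)); last first.
  by rewrite lerDr mulr_ge0 ?exprn_ge0// ltW.
rewrite mulrC -mulrA ler_wpM2l// ler_pdivlMr// mulrC.
have -> : Num.sqrt w * a = Num.sqrt (w * a ^+ 2).
  by rewrite sqrtrM ?ltW// sqrtr_sqr ger0_norm.
by rewrite ler_sqrt.
Qed.

Lemma cube_dominates (a : R) : `|a| <= 1 + `|a| ^+ 3 /\ a ^+ 2 <= 1 + `|a| ^+ 3.
Proof.
have H (x : R) : 0 <= x -> x <= 1 + x ^+ 3 /\ x ^+ 2 <= 1 + x ^+ 3.
  by move=> x0; split; have [x1|/ltW x1] := leP x 1; nra.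
by have [h1] := H _ (normr_ge0 a); rewrite real_normK ?num_real.
Qed.

Lemma cube_addl (a b : R) : 0 <= a -> 0 <= b -> (a + b) ^+ 3 <= 4 * (a ^+ 3 + b ^+ 3).
Proof.
move=> a0 b0; rewrite -subr_ge0.
have -> : 4 * (a ^+ 3 + b ^+ 3) - (a + b) ^+ 3 = 3 * ((a + b) * (a - b) ^+ 2) by ring.
by apply: mulr_ge0 => //; apply: mulr_ge0; [exact: addr_ge0|exact: sqr_ge0].
Qed.

Variable m : {measure set E -> \bar R}.
Hypothesis m1 : m setT = 1%E.

Lemma cube_integrable (g : E -> R) : measurable_fun setT g ->
  (\int[m]_y (`|g y| ^+ 3)%:E < +oo)%E ->
  m.-integrable setT (fun y => (g y)%:E) /\ m.-integrable setT (fun y => (g y ^+ 2)%:E).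
Proof.
move=> mg g3.
have mag : measurable_fun setT (fun y => `|g y|) by exact: measurableT_comp.
have bi : m.-integrable setT (fun y => (1 + `|g y| ^+ 3)%:E).
  apply/integrableP; split.
    by apply/measurable_EFinP/measurable_funD => //; exact: measurable_funX.
  under eq_integral => x _ do
    rewrite gee0_abs ?lee_fin ?addr_ge0 ?exprn_ge0// EFinD.
  have m3 : measurable_fun setT (fun x => (`|g x| ^+ 3)%:E).
    by apply/measurable_EFinP; exact: measurable_funX.
  have p3 x : (0 <= (`|g x| ^+ 3)%:E)%E by rewrite lee_fin exprn_ge0.
  rewrite ge0_integralD//.
  by rewrite integral_cst// m1 mule1 lte_add_pinfty// ltry.
split; apply: le_integrable bi => //.
- exact/measurable_EFinP.
- move=> x _; rewrite /= lee_fin [X in _ <= X]ger0_norm ?addr_ge0 ?exprn_ge0//.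
  by have [] := cube_dominates (g x).
- by apply/measurable_EFinP/measurable_funX.
- move=> x _; rewrite /= lee_fin [X in _ <= X]ger0_norm ?addr_ge0 ?exprn_ge0//.
  by rewrite ger0_norm ?sqr_ge0//; have [] := cube_dominates (g x).
Qed.

Lemma fin_RintegralZ (a : R) (h : E -> R) : m.-integrable setT (fun x => (h x)%:E) ->
  Rintegral m setT (fun x => a * h x) = a * Rintegral m setT h.
Proof. by move=> hi; rewrite RintegralZl. Qed.

Lemma fin_RintegralD (h k : E -> R) : m.-integrable setT (fun x => (h x)%:E) ->
  m.-integrable setT (fun x => (k x)%:E) ->
  Rintegral m setT (fun x => h x + k x) = Rintegral m setT h + Rintegral m setT k.
Proof. by move=> hi ki; rewrite RintegralD. Qed.

Lemma fin_RintegralB (h k : E -> R) : m.-integrable setT (fun x => (h x)%:E) ->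
  m.-integrable setT (fun x => (k x)%:E) ->
  Rintegral m setT (fun x => h x - k x) = Rintegral m setT h - Rintegral m setT k.
Proof. by move=> hi ki; rewrite RintegralB. Qed.

Lemma fin_integrable_cst (a : R) : m.-integrable setT (fun _ => a%:E).
Proof.
apply/integrableP; split; first exact: measurable_cst.
by rewrite /= (integral_cst m measurableT `|a|%:E) m1 mule1 ltry.
Qed.

Lemma cint_cexpi_taylor (g : E -> R) (u c : R) : measurable_fun setT g ->
  (\int[m]_y (`|g y| ^+ 3)%:E < +oo)%E -> Rintegral m setT g = c ->
  ((cabs (cexpi (- (u * c)) * cint m (fun y => cexpi (u * g y)) -
         (1 - u ^+ 2 / 2 * (Rintegral m setT (fun y => (g y ^+ 2)%R) - c ^+ 2))%R%:C)%R)%:E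
   <= (8 * `|u| ^+ 3)%:E * (\int[m]_y (`|g y| ^+ 3)%:E + (`|c| ^+ 3)%:E))%E.
Proof.
move=> mg g3 cE; have [g1 g2] := cube_integrable mg g3.
have cs := fin_integrable_cst.
pose A y := cexpi (u * g y - u * c).
pose b y := u * g y - u * c.
have mb : measurable_fun setT b.
  by apply: measurable_funB => //; apply: measurable_funM.
(* [B] is the second-order Taylor polynomial of [cexpi] at 0, taken at [b y]. Its imaginary part
   integrates to 0 because [c] is the mean of [g]. *)
pose B y : R[i] := ((1 - u ^+ 2 / 2 * (g y ^+ 2 - 2 * c * g y + c ^+ 2)) +i* b y).
have mA : cmeasurable A by exact: cmeasurable_cexpi.
have Ai : cintegrable m A.
  apply: (@cintegrable_bounded _ _ _ m A 1) => //; first by rewrite m1 ltry.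
  by move=> y; rewrite cabs_cexpi.
have qi : m.-integrable setT (fun y => (g y ^+ 2 - 2 * c * g y + c ^+ 2)%:E).
  by apply: fin_integrableD => //; apply: fin_integrableB => //; exact: fin_integrableZ.
have Bi : cintegrable m B.
  split => /=; apply: fin_integrableB => //; exact: fin_integrableZ.
have R1 (a : R) : Rintegral m setT (fun _ => a) = a.
  by rewrite Rintegral_cst// m1 /= mulr1.
have -> : cexpi (- (u * c)) * cint m (fun y => cexpi (u * g y)) = cint m A.
  rewrite -cintZ; last first.
    apply: (@cintegrable_bounded _ _ _ m _ 1); first by rewrite m1 ltry.
    - by apply: cmeasurable_cexpi; exact: measurable_funM.
    - by move=> y; rewrite cabs_cexpi.
  by congr (cint m _); apply/funext => y; rewrite /A -cexpiD addrC.
have -> : (1 - u ^+ 2 / 2 * (Rintegral m setT (fun y => g y ^+ 2) - c ^+ 2))%:C = cint m B.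
  apply: complex_eq; rewrite ?cint_ReE ?cint_ImE /=.
    rewrite (fin_RintegralB (cs 1) (fin_integrableZ (u ^+ 2 / 2) qi)).
    rewrite R1 (fin_RintegralZ _ qi).
    rewrite (fin_RintegralD (fin_integrableB g2 (fin_integrableZ (2 * c) g1)) (cs _)).
    rewrite (fin_RintegralB g2 (fin_integrableZ (2 * c) g1)).
    by rewrite R1 (fin_RintegralZ _ g1) cE; ring.
  rewrite (fin_RintegralB (fin_integrableZ u g1) (cs _)) (fin_RintegralZ _ g1).
  by rewrite R1 cE subrr.
apply: (le_trans (le_cint_sub Ai Bi)).
have mag : measurable_fun setT (fun y => `|g y| ^+ 3).
  by apply: measurable_funX; exact: measurableT_comp.
have -> : ((8 * `|u| ^+ 3)%:E * (\int[m]_y (`|g y| ^+ 3)%:E + (`|c| ^+ 3)%:E) =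
   \int[m]_y (8 * `|u| ^+ 3 * (`|g y| ^+ 3 + `|c| ^+ 3))%:E)%E.
  under [RHS]eq_integral do rewrite EFinM EFinD.
  have p3 (a : R) : (0 <= (`|a| ^+ 3)%:E)%E by rewrite lee_fin exprn_ge0.
  have m3 : measurable_fun setT (fun y => (`|g y| ^+ 3)%:E) by exact/measurable_EFinP.
  have m3c : measurable_fun setT (fun y => ((`|g y| ^+ 3)%:E + (`|c| ^+ 3)%:E)%E).
    exact: emeasurable_funD.
  rewrite (ge0_integralZl_EFin m measurableT _ m3c) ?mulr_ge0 ?exprn_ge0//.
    by rewrite ge0_integralD// integral_cst// m1 mule1.
  by move=> x _; rewrite adde_ge0.
apply: normL1_le.
- by apply: cmeasurableB => //; exact: cintegrable_measurable Bi.
- by apply: measurable_funM => //; exact: measurable_funD.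
- move=> y; have [_ _ h3 h4] := cos_sin_taylor (b y).
  rewrite (le_trans (cabs_le_ReIm _))// ReD ImD ReN ImN /A Re_cexpi Im_cexpi /=.
  have -> : cos (u * g y - u * c) - (1 - u ^+ 2 / 2 * (g y ^+ 2 - 2 * c * g y + c ^+ 2)) =
     cos (b y) - 1 + b y ^+ 2 / 2 by rewrite /b; field.
  apply: (@le_trans _ _ (2 * `|b y| ^+ 3)).
    by rewrite -/(b y); lra.
  have h : `|b y| <= `|u| * (`|g y| + `|c|).
    by rewrite /b -mulrBr normrM ler_wpM2l// ler_normB.
  have h' : `|b y| ^+ 3 <= (`|u| * (`|g y| + `|c|)) ^+ 3.
    by apply: lerXn2r; rewrite ?nnegrE ?mulr_ge0 ?addr_ge0.
  (* The constant 8 is 2 for the real and imaginary parts times 4 from this inequality. *)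
  have h2 := cube_addl (normr_ge0 (g y)) (normr_ge0 c).
  rewrite exprMn in h'.
  have h6 : `|u| ^+ 3 * (`|g y| + `|c|) ^+ 3 <= `|u| ^+ 3 * (4 * (`|g y| ^+ 3 + `|c| ^+ 3)).
    by rewrite ler_wpM2l// exprn_ge0.
  lra.
Qed.

End CharacteristicTaylor.

(** * One-step estimates for the conjugated kernel in [L^1(nu)] *)

Section Lindeberg.
Context {R : realType} {d : measure_display} {E : measurableType d}.
Variables (Q : R.-pker E ~> E) (nu : probability E R).
Hypothesis Hinv : forall A : set E, measurable A -> nu A = (\int[nu]_x Q x A)%E.
Variables (g h : E -> R).
Hypotheses (mg : measurable_fun setT g) (mh : measurable_fun setT h).
Hypothesis gh : forall x, Rintegral (Q x) setT g = h x.
Variables (G3 H3 : R).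
Hypothesis HG3 : (\int[nu]_x (`|g x| ^+ 3)%:E = G3%:E)%E.
Hypothesis HH3 : (\int[nu]_x (`|h x| ^+ 3)%:E = H3%:E)%E.

Let m3 (k : E -> R) : measurable_fun setT k ->
  measurable_fun setT (fun y => (`|k y| ^+ 3)%:E).
Proof.
by move=> mk; apply/measurable_EFinP; apply: measurable_funX; exact: measurableT_comp.
Qed.

Let p3 (k : E -> R) y : (0 <= (`|k y| ^+ 3)%:E)%E.
Proof. by rewrite lee_fin exprn_ge0. Qed.

Let R_ u := twist Q (fun y => u * g y) (fun y => - (u * h y)).

Let mug u : measurable_fun setT (fun y => u * g y).
Proof. exact: measurable_funM. Qed.
Let muh u : measurable_fun setT (fun y => - (u * h y)).
Proof. by apply: measurableT_comp => //; exact: measurable_funM. Qed.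

Let G30 : 0 <= G3.
Proof. by rewrite -lee_fin -HG3 integral_ge0. Qed.
Let H30 : 0 <= H3.
Proof. by rewrite -lee_fin -HH3 integral_ge0. Qed.

(** By [psiE] the conditional variance of [g] under [Q x] is [sigma2 + psi x], so the expansion
    applies at almost every [x]. Invariance turns the integral of the conditional third moments into
    [G3]. *)
Lemma twist_one_taylor (u sigma2 : R) (psi : E -> R[i]) : cmeasurable psi ->
  {ae nu, forall x, psi x =
    (Rintegral (Q x) setT (fun y => g y ^+ 2) - h x ^+ 2 - sigma2)%:C} ->
  (normL1 nu (fun x => (R_ u (fun _ => 1) x -
      ((1 - u ^+ 2 / 2 * sigma2)%:C - (u ^+ 2 / 2)%:C * psi x))%R)
   <= (8 * `|u| ^+ 3 * (G3 + H3))%:E)%E.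
Proof.
move=> mpsi psiE; pose c8 := 8 * `|u| ^+ 3.
have c80 : 0 <= c8 by rewrite mulr_ge0// exprn_ge0.
have mI : measurable_fun setT (fun x => \int[Q x]_y (`|g y| ^+ 3)%:E)%E.
  by apply: measurable_kernel_integral => //; exact: m3.
have mS : measurable_fun setT
    (fun x => \int[Q x]_y (`|g y| ^+ 3)%:E + (`|h x| ^+ 3)%:E)%E.
  by apply: emeasurable_funD => //; exact: m3.
have S0 x : (0 <= \int[Q x]_y (`|g y| ^+ 3)%:E + (`|h x| ^+ 3)%:E)%E.
  by rewrite adde_ge0// integral_ge0.
have -> : ((c8 * (G3 + H3))%:E =
    \int[nu]_x (c8%:E * (\int[Q x]_y (`|g y| ^+ 3)%:E + (`|h x| ^+ 3)%:E)))%E.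
  rewrite (ge0_integralZl_EFin nu measurableT _ mS)//.
  rewrite ge0_integralD//; [|by move=> x _; exact: integral_ge0|exact: m3].
  by rewrite (integral_kernel_inv Hinv)//; [rewrite HG3 HH3 -EFinD -EFinM|exact: m3].
apply: ae_ge0_le_integral => //.
- by move=> x _; rewrite lee_fin cabs_ge0.
- apply/measurable_EFinP/measurable_cabs; apply: cmeasurableB.
    by apply: cmeasurable_twist => //; exact: cmeasurable_cst.
  apply: cmeasurableB; first exact: cmeasurable_cst.
  by apply: cmeasurableM => //; exact: cmeasurable_cst.
- by move=> x _; rewrite mule_ge0.
- exact: measurable_funeM.
have := ae_kernel_fin Hinv (p3 g) (m3 mg); rewrite HG3 ltry => /(_ isT).
apply: filterS2 psiE => x psix g3 _.
have := cint_cexpi_taylor (kernel_total Q x) u mg g3 (gh x).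
apply: le_trans; rewrite lee_fin /R_ /twist psix /kop.
under [in leLHS]eq_fun do rewrite mulr1.
rewrite le_eqVlt; apply/orP; left; apply/eqP; congr cabs; congr (_ - _).
by rewrite -rmorphM -rmorphB /=; congr (_ %:C); ring.
Qed.

(** The second term of [young_three_halves] with [b = |f|]. Its integral is at most [w] as soon as
    the [L^(3/2)] norm of [f] is at most [w]. *)
Let phi w f (y : E) : R := cabs (f y) * Num.sqrt (cabs (f y)) / Num.sqrt w.

Let mphi w f : cmeasurable f -> measurable_fun setT (fun y => phi w f y).
Proof.
move=> /measurable_cabs mf; apply: measurable_funM => //.
apply: measurable_funM => //; apply: (measurableT_comp _ mf).
by apply: continuous_measurable_fun; exact: sqrt_continuous.
Qed.

Let phi0 w f y : 0 <= phi w f y.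
Proof. by rewrite !mulr_ge0 ?cabs_ge0 ?sqrtr_ge0// invr_ge0 sqrtr_ge0. Qed.

Let int_phi (w : R) f : 0 < w -> cmeasurable f ->
  (\int[nu]_x (cabs (f x) * Num.sqrt (cabs (f x)))%:E <= (w * Num.sqrt w)%:E)%E ->
  (\int[nu]_x (phi w f x)%:E <= w%:E)%E.
Proof.
move=> w0 mf fw; have sw : 0 < Num.sqrt w by rewrite sqrtr_gt0.
have mf' : measurable_fun setT (fun x => (cabs (f x) * Num.sqrt (cabs (f x)))%:E).
  apply/measurable_EFinP; apply: measurable_funM; first exact: measurable_cabs.
  apply: (measurableT_comp _ (measurable_cabs mf)).
  by apply: continuous_measurable_fun; exact: sqrt_continuous.
rewrite /phi; under eq_integral => x _ do rewrite mulrC EFinM.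
rewrite (ge0_integralZl_EFin nu measurableT _ mf') ?invr_ge0 ?sqrtr_ge0//; last first.
  by move=> x _; rewrite lee_fin mulr_ge0 ?cabs_ge0 ?sqrtr_ge0.
apply: le_trans (lee_wpmul2l _ fw) _; first by rewrite lee_fin invr_ge0 sqrtr_ge0.
by rewrite -EFinM lee_fin mulrCA mulVf ?mulr1// gt_eqF.
Qed.

(** The case [a = 1] of Young's inequality; it replaces Hölder's inequality at the price of a
    harmless factor 2. *)
Lemma normL1_three_halves f (w : R) : 0 < w -> cmeasurable f ->
  (\int[nu]_x (cabs (f x) * Num.sqrt (cabs (f x)))%:E <= (w * Num.sqrt w)%:E)%E ->
  (normL1 nu f <= (2 * w)%:E)%E.
Proof.
move=> w0 mf fw; have mp := mphi w mf.
apply: (@le_trans _ _ (\int[nu]_x (w + phi w f x)%:E)%E).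
  apply: normL1_le => //; first exact: measurable_funD.
  move=> x; have := young_three_halves ler01 (cabs_ge0 (f x)) w0.
  by rewrite mul1r expr1n mulr1.
under eq_integral do rewrite EFinD.
have mpe : measurable_fun setT (fun y => (phi w f y)%:E) by exact/measurable_EFinP.
have p0 y : (0 <= (phi w f y)%:E)%E by rewrite lee_fin phi0.
have w0' : (0 <= w%:E)%E by rewrite lee_fin ltW.
rewrite ge0_integralD// integral_cst// [X in (_ * X + _)%E](probability_setT nu).
rewrite mule1 mulr2n mulrDl mul1r EFinD leeD2l//.
exact: int_phi.
Qed.

(** The integrand [(cexpi (u * (g y - h x)) - 1) * f y] is at most [2 |u| (|g y| + |h x|) |f y|], to
    which Young's inequality applies twice. Linearity of the bound in [w] is what makes the errors
    of all [Q^p psi] summable under (H2). *)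
Lemma normL1_kop_twist_sub f (w u : R) : 0 < w -> cmeasurable f ->
  (\int[nu]_x (cabs (f x) * Num.sqrt (cabs (f x)))%:E <= (w * Num.sqrt w)%:E)%E ->
  (normL1 nu (fun x => (kop Q f x - R_ u f x)%R) <=
   (2 * `|u| * (G3 + H3 + 2) * w)%:E)%E.
Proof.
move=> w0 mf fw.
have fi : cintegrable nu f.
  apply: cintegrableP => //; apply: (le_lt_trans (normL1_three_halves w0 mf fw)).
  exact: ltry.
have mp := mphi w mf; have mag := m3 mg; have mah := m3 mh.
pose k y := w * `|g y| ^+ 3 + 2 * phi w f y.
have k0 y : (0 <= (k y)%:E)%E.
  rewrite lee_fin; apply: addr_ge0.
    by apply: mulr_ge0; [exact: ltW|exact: exprn_ge0].
  by apply: mulr_ge0 => //; exact: phi0.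
have mk : measurable_fun setT (fun y => (k y)%:E).
  apply/measurable_EFinP; apply: measurable_funD; apply: measurable_funM => //.
  exact/measurable_EFinP.
have wh0 x : (0 <= (w * `|h x| ^+ 3)%:E)%E by rewrite lee_fin mulr_ge0 ?exprn_ge0// ltW.
have mwh : measurable_fun setT (fun x => (w * `|h x| ^+ 3)%:E).
  by apply/measurable_EFinP; apply: measurable_funM => //; exact/measurable_EFinP.
have mI : measurable_fun setT (fun x => \int[Q x]_y (k y)%:E)%E.
  exact: measurable_kernel_integral.
have mS : measurable_fun setT (fun x => (w * `|h x| ^+ 3)%:E + \int[Q x]_y (k y)%:E)%E.
  exact: emeasurable_funD.
have u20 : 0 <= 2 * `|u| by rewrite mulr_ge0.
apply: (@le_trans _ _
    (\int[nu]_x ((2 * `|u|)%:E * ((w * `|h x| ^+ 3)%:E + \int[Q x]_y (k y)%:E)))%E).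
  apply: ae_ge0_le_integral => //.
  - by move=> x _; rewrite lee_fin cabs_ge0.
  - apply/measurable_EFinP/measurable_cabs; apply: cmeasurableB.
      exact: cmeasurable_kop.
    exact: cmeasurable_twist.
  - by move=> x _; rewrite mule_ge0// adde_ge0// integral_ge0.
  - exact: measurable_funeM.
  apply: filterS (ae_cintegrable Hinv fi) => x fx _.
  have ex : cintegrable (Q x) (fun y => cexpi (u * g y) * f y).
    exact: cintegrable_cexpiM.
  rewrite /R_ /twist /kop -cintZ//.
  apply: (le_trans (le_cint_sub fx _)).
    by apply: (cintegrable_cexpiM (a := fun _ => - (u * h x))) => //; exact: measurable_cst.
  have -> : ((w * `|h x| ^+ 3)%:E + \int[Q x]_y (k y)%:E =
      \int[Q x]_y (w * `|h x| ^+ 3 + k y)%:E)%E.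
    under [RHS]eq_integral do rewrite EFinD.
    rewrite ge0_integralD// integral_cst//.
    by rewrite [X in (_ * X)%E](kernel_total Q x) mule1.
  rewrite -(ge0_integralZl_EFin (Q x) measurableT)//; last 2 first.
  - by move=> y _; rewrite EFinD adde_ge0.
  - by under eq_fun do rewrite EFinD; exact: emeasurable_funD.
  under [leRHS]eq_integral do rewrite -EFinM.
  apply: normL1_le.
  - apply: cmeasurableB => //; apply: cmeasurableM; first exact: cmeasurable_cst.
    exact: cmeasurable_cexpiM.
  - apply: measurable_funM => //; apply: measurable_funD => //.
    exact/measurable_EFinP.
  move=> y.
  have -> : f y - cexpi (- (u * h x)) * (cexpi (u * g y) * f y) =
            - ((cexpi (u * g y - u * h x) - 1) * f y).
    by rewrite cexpiD; ring.
  rewrite cabsN cabsM.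
  apply: (@le_trans _ _ (2 * `|u| * (`|g y| + `|h x|) * cabs (f y))).
    apply: ler_wpM2r; first exact: cabs_ge0.
    apply: (le_trans (cabs_cexpi_sub1 _)); rewrite -mulrBr normrM.
    by rewrite mulrA ler_wpM2l// ler_normB.
  rewrite -mulrA ler_wpM2l// mulrDl /k.
  have := young_three_halves (normr_ge0 (g y)) (cabs_ge0 (f y)) w0.
  have := young_three_halves (normr_ge0 (h x)) (cabs_ge0 (f y)) w0.
  by rewrite -/(phi w f y); lra.
rewrite (ge0_integralZl_EFin nu measurableT _ mS)//; last first.
  by move=> x _; rewrite adde_ge0// integral_ge0.
have -> : 2 * `|u| * (G3 + H3 + 2) * w = 2 * `|u| * ((G3 + H3 + 2) * w) by ring.
rewrite [leRHS]EFinM lee_wpmul2l ?lee_fin//.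
rewrite ge0_integralD//; last by move=> x _; exact: integral_ge0.
rewrite (integral_kernel_inv Hinv)//.
have Zw (q : E -> R) : measurable_fun setT (fun x => (`|q x| ^+ 3)%:E) ->
    (\int[nu]_x (w * `|q x| ^+ 3)%:E = w%:E * \int[nu]_x (`|q x| ^+ 3)%:E)%E.
  move=> mq; under eq_integral do rewrite EFinM.
  by rewrite (ge0_integralZl_EFin nu measurableT _ mq) ?ltW.
have -> : (\int[nu]_x (k x)%:E = w%:E * G3%:E + 2%:E * \int[nu]_x (phi w f x)%:E)%E.
  rewrite -HG3 -Zw// -(ge0_integralZl_EFin nu measurableT)//; last 2 first.
  - by move=> x _; rewrite lee_fin phi0.
  - exact/measurable_EFinP.
  rewrite -ge0_integralD//.
  - by move=> x _; rewrite lee_fin mulr_ge0 ?exprn_ge0// ltW.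
  - by apply/measurable_EFinP; apply: measurable_funM => //; exact/measurable_EFinP.
  - by move=> x _; rewrite mule_ge0// lee_fin phi0.
  - by apply: measurable_funeM; exact/measurable_EFinP.
rewrite Zw// HH3 -!EFinM.
have -> : (G3 + H3 + 2) * w = w * H3 + (w * G3 + 2 * w) by ring.
rewrite !EFinD leeD2l// leeD2l// [leRHS]EFinM lee_wpmul2l ?lee_fin//.
exact: int_phi.
Qed.

End Lindeberg.

(** * Assembling the small-frequency estimate *)

Section LindebergBound.
Context {R : realType} {d : measure_display} {E : measurableType d}.
Variables (Q : R.-pker E ~> E) (nu : probability E R).
Hypothesis Hinv : forall A : set E, measurable A -> nu A = (\int[nu]_x Q x A)%E.
Variables (g h xi : E -> R).
Hypotheses (mg : measurable_fun setT g) (mh : measurable_fun setT h).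
Hypothesis gh : forall x, Rintegral (Q x) setT g = h x.
Hypothesis xiE : forall x, xi x = g x - h x.
Variables (G3 H3 : R).
Hypothesis HG3 : (\int[nu]_x (`|g x| ^+ 3)%:E = G3%:E)%E.
Hypothesis HH3 : (\int[nu]_x (`|h x| ^+ 3)%:E = H3%:E)%E.

Let one : E -> R[i] := fun _ => 1.

(** Conjugation leaves two boundary factors: [F = cexpi (u * h)] inside the iterate and its inverse
    outside. Removing each one costs the [L^1] norm of [one - F], since iterates are contractions in
    [L^1] and bounded by 1 pointwise. *)
Lemma coboundary_charfun_bound (u : R) n :
  cabs (cint nu (iter n (kopt Q xi u) one) -
        cint nu (iter n (twist Q (fun y => u * g y) (fun y => - (u * h y))) one))
  <= 4 * `|u| * (1 + H3).
Proof.
have mxi : measurable_fun setT xi.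
  by rewrite (_ : xi = fun x => g x - h x);
    [exact: measurable_funB|apply/funext => x; exact: xiE].
have mu (k : E -> R) : measurable_fun setT k -> measurable_fun setT (fun y => u * k y).
  by move=> mk; exact: measurable_funM.
have mNuh : measurable_fun setT (fun y => - (u * h y)).
  by apply: measurableT_comp => //; exact: mu.
have nu1 : ((nu : {measure set E -> \bar R}) setT < +oo)%E.
  by rewrite [X in (X < _)%E](probability_setT nu) ltry.
pose F y := cexpi (u * h y).
have mF : cmeasurable F by apply: cmeasurable_cexpi; exact: mu.
have F1 y : cabs (F y) <= 1 by rewrite cabs_cexpi.
have one1 (y : E) : cabs (one y) <= 1 by rewrite cabs1.
have m1 : cmeasurable one by exact: cmeasurable_cst.
have T := twist_kopt Q xi u.
have bd f : cmeasurable f -> (forall y, cabs (f y) <= 1) -> cintegrable nu f.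
  by move=> mf f1; exact: (cintegrable_bounded nu1 mf f1).
have [mTF TF1] := cabs_iter_twist_bounded Q n (mu xi mxi) (measurable_cst (0 : R)) mF F1.
have [mT1 T11] := cabs_iter_twist_bounded Q n (mu xi mxi) (measurable_cst (0 : R)) m1 one1.
have [mR R1] := cabs_iter_twist_bounded Q n (mu _ mg) mNuh m1 one1.
rewrite T.
have C := L1_contraction_iter Hinv n (mu xi mxi) (measurable_cst (0 : R)).
have h1 : (normL1 nu (fun x => (one x - F x)%R) <= (2 * `|u| * (1 + H3))%:E)%E.
  have mah : measurable_fun setT (fun x => (`|h x| ^+ 3)%:E).
    by apply/measurable_EFinP; apply: measurable_funX; exact: measurableT_comp.
  apply: (@le_trans _ _ (\int[nu]_x (2 * `|u| * (1 + `|h x| ^+ 3))%:E)%E).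
    apply: normL1_le; first exact: cmeasurableB.
      by apply: measurable_funM => //; apply: measurable_funD => //; exact/measurable_EFinP.
    move=> x; rewrite cabsB (le_trans (cabs_cexpi_sub1 _))// normrM mulrA ler_wpM2l ?mulr_ge0//.
    by have [] := cube_dominates (h x).
  have p3 x : (0 <= (`|h x| ^+ 3)%:E)%E by rewrite lee_fin exprn_ge0.
  under eq_integral do rewrite EFinM EFinD.
  rewrite (ge0_integralZl_EFin nu measurableT) ?mulr_ge0//; last 2 first.
  - by move=> x _; rewrite adde_ge0.
  - exact: emeasurable_funD.
  rewrite ge0_integralD// integral_cst// [X in (_ * X + _)%E](probability_setT nu).
  by rewrite mule1 HH3 -EFinD -EFinM.
have st1 : cabs (cint nu (iter n (twist Q (fun y => u * xi y) (fun=> 0)) one) -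
                 cint nu (iter n (twist Q (fun y => u * xi y) (fun=> 0)) F))
           <= 2 * `|u| * (1 + H3).
  rewrite -lee_fin; apply: le_trans h1.
  by apply: (L1_contraction_sub C); exact: bd.
have RE : iter n (twist Q (fun y => u * g y) (fun y => - (u * h y))) one =
    fun x => cexpi (- (u * h x)) * iter n (twist Q (fun y => u * xi y) (fun=> 0)) F x.
  have FE : (fun y => cexpi (u * h y) * one y) = F.
    by apply/funext => y; rewrite /one mulr1.
  by apply/funext => x; rewrite (iter_twist_conj Q u n one x xiE) -T FE.
have st2 : cabs (cint nu (iter n (twist Q (fun y => u * xi y) (fun=> 0)) F) -
      cint nu (iter n (twist Q (fun y => u * g y) (fun y => - (u * h y))) one))
      <= 2 * `|u| * (1 + H3).
  rewrite -lee_fin; apply: le_trans h1.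
  apply: (le_trans (le_cint_sub (bd _ mTF TF1) (bd _ mR R1))).
  apply: normL1_le; first exact: cmeasurableB.
    by apply: measurable_cabs; exact: cmeasurableB.
  move=> x; rewrite RE.
  set z := iter n _ F x.
  have -> : z - cexpi (- (u * h x)) * z = (cexpi (- (u * h x)) * (F x - 1)) * z.
    by rewrite mulrBr [cexpi _ * F x]mulrC cexpiN mulr1 mulrBl mul1r.
  rewrite !cabsM cabs_cexpi mul1r cabsB ler_piMr ?cabs_ge0//.
  exact: TF1.
have -> : 4 * `|u| * (1 + H3) = 2 * `|u| * (1 + H3) + 2 * `|u| * (1 + H3) by ring.
by apply: le_trans (lerD st1 st2); exact: cabs_triangle.
Qed.

Variables (psi : E -> R[i]) (sigma2 W : R) (w : nat -> R).
Hypothesis mpsi : cmeasurable psi.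
Hypothesis psiE : {ae nu, forall x, psi x =
  (Rintegral (Q x) setT (fun y => g y ^+ 2) - h x ^+ 2 - sigma2)%:C}.
Hypothesis sigma20 : 0 <= sigma2.
Hypothesis w0 : forall p, 0 < w p.
Hypothesis psiw : forall p, (\int[nu]_x (cabs (iter p (kop Q) psi x) *
  Num.sqrt (cabs (iter p (kop Q) psi x)))%:E <= (w p * Num.sqrt (w p))%:E)%E.
Hypothesis wW : forall P : nat, \sum_(p < P) w p <= W.
Hypothesis w_small : forall eps, 0 < eps -> exists P : nat, w P <= eps.

Lemma charfun_gaussian_bound : exists C : R, 0 <= C /\ forall (u : R) (n : nat),
  `|u| <= 1 -> u ^+ 2 / 2 * sigma2 <= 1 ->
  cabs (cint nu (iter n (kopt Q xi u) one) -
        (expR (- (n%:R * (u ^+ 2 / 2 * sigma2))))%:C)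
  <= C * (`|u| + n%:R * `|u| ^+ 3).
Proof.
have G30 : 0 <= G3.
  by rewrite -lee_fin -HG3 integral_ge0// => x _; rewrite lee_fin exprn_ge0.
have H30 : 0 <= H3.
  by rewrite -lee_fin -HH3 integral_ge0// => x _; rewrite lee_fin exprn_ge0.
have W0 : 0 <= W by have := wW 0; rewrite big_ord0.
(* The sum of all coefficients of [t] and of [N3] in the final expansion below, where [t] is [|u|]
   and [N3] is [n * t ^+ 3]. *)
exists (8 * (G3 + H3) + (G3 + H3 + 2) * W + sigma2 * W + sigma2 ^+ 2 + 2 * W + 4 * (1 + H3)).
split.
  by rewrite !addr_ge0 ?mulr_ge0 ?addr_ge0// sqr_ge0.
move=> u n u1 s1.
have mu (k : E -> R) : measurable_fun setT k -> measurable_fun setT (fun y => u * k y).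
  by move=> mk; exact: measurable_funM.
have mNuh : measurable_fun setT (fun y => - (u * h y)).
  by apply: measurableT_comp => //; exact: mu.
have mug := mu _ mg.
pose Ru := twist Q (fun y => u * g y) (fun y => - (u * h y)).
pose b k := cint nu (iter k Ru one).
pose al k p := cint nu (iter k Ru (iter p (kop Q) psi)).
have mp p : cmeasurable (iter p (kop Q) psi) by exact: cmeasurable_iter_kop.
have np p := normL1_three_halves (w0 p) (mp p) (psiw p).
have ip p : cintegrable nu (iter p (kop Q) psi).
  by apply: cintegrableP => //; apply: (le_lt_trans (np p)); exact: ltry.
have C k := L1_contraction_iter Hinv k mug mNuh.
have io : cintegrable nu one.
  apply: (cintegrable_bounded (M := 1)); last by move=> y; rewrite cabs1.
    by rewrite [X in (X < _)%E](probability_setT nu) ltry.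
  exact: cmeasurable_cst.
pose v := u ^+ 2 / 2; pose s := v * sigma2.
have v0 : 0 <= v by rewrite mulr_ge0// ?sqr_ge0// invr_ge0.
have s01 : 0 <= s <= 1 by rewrite s1 andbT mulr_ge0.
have alw k p : cabs (al k p) <= 2 * w p.
  by rewrite -lee_fin; apply: le_trans (np p); exact: (C k).2.
have ale k p : cabs (al k p.+1 - al k.+1 p) <= 2 * `|u| * (G3 + H3 + 2) * w p.
  (* With the extra factor moved next to [Q^p psi], the difference is the contraction [nu (R^k .)]
     evaluated at [Q (Q^p psi) - R (Q^p psi)]. *)
  have E1 : al k.+1 p = cint nu (iter k Ru (Ru (iter p (kop Q) psi))).
    exact: (f_equal (cint nu) (iterSr k Ru (iter p (kop Q) psi))).
  have K := normL1_kop_twist_sub Hinv mg mh HG3 HH3 u (w0 p) (mp p) (psiw p).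
  have iR := cintegrable_twist Hinv mug mNuh (ip p).
  by rewrite -lee_fin E1; exact: le_trans (L1_contraction_sub (C k) (ip p.+1) iR) K.
have b0 : b 0%N = 1.
  apply: complex_eq; rewrite -[b 0%N]/(cint nu one) ?cint_ReE ?cint_ImE Rintegral_cst//;
    by rewrite [X in fine X](probability_setT nu) /= mulr1.
have Hb k : cabs (b k.+1 - ((1 - s)%:C * b k - v%:C * al k 0%N)) <= 8 * `|u| ^+ 3 * (G3 + H3).
  have K := twist_one_taylor Hinv mg mh gh HG3 HH3 u mpsi psiE.
  have -> : b k.+1 = cint nu (iter k Ru (Ru one)).
    exact: (f_equal (cint nu) (iterSr k Ru one)).
  pose F x := - v%:C * psi x + (1 - s)%:C * one x.
  have i1 : cintegrable nu (fun x => (1 - s)%:C * one x + 0).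
    by apply: cintegrableD => //; split; exact: integrable0.
  have i1' : cintegrable nu (fun x => (1 - s)%:C * one x).
    by move: i1; under eq_fun do rewrite addr0.
  have iF : cintegrable nu F by apply: cintegrableD => //; exact: (ip 0%N).
  have -> : (1 - s)%:C * b k - v%:C * al k 0%N = cint nu (iter k Ru F).
    rewrite (C k).1//; last exact: (ip 0%N).
    have z0 : cintegrable nu (fun _ => 0) by split; exact: integrable0.
    have := (C k).1 (1 - s)%:C one (fun _ => 0) io z0.
    under [X in cint nu (iter k _ X)]eq_fun do rewrite addr0.
    have -> : cint nu (iter k Ru (fun _ => 0)) = 0.
      apply: cabs_eq0; apply/eqP; rewrite eq_le cabs_ge0 andbT -lee_fin.
      apply: le_trans ((C k).2 _ z0) _.
      by rewrite /normL1; under eq_integral do rewrite cabs0; rewrite integral0.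
    by rewrite addr0 => ->; rewrite /al /b /=; ring.
  have FE : (fun x => (Ru one x - ((1 - s)%:C - v%:C * psi x))%R) = (fun x => (Ru one x - F x)%R).
    by apply/funext => x; rewrite /F /one mulr1 mulNr; congr (_ - _); rewrite addrC.
  have iR := cintegrable_twist Hinv mug mNuh io.
  rewrite -lee_fin; apply: le_trans (L1_contraction_sub (C k) iR iF) _.
  by rewrite -FE.
have eps0 : 0 <= 2 * `|u| * (G3 + H3 + 2) by rewrite !mulr_ge0 ?addr_ge0.
have main P := coboundary_recursion_bound s01 v0 alw ale eps0 (wW P) b0 Hb n.
(* The truncation [P] is free, and only the tail term depends on it. A choice of [P] depending on
   [n] makes that term at most [e]; the added 1 in the denominator covers [n * v = 0]. *)
have {main} main : cabs (b n - ((1 - s) ^+ n)%:C) <=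
    n%:R * (8 * `|u| ^+ 3 * (G3 + H3) + v * (2 * `|u| * (G3 + H3 + 2) * W) +
            s * (v * (2 * W))) + 4 * (v * W).
  apply/ler_addgt0Pr => e e0.
  have nv0 : 0 <= n%:R * v by rewrite mulr_ge0.
  have nv : 0 < 1 + n%:R * v * 2 by lra.
  have [P wP] := w_small (divr_gt0 e0 nv).
  apply: (le_trans (main P)).
  have : n%:R * v * 2 * w P <= e.
    apply: (@le_trans _ _ (n%:R * v * 2 * (e / (1 + n%:R * v * 2)))).
      by rewrite ler_wpM2l//; lra.
    rewrite mulrCA -[leRHS]mulr1; apply: ler_wpM2l; first exact: ltW.
    by rewrite ler_pdivrMr// mul1r; lra.
  by lra.
have h1 := coboundary_charfun_bound u n; rewrite -/Ru -/(b n) in h1.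
have h2 := expr_expR_bound n s01.
have u0 := normr_ge0 u; have n0 : 0 <= n%:R :> R by [].
have uu : u ^+ 2 = `|u| ^+ 2 by rewrite real_normK ?num_real.
have T : cabs (cint nu (iter n (kopt Q xi u) one) - (expR (- (n%:R * s)))%:C) <=
   4 * `|u| * (1 + H3) + (n%:R * (8 * `|u| ^+ 3 * (G3 + H3) + v * (2 * `|u| * (G3 + H3 + 2) * W) +
            s * (v * (2 * W))) + 4 * (v * W)) + n%:R * s ^+ 2.
  rewrite -cabs_real rmorphB in h2.
  apply: (le_trans (cabs_triangle _ ((1 - s) ^+ n)%:C _)); apply: lerD => //.
  by apply: (le_trans (cabs_triangle _ (b n) _)); apply: lerD.
apply: (le_trans T).
set t := `|u| in u0 u1 uu *.
have vE : v = t ^+ 2 / 2 by rewrite /v uu.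
have t2 : t ^+ 2 <= t by rewrite expr2 ler_piMl.
have t4 : t ^+ 4 <= t ^+ 3 by rewrite exprS ler_piMl ?exprn_ge0.
pose N3 := n%:R * t ^+ 3.
have N30 : 0 <= N3 by rewrite mulr_ge0 ?exprn_ge0.
have N4 : n%:R * t ^+ 4 <= N3 by rewrite ler_wpM2l.
have -> : 4 * t * (1 + H3) +
  (n%:R * (8 * t ^+ 3 * (G3 + H3) + v * (2 * t * (G3 + H3 + 2) * W) + s * (v * (2 * W))) +
   4 * (v * W)) + n%:R * s ^+ 2 =
  8 * (G3 + H3) * N3 + (G3 + H3 + 2) * W * N3 + sigma2 * W * (n%:R * t ^+ 4) / 2 +
  sigma2 ^+ 2 * (n%:R * t ^+ 4) / 4 + 2 * W * t ^+ 2 + 4 * (1 + H3) * t.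
  by rewrite /s vE /N3; field.
have a1 : sigma2 * W * (n%:R * t ^+ 4) <= sigma2 * W * N3 by rewrite ler_wpM2l// mulr_ge0.
have a2 : sigma2 ^+ 2 * (n%:R * t ^+ 4) <= sigma2 ^+ 2 * N3 by rewrite ler_wpM2l// sqr_ge0.
have a3 : 2 * W * t ^+ 2 <= 2 * W * t by rewrite ler_wpM2l// mulr_ge0.
have b1 : 0 <= sigma2 * W * N3 by rewrite !mulr_ge0.
have b2 : 0 <= sigma2 ^+ 2 * N3 by rewrite mulr_ge0// sqr_ge0.
have b3 : 0 <= 8 * (G3 + H3) * t by rewrite !mulr_ge0 ?addr_ge0.
have b4 : 0 <= (G3 + H3 + 2) * W * t by rewrite !mulr_ge0 ?addr_ge0.
have b5 : 0 <= sigma2 * W * t by rewrite !mulr_ge0.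
have b6 : 0 <= sigma2 ^+ 2 * t by rewrite mulr_ge0// sqr_ge0.
have b7 : 0 <= 2 * W * N3 by rewrite !mulr_ge0.
have b8 : 0 <= 4 * (1 + H3) * N3 by rewrite !mulr_ge0 ?addr_ge0.
rewrite -/N3; lra.
Qed.

End LindebergBound.

(** * Gaussian decay of the characteristic function *)

Section Decay.
Context {R : realType} {d : measure_display} {E : measurableType d}.
Variables (Q : R.-pker E ~> E) (nu : probability E R).
Hypothesis Hinv : forall A : set E, measurable A -> nu A = (\int[nu]_x Q x A)%E.
Variables (xi : E -> R) (B : set (E -> R[i])) (nB : (E -> R[i]) -> R).
Hypotheses (mxi : measurable_fun setT xi) (HB : banach_fun_space B nB).
Hypothesis BQ : forall f, B f -> forall x, cintegrable (Q x) f.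

Let one : E -> R[i] := fun _ => 1.
Hypothesis B1 : B one.

Let Bm f : B f -> cmeasurable f.
Proof. by case: HB => -[mB _ _ _ _] _; exact: mB. Qed.
Let BD (c : R[i]) f g : B f -> B g -> B (fun x => c * f x + g x).
Proof.
move=> Bf Bg; case: HB => -[_ _ hD hZ _] _.
by apply: (hD (fun x => c * f x)) => //; exact: hZ.
Qed.
Let BB f g : B f -> B g -> B (fun x => f x - g x).
Proof.
move=> Bf Bg; rewrite (_ : (fun x => _) = fun x => (-1) * g x + f x).
  exact: BD.
by apply/funext => x; rewrite mulN1r addrC.
Qed.
Let BZ (c : R[i]) f : B f -> B (fun x => c * f x).
Proof. by case: HB => -[_ _ _ hZ _] _; exact: hZ. Qed.
Let nB0 f : B f -> 0 <= nB f.
Proof. by case: HB => -[_ _ _ _ h] _; exact: h. Qed.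

Variable c1 : R.
Hypotheses (c10 : 0 <= c1) (emb : forall f, B f -> (normL1 nu f <= (c1 * nB f)%:E)%E).

Let Bi f : B f -> cintegrable nu f.
Proof.
by move=> Bf; apply: cintegrableP (Bm Bf) _; apply: (le_lt_trans (emb Bf)); exact: ltry.
Qed.

(** A real-valued copy of [normL1], finite on [B] by the embedding, so that the contraction argument
    is ordinary real arithmetic. *)
Let N (f : E -> R[i]) : R := Rintegral nu setT (fun x => cabs (f x)).

Let NE f : B f -> normL1 nu f = (N f)%:E.
Proof.
move=> Bf; rewrite -[N f]/(fine (normL1 nu f)) fineK// ge0_fin_numE.
  exact: cintegrable_norm (Bi Bf).
exact: normL1_ge0.
Qed.

Let N0 f : B f -> 0 <= N f.
Proof. by move=> Bf; rewrite -lee_fin -NE// normL1_ge0. Qed.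

Let NnB f : B f -> N f <= c1 * nB f.
Proof. by move=> Bf; rewrite -lee_fin -NE// emb. Qed.

Let N_sub f g : B f -> B g -> N f <= N (fun x => f x - g x) + N g.
Proof.
move=> Bf Bg; rewrite -lee_fin EFinD -!NE//; last exact: BB.
apply: le_trans (normL1D nu (cmeasurableB (Bm Bf) (Bm Bg)) (Bm Bg)).
by rewrite le_eqVlt; apply/orP; left; apply/eqP; congr normL1; apply/funext => x; rewrite subrK.
Qed.

Let N_triangle f g h : B f -> B g -> B h ->
  N (fun x => f x - h x) <= N (fun x => f x - g x) + N (fun x => g x - h x).
Proof.
move=> Bf Bg Bh; rewrite -lee_fin EFinD -!NE//; [|exact: BB..].
by apply: normL1_triangle; exact: Bm.
Qed.

Let NZ (c : R[i]) f : B f -> N (fun x => c * f x) = cabs c * N f.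
Proof.
move=> Bf; apply: EFin_inj; rewrite EFinM -!NE//; last exact: BZ.
by apply: normL1Z; exact: Bm.
Qed.

Let Nint f : B f -> cabs (cint nu f) <= N f.
Proof. by move=> Bf; rewrite -lee_fin -NE//; apply: cabs_cint; exact: Bi. Qed.

Variable qB : R.
Hypotheses (q0 : 0 <= qB) (BQf : forall f, B f -> B (kop Q f))
  (QB : forall f, B f -> nB (kop Q f) <= qB * nB f).

Let B_iterQ l f : B f -> B (iter l (kop Q) f).
Proof. by move=> Bf; elim: l => //= l; exact: BQf. Qed.

Let iterQ_le l f : B f -> nB (iter l (kop Q) f) <= qB ^+ l * nB f.
Proof.
move=> Bf; elim: l => [|l IH]; first by rewrite expr0 mul1r.
rewrite iterS exprS -mulrA (le_trans (QB (B_iterQ l Bf)))//.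
by rewrite ler_wpM2l.
Qed.

Variables (c3 : R).

Section FixedFrequency.
Variables (u kappa c4 : R).
Hypothesis c30 : 0 <= c3.
Hypothesis HF3 : forall f, B f ->
  (\int[nu]_x (cabs (cexpi (u * xi x) - 1) * cabs (f x))%:E <= (c3 * `|u| * nB f)%:E)%E.
Hypothesis BT : forall f, B f -> B (kopt Q xi u f).
Hypothesis TD : forall (a : R[i]) f g, B f -> B g ->
  kopt Q xi u (fun x => a * f x + g x) = (fun x => a * kopt Q xi u f x + kopt Q xi u g x).

Let T := kopt Q xi u.

Let muxi : measurable_fun setT (fun y => u * xi y).
Proof. exact: measurable_funM. Qed.

Let B_iterT n f : B f -> B (iter n T f).
Proof. by move=> Bf; elim: n => //= n; exact: BT. Qed.

Let iterT_lin n (a : R[i]) f g : B f -> B g ->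
  iter n T (fun x => a * f x + g x) = (fun x => a * iter n T f x + iter n T g x).
Proof.
move=> Bf Bg; elim: n => //= n ->.
by rewrite [LHS]TD//; exact: B_iterT.
Qed.

Let iterT_sub n f g : B f -> B g ->
  iter n T (fun x => f x - g x) = (fun x => iter n T f x - iter n T g x).
Proof.
move=> Bf Bg; have := iterT_lin n (-1) Bg Bf.
rewrite (_ : (fun x => -1 * g x + f x) = fun x => f x - g x) => [->|].
  by apply/funext => x; rewrite mulN1r addrC.
by apply/funext => x; rewrite mulN1r addrC.
Qed.

Let N_T f : B f -> N (T f) <= N f.
Proof.
move=> Bf; rewrite -lee_fin -!NE//; last exact: BT.
apply: le_trans (normL1_kop Hinv (cmeasurable_cexpiM muxi (Bm Bf))) _.
by rewrite normL1_cexpiM.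
Qed.

Lemma N_iterT n f : B f -> N (iter n T f) <= N f.
Proof.
move=> Bf; elim: n => //= n IH.
by apply: le_trans IH; apply: N_T; exact: B_iterT.
Qed.

Let N_TQ f : B f -> N (fun x => T f x - kop Q f x) <= c3 * `|u| * nB f.
Proof.
move=> Bf; have mf := Bm Bf.
rewrite -lee_fin -NE; last by apply: BB; [exact: BT|exact: BQf].
have mef := cmeasurable_cexpiM muxi mf.
have -> : (fun x => T f x - kop Q f x) =
    kop Q (fun y => cexpi (u * xi y) * f y - f y).
  apply/funext => x; rewrite /T /kopt /kop cintB//.
    by apply: cintegrable_cexpiM => //; exact: BQ.
  exact: BQ.
apply: (le_trans (normL1_kop Hinv (cmeasurableB mef mf))).
apply: le_trans (HF3 Bf); rewrite le_eqVlt; apply/orP; left; apply/eqP.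
by apply: eq_integral => x _; rewrite -cabsM mulrBl mul1r.
Qed.

(** Write [T^l - Q^l] as the sum of [T^(l-1-j) (T - Q) Q^j]. The order matters: [T - Q] is small
    only from [B] to [L^1], so the powers of [Q] act first, in the norm of [B], and those of [T]
    afterwards, as [L^1] contractions. *)
Lemma N_iterT_sub_iterQ l f : B f ->
  N (fun x => iter l T f x - iter l (kop Q) f x) <=
    (\sum_(j < l) c3 * qB ^+ j) * `|u| * nB f.
Proof.
move=> Bf; elim: l => [|l IH].
  rewrite big_ord0 !mul0r /= /N.
  by under eq_Rintegral do rewrite subrr cabs0; rewrite Rintegral_cst// mul0r.
have BTl := B_iterT l Bf; have BQl := B_iterQ l Bf.
have B2 : B (T (iter l (kop Q) f)) by exact: BT.
apply: (le_trans (N_triangle (B_iterT l.+1 Bf) B2 (B_iterQ l.+1 Bf))).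
rewrite big_ord_recr /= !mulrDl; apply: lerD.
  have -> : (fun x => T (iter l T f) x - T (iter l (kop Q) f) x) =
            T (fun x => iter l T f x - iter l (kop Q) f x).
    by rewrite [RHS](iterT_sub 1 BTl BQl).
  by apply: le_trans IH; apply: N_T; exact: BB.
apply: (le_trans (N_TQ BQl)).
have -> : c3 * qB ^+ l * `|u| * nB f = c3 * `|u| * (qB ^+ l * nB f) by ring.
by rewrite ler_wpM2l ?mulr_ge0// iterQ_le.
Qed.

Variables (l : nat) (e eps : R).
Hypothesis mix : forall f, B f ->
  nB (fun x => iter l (kop Q) f x - cint nu f) <= eps * nB f.
Hypothesis e_ge : c1 * eps + (\sum_(j < l) c3 * qB ^+ j) * `|u| <= e.

Let Bcst (c : R[i]) : B (fun _ => c).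
Proof.
have := BZ c B1; rewrite /one.
by rewrite (_ : (fun x => c * 1) = (fun _ : E => c))//; apply/funext => x; rewrite mulr1.
Qed.

Let N_iterT_cint f : B f -> N (fun x => iter l T f x - cint nu f) <= e * nB f.
Proof.
move=> Bf; have BQl := B_iterQ l Bf; have Bc := Bcst (cint nu f).
apply: (le_trans (N_triangle (B_iterT l Bf) BQl Bc)).
apply: le_trans (_ : (\sum_(j < l) c3 * qB ^+ j) * `|u| * nB f + c1 * (eps * nB f) <= _).
  apply: lerD; first exact: N_iterT_sub_iterQ.
  by apply: (le_trans (NnB (BB BQl Bc))); rewrite ler_wpM2l// mix.
by rewrite mulrA -mulrDl ler_wpM2r ?nB0// addrC.
Qed.

Hypothesis kappa01 : 0 <= kappa < 1.
Hypothesis c40 : 0 <= c4.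
Hypothesis DF : forall n f, (0 < n)%N -> B f ->
  nB (iter n T f) <= c4 * kappa ^+ n * nB f + c4 * N f.

Let N1 : N one = 1.
Proof.
rewrite /N /one; under eq_Rintegral do rewrite cabs1.
by rewrite Rintegral_cst// [X in fine X](probability_setT nu) mulr1.
Qed.

Let e0 : 0 <= e.
Proof.
have := le_trans (N0 (BB (B_iterT l B1) (Bcst (cint nu one)))) (N_iterT_cint B1).
(* The norm of [one] cannot vanish, for it dominates [N one = 1] up to the constant [c1]. *)
have [nb0|nb0] := eqVneq (nB one) 0.
  by have := NnB B1; rewrite N1 nb0 mulr0; lra.
by rewrite pmulr_lge0// lt0r nb0 nB0.
Qed.

Variables (m : nat) (q1 : R).
Hypothesis q1_ge : cabs (cint nu (iter m T one)) + e * ((c4 + 1) * (nB one + 1)) <= q1.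

Let nB_iterT1 n : nB (iter n T one) <= (c4 + 1) * (nB one + 1).
Proof.
have b0 := nB0 B1; case: n => [|n].
  have : 0 <= c4 * (nB one + 1) by rewrite mulr_ge0// addr_ge0.
  by rewrite /=; lra.
apply: (le_trans (DF (ltn0Sn n) B1)); rewrite N1 mulr1.
have : c4 * kappa ^+ n.+1 * nB one <= c4 * nB one.
  have /andP[k0 /ltW k1] := kappa01.
  by rewrite ler_wpM2r// ler_piMr// exprn_ile1.
have : 0 <= c4 * nB one by rewrite mulr_ge0.
lra.
Qed.

(** A bound on [|nu (T^m 1)|] says nothing by itself about the [L^1] norm of [T^m 1]. Further mixing
    over [l] steps brings [T^m 1] close to the constant [nu (T^m 1)], whose [L^1] norm is that
    modulus. *)
Let N_T1 : N (iter (l + m) T one) <= q1.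
Proof.
apply: le_trans q1_ge; rewrite iterD.
have Bm1 := B_iterT m B1; have Bc := Bcst (cint nu (iter m T one)).
apply: (le_trans (N_sub (B_iterT l Bm1) Bc)); rewrite addrC; apply: lerD.
  have := NZ (cint nu (iter m T one)) B1; rewrite N1 mulr1 => <-.
  rewrite (_ : (fun x => cint nu (iter m T one) * one x) = (fun _ => cint nu (iter m T one)))//.
  by apply/funext => x; rewrite mulr1.
apply: (le_trans (N_iterT_cint Bm1)).
by rewrite ler_wpM2l.
Qed.

(** The first [l] steps bring [f] close to [nu(f) 1], the next [m] reduce the characteristic
    function, and the last [l] turn this reduction into one of the [L^1] norm. *)
Let M := ((l + m) + l)%N.

Let N_step f : B f -> N (iter M T f) <= q1 * N f + e * nB f.
Proof.
move=> Bf; rewrite /M iterD; have BTl := B_iterT l Bf.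
have Bn := B_iterT (l + m) B1.
have Bcn := BZ (cint nu f) Bn.
have Bc := Bcst (cint nu f).
have Ec : iter (l + m) T (fun _ => cint nu f) = fun x => cint nu f * iter (l + m) T one x.
  have := iterT_lin (l + m) (cint nu f - 1) B1 B1.
  rewrite (_ : (fun x => _ * one x + one x) = fun _ => cint nu f) => [->|].
    by apply/funext => x; ring.
  by apply/funext => x; rewrite /one; ring.
apply: (le_trans (N_sub (B_iterT (l + m) BTl) Bcn)); rewrite addrC; apply: lerD.
  rewrite NZ// mulrC; apply: ler_pM => //; [exact: N0|exact: cabs_ge0|exact: Nint].
have -> : (fun x => iter (l + m) T (iter l T f) x - cint nu f * iter (l + m) T one x) =
    iter (l + m) T (fun x => iter l T f x - cint nu f).
  by rewrite (iterT_sub (l + m) BTl Bc) Ec.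
by apply: (le_trans (N_iterT (l + m) (BB BTl Bc))); exact: N_iterT_cint.
Qed.

Variables (eta q2 : R).
Hypotheses (eta0 : 0 < eta) (q20 : 0 <= q2) (M0 : (0 < M)%N)
  (q12 : q1 + eta * c4 <= q2) (eq2 : e + eta * (c4 * kappa ^+ M) <= q2 * eta).

(* The [L^1] norm alone is not contracted, and the norm of [B] only up to the
   [L^1] term of the Doeblin-Fortet inequality; this mixture is. *)
Let V f := N f + eta * nB f.

(** [q12] bounds the coefficient of [N f] and [eq2] that of [nB f] after [M] steps. *)
Let V_step j f : B f -> V (iter (j * M) T f) <= q2 ^+ j * V f.
Proof.
move=> Bf; elim: j => [|j IH]; first by rewrite mul0n expr0 mul1r.
rewrite mulSn iterD exprS -mulrA; set F := iter (j * M) T f in IH *.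
have BF : B F by exact: B_iterT.
apply: le_trans (ler_wpM2l q20 IH).
have := N_step BF; have := DF M0 BF; have nF := nB0 BF; have NF := N0 BF.
move=> h1 h2; rewrite /V.
have h3 : eta * nB (iter M T F) <= eta * (c4 * kappa ^+ M * nB F + c4 * N F).
  by rewrite ler_wpM2l// ltW.
have h4 : (q1 + eta * c4) * N F <= q2 * N F by rewrite ler_wpM2r.
have h5 : (e + eta * (c4 * kappa ^+ M)) * nB F <= q2 * eta * nB F by rewrite ler_wpM2r.
lra.
Qed.

(** The remaining [n %% M] steps are absorbed by the contraction in [L^1]. *)
Lemma charfun_geometric_decay n :
  cabs (cint nu (iter n T one)) <= q2 ^+ (n %/ M) * (1 + eta * nB one).
Proof.
rewrite {1}(divn_eq n M) addnC iterD.
have BF := B_iterT (n %/ M * M) B1.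
apply: (le_trans (Nint (B_iterT (n %% M) BF))).
apply: (le_trans (N_iterT (n %% M) BF)).
have := V_step (n %/ M) B1; rewrite /V N1; apply: le_trans.
by rewrite lerDl mulr_ge0 ?nB0// ltW.
Qed.

End FixedFrequency.
End Decay.

(** * Choice of the block length and of the constants *)

Section GaussianDecay.
Context {R : realType} {d : measure_display} {E : measurableType d}.

Lemma expr_small (k e : R) : 0 <= k < 1 -> 0 < e -> exists n, k ^+ n <= e.
Proof.
move=> /andP[k0 k1] e0.
have kn : (fun n => k ^+ n) @ \oo --> (0 : R) by apply: cvg_expr; rewrite ger0_norm.
have /cvgrPdist_le/(_ e e0)[n _ H] := kn.
by exists n; have := H n (leqnn n); rewrite /= sub0r normrN ger0_norm// exprn_ge0.
Qed.

Variables (Q : R.-pker E ~> E) (nu : probability E R).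
Hypothesis Hinv : forall A : set E, measurable A -> nu A = (\int[nu]_x Q x A)%E.
Variables (xi : E -> R) (B : set (E -> R[i])) (nB : (E -> R[i]) -> R).
Hypotheses (mxi : measurable_fun setT xi) (HB : banach_fun_space B nB).
Hypothesis BQ : forall f, B f -> forall x, cintegrable (Q x) f.

Let one : E -> R[i] := fun _ => 1.
Hypothesis B1 : B one.
Variable c1 : R.
Hypotheses (c10 : 0 <= c1) (emb : forall f, B f -> (normL1 nu f <= (c1 * nB f)%:E)%E).
Variable qB : R.
Hypotheses (q0 : 0 <= qB) (BQf : forall f, B f -> B (kop Q f))
  (QB : forall f, B f -> nB (kop Q f) <= qB * nB f).
Hypothesis mix : forall eps : R, 0 < eps -> exists l : nat, forall f, B f ->
  nB (fun x => iter l (kop Q) f x - cint nu f) <= eps * nB f.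
Variables (c3 delta3 : R).
Hypotheses (c30 : 0 <= c3) (delta30 : 0 < delta3).
Hypothesis HF3 : forall u : R, `|u| < delta3 -> forall f, B f ->
  (\int[nu]_x (cabs (cexpi (u * xi x) - 1) * cabs (f x))%:E <= (c3 * `|u| * nB f)%:E)%E.
Variables (kappa c4 delta4 : R).
Hypotheses (kappa01 : 0 <= kappa < 1) (c40 : 0 <= c4) (delta40 : 0 < delta4).
Hypothesis HT : forall u : R, `|u| < delta4 -> bounded_op B nB (kopt Q xi u).
Hypothesis DF : forall u : R, `|u| < delta4 -> forall (n : nat) f, (0 < n)%N -> B f ->
  nB (iter n (kopt Q xi u) f)
    <= c4 * kappa ^+ n * nB f + c4 * Rintegral nu setT (fun x => cabs (f x)).
Variables (C5 u5 sigma2 : R).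
Hypotheses (C50 : 0 <= C5) (u50 : 0 < u5) (sigma20 : 0 < sigma2).
Hypothesis CF : forall (u : R) (n : nat), `|u| <= u5 ->
  cabs (cint nu (iter n (kopt Q xi u) one) -
        (expR (- (n%:R * (u ^+ 2 / 2 * sigma2))))%:C)
  <= C5 * (`|u| + n%:R * `|u| ^+ 3).

Lemma charfun_gaussian_decay : exists delta c K : R, [/\ 0 < delta, 0 < c, 0 <= K &
  forall (u : R) (n : nat), `|u| <= delta ->
    cabs (cint nu (iter n (kopt Q xi u) one)) <= K * expR (- (c * (n%:R * u ^+ 2)))].
Proof.
(* Stated first because [lra] is slow in the large context reached below. *)
have half_lt (x y : R) : 0 < y -> x <= y / 2 -> x < y by lra.
have ari1 (S a e : R) : 0 <= a -> a * (2 * (S + 1)) <= e -> S * a <= e / 2 by lra.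
have ari2 (x y : R) : x <= 1 + y -> y <= 1 -> 1 + x <= 3 by lra.
have ari3 (C a r : R) : 0 <= a -> a * (12 * (C + 1)) <= 1 - r ->
  C * (a * 3) <= (1 - r) / 4 by lra.
have ari4 (z zv v k g r : R) : zv <= g -> k <= (1 - r) / 4 -> z <= zv + v ->
  g <= (1 - r) / 4 -> v <= r -> z + k <= (1 + r) / 2 by lra.
have ari5 (q x c : R) : x * (c + 1) = (1 - q) / 2 -> 0 < x -> q + x * c <= (1 + q) / 2.
  by lra.
have ari6 (c : R) : 0 <= c -> c * (4 * (c + 1))^-1 <= 1 / 4.
  by move=> cp; rewrite ler_pdivrMr; lra.
have ari7 (x y z e : R) : x <= e / 4 -> y <= e * (1 / 4) -> 1 / 2 * e <= z -> x + y <= z.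
  by lra.
have ari8 (c j x : R) : c * x <= c * ((j + 1) * 2) -> j * - (2 * c) <= 2 * c - c * x by lra.
have ari9 (a l : R) : 0 < a -> a * (l * 2) <= 1 -> 1 <= l -> a <= 1 by nra.
have ari10 (a n : R) : 0 < a -> a <= 1 -> 0 <= n -> a * (n + 1) <= 1 -> n * a ^+ 2 <= 1 by nra.
have ari11 (a l m : R) : 0 < a -> a <= 1 -> 0 <= l -> a * ((l + 1) * 2) <= 1 ->
  m * a ^+ 2 <= 1 + a ^+ 2 -> (l + m + l) * a ^+ 2 <= 2 by nra.
have ari12 (e k r : R) : e * (4 * k) <= 1 - r -> e * k <= (1 - r) / 4 by lra.
have ari13 (x y : R) : x <= 0 -> y <= x + 1 -> y <= 1 by lra.
move: (c10) (c30) (c40) (C50) (delta30) (delta40) (sigma20) => c10' c30' c40' C50' d30' d40' s0'.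
have nB1 : 0 <= nB one by case: HB => -[_ _ _ _ h] _; exact: h.
(* The Gaussian factor after [m] steps when [m * u ^+ 2 >= 1]. The gap [1 - r] is shared out: [q1]
   leaves half of it for two errors of size [(1 - r) / 4], and [q2] lies halfway between [q1] and
   1. *)
pose r := expR (- (sigma2 / 2)).
have r0 : 0 < r := expR_gt0 _.
have r1 : r < 1 by rewrite expR_lt1 oppr_lt0 divr_gt0.
pose K1 := (c4 + 1) * (nB one + 1).
have K10 : 0 < K1 by rewrite mulr_gt0// ltr_wpDl.
pose q1 := (1 + r) / 2; pose eta := (1 - q1) / (2 * (c4 + 1)); pose q2 := (1 + q1) / 2.
have q1r : 0 < q1 < 1 by rewrite /q1; lra.
have q2r : 1 / 2 < q2 < 1 by rewrite /q2; lra.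
have c41 : 0 < 2 * (c4 + 1) by lra.
have eta0 : 0 < eta by rewrite divr_gt0//; lra.
have etac : eta * (c4 + 1) = (1 - q1) / 2 by rewrite /eta; field; lra.
(* The first bound serves [eq2], where [e] and [eta * c4 * kappa ^+ M] each take a quarter of [eta]
   and [q2 > 1 / 2]; the second serves the definition of [q1]. *)
pose e := Num.min (eta / 4) ((1 - r) / (4 * K1)).
have e0 : 0 < e by rewrite lt_min (divr_gt0 eta0)//= divr_gt0 ?subr_gt0// mulr_gt0.
have e_eta : e <= eta / 4 by rewrite ge_min lexx.
have eK1 : e * K1 <= (1 - r) / 4.
  have : e <= (1 - r) / (4 * K1) by rewrite ge_min lexx orbT.
  have K14 : 0 < 4 * K1 := mulr_gt0 (ltr0Sn R 3) K10.
  by rewrite ler_pdivlMr// => /ari12.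
have c11 : 0 < 2 * (c1 + 1) by lra.
have [l Hl] := mix (divr_gt0 e0 c11).
have c1eps : c1 * (e / (2 * (c1 + 1))) <= e / 2.
  have -> : c1 * (e / (2 * (c1 + 1))) = (c1 / (c1 + 1)) * (e / 2) by field; lra.
  by rewrite ler_piMl ?divr_ge0 ?ltW// ltr_pdivrMr; lra.
pose S := \sum_(j < l) c3 * qB ^+ j.
have S0 : 0 <= S by apply: sumr_ge0 => j _; rewrite mulr_ge0// exprn_ge0.
have [N0 kN0] : exists n, kappa ^+ n <= (4 * (c4 + 1))^-1.
  by apply: expr_small => //; rewrite invr_gt0; lra.
(* In order: range of the Gaussian estimate; strict ranges of (H3) and (H4); smallness of [S * |u|];
   the Gaussian error over [m] steps, at most [3 * C5 * |u|]; [m >= N0], so that [kappa ^+ M] is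
   small; and [M * u ^+ 2 <= 2]. *)
pose delta := Num.min (Num.min (Num.min u5 (delta3 / 2)) (Num.min (delta4 / 2) (e / (2 * (S + 1)))))
  (Num.min (Num.min ((1 - r) / (12 * (C5 + 1))) (N0.+1%:R)^-1) ((l.+1%:R) * 2)^-1).
have S1 : 0 < 2 * (S + 1) by lra.
have C51 : 0 < 12 * (C5 + 1) by lra.
have delta0 : 0 < delta.
  by rewrite !lt_min u50 !divr_gt0 ?invr_gt0 ?mulr_gt0 ?ltr0n// ?subr_gt0 ?ltr_wpDl.
(* Since [M * u ^+ 2 <= 2], the number of blocks is at least [n * u ^+ 2 / 2 - 1];
   [q2 = expR (- (2 * c))] then gives the rate [c], with [expR (2 * c)] paying for the missing
   block. *)
pose c := - ln q2 / 2.
have q20 : 0 < q2 by lra.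
have c0 : 0 < c.
  by rewrite divr_gt0// oppr_gt0 -ln1 ltr_ln ?posrE//; lra.
have q2E : q2 = expR (- (2 * c)) by rewrite /c mulrCA divff// mulr1 opprK lnK.
pose K := expR (2 * c) * (1 + eta * nB one).
have K0 : 0 <= K by rewrite mulr_ge0 ?expR_ge0// addr_ge0// mulr_ge0// ltW.
exists delta, c, K; split => // u n.
rewrite !le_min => /andP[/andP[/andP[d1 d2] /andP[d3 d4]] /andP[/andP[d5 d6] d7]].
(* The block length is about [u^-2], so [u = 0] is treated apart, where [K >= 1] suffices. *)
have [->|un0] := eqVneq u 0.
  have := @CF 0 n; rewrite normr0 => /(_ (ltW u50)).
  rewrite !expr0n /= mul0r mul0r !mulr0 oppr0 expR0 addr0 mulr0 mulr1 => h.
  have : K >= 1.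
    rewrite /K -[leLHS]mulr1 ler_pM//.
      by rewrite -expR0 ler_expR mulr_ge0// ltW.
    by rewrite lerDl mulr_ge0// ltW.
  apply: le_trans.
  have := cabs_triangle (cint nu (iter n (kopt Q xi 0) one)) 1 0.
  by rewrite !subr0 cabs1; exact: ari13.
set a := `|u| in d1 d2 d3 d4 d5 d6 d7.
have a0 : 0 < a by rewrite normr_gt0.
have uu : u ^+ 2 = a ^+ 2 by rewrite real_normK ?num_real.
have N1 : a * N0.+1%:R <= 1 by move: d6; rewrite -[X in _ <= X]mul1r ler_pdivlMr ?ltr0n.
have L1 : a * (l.+1%:R * 2) <= 1.
  by move: d7; rewrite -[X in _ <= X]mul1r ler_pdivlMr// mulr_gt0 ?ltr0n.
have a1 : a <= 1.
  have : 1 <= l.+1%:R :> R by rewrite ler1n.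
  exact: ari9.
have a20 : 0 < a ^+ 2 by rewrite exprn_gt0.
have a2a : a ^+ 2 <= a by rewrite expr2 ler_piMl// ltW.
(* With [m ~ a^-2], the Gaussian factor over [m] steps is at most [r] while the
   error [a + m * a ^+ 3] is of order [a]. *)
pose m := (Num.truncn (a ^+ 2)^-1).+1.
have m1 : 1 <= m%:R * a ^+ 2.
  rewrite -ler_pdivrMr// mul1r ltW//.
  exact: truncnS_gt.
have m2 : m%:R * a ^+ 2 <= 1 + a ^+ 2.
  rewrite /m -natr1 mulrDl mul1r lerD2r -ler_pdivlMr// mul1r.
  by rewrite truncn_le// invr_ge0 ltW.
have mN0 : (N0 <= m)%N.
  rewrite -(ler_nat R) -(ler_pM2r a20); apply: le_trans m1.
  move: N1; rewrite -natr1 => N1.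
  have n0 : 0 <= N0%:R :> R by [].
  exact: ari10.
pose M := (l + m + l)%N.
have M0 : (0 < M)%N by rewrite /M addn_gt0 addn_gt0 /= orbT.
have Ma : M%:R * a ^+ 2 <= 2.
  rewrite /M !natrD; move: L1; rewrite -natr1 => L1.
  have l0 : 0 <= l%:R :> R by [].
  exact: ari11.
have ad3 : a < delta3 by exact: half_lt d30' d2.
have ad4 : a < delta4 by exact: half_lt d40' d3.
have [h1 h2 _] := @HT u ad4.
have h3 := @HF3 u ad3.
have h4 := @DF u ad4.
have He : c1 * (e / (2 * (c1 + 1))) + (\sum_(j < l) c3 * qB ^+ j) * `|u| <= e.
  rewrite -/S -/a.
  have : S * a <= e / 2.
    by move: d4; rewrite ler_pdivlMr// => /(ari1 _ _ _ (ltW a0)).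
  by move=> Sa; apply: (le_trans (lerD c1eps Sa)); rewrite -splitr.
have Hq1 : cabs (cint nu (iter m (kopt Q xi u) one)) + e * ((c4 + 1) * (nB one + 1)) <= q1.
  have := CF m d1; set z := cint nu _; rewrite -/a => cf.
  have : expR (- (m%:R * (u ^+ 2 / 2 * sigma2))) <= r.
    rewrite ler_expR lerN2 uu.
    have -> : m%:R * (a ^+ 2 / 2 * sigma2) = (m%:R * a ^+ 2) * (sigma2 / 2) by ring.
    by rewrite ler_peMl// divr_ge0// ltW.
  have : C5 * (a + m%:R * a ^+ 3) <= (1 - r) / 4.
    have -> : a + m%:R * a ^+ 3 = a * (1 + m%:R * a ^+ 2) by ring.
    apply: (@le_trans _ _ (C5 * (a * 3))).
      by apply: ler_wpM2l => //; apply: ler_wpM2l; [exact: ltW|exact: ari2 m2 (le_trans a2a a1)].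
    by move: d5; rewrite ler_pdivlMr// => /(ari3 _ _ _ (ltW a0)).
  have := cabs_triangle z (expR (- (m%:R * (u ^+ 2 / 2 * sigma2))))%:C 0.
  rewrite !subr0 cabs_real ger0_norm ?expR_ge0//.
  have -> : e * ((c4 + 1) * (nB one + 1)) = e * K1 by [].
  exact: ari4 cf eK1.
have Hq2 : q1 + eta * c4 <= q2 := ari5 _ _ _ etac eta0.
have Heq2 : e + eta * (c4 * kappa ^+ M) <= q2 * eta.
  have /andP[k0 k1] := kappa01.
  have kM : kappa ^+ M <= (4 * (c4 + 1))^-1.
    apply: le_trans kN0; apply: ler_wiXn2l => //; first exact: ltW.
    by rewrite /M -addnA addnCA (leq_trans mN0)// leq_addr.
  have : c4 * kappa ^+ M <= 1 / 4.
    apply: (@le_trans _ _ (c4 * (4 * (c4 + 1))^-1)); first by rewrite ler_wpM2l.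
    exact: ari6.
  move=> /(ler_wpM2l (ltW eta0)) h.
  have q21 : 1 / 2 <= q2 by case/andP: q2r => /ltW.
  have : 1 / 2 * eta <= q2 * eta by apply: ler_wpM2r => //; exact: ltW.
  exact: ari7.
have D := charfun_geometric_decay Hinv mxi HB BQ B1 c10 emb q0 BQf QB c30 h3 h1 h2 Hl He
  kappa01 c40 h4 Hq1 eta0 (ltW q20) M0 Hq2 Heq2 n.
apply: (le_trans D).
have en : 0 <= 1 + eta * nB one by rewrite addr_ge0// mulr_ge0// ltW.
rewrite -/M /K [leRHS]mulrAC; apply: ler_wpM2r => //.
rewrite q2E -expRM_natl -expRD ler_expR uu.
have : n%:R * a ^+ 2 <= ((n %/ M)%:R + 1) * 2.
  have nM : n%:R <= ((n %/ M)%:R + 1) * M%:R :> R.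
    by rewrite natr1 -natrM ler_nat ltnW// -ltn_divLR.
  have j0 : 0 <= (n %/ M)%:R + 1 :> R by rewrite addr_ge0.
  apply: (@le_trans _ _ (((n %/ M)%:R + 1) * M%:R * a ^+ 2)).
    by rewrite ler_wpM2r// ltW.
  by rewrite -mulrA ler_wpM2l.
move=> /(ler_wpM2l (ltW c0)) h.
exact: ari8 h.
Qed.

End GaussianDecay.

(** * Esseen's smoothing inequality *)

Section Fejer.
Context {R : realType}.
Local Notation mu := (@lebesgue_measure R).
Implicit Types (t w x y z : R).

Lemma is_derive_continuous (F f : R -> R) :
  (forall x : R, is_derive x (1 : R) F (f x)) -> continuous F.
Proof.
move=> dF x; apply: differentiable_continuous.
by apply/derivable1_diffP; have [] := dF x.
Qed.

Lemma integral_is_derive (F f : R -> R) (a b : R) : a <= b ->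
  (forall x : R, is_derive x (1 : R) F (f x)) -> continuous f ->
  (\int[mu]_(x in `[a, b]) (f x)%:E)%E = (F b - F a)%:E.
Proof.
rewrite le_eqVlt => /predU1P[->|ab] dF cf.
  by rewrite set_itv1 integral_set1 subrr.
have cF := is_derive_continuous dF.
rewrite (@continuous_FTC2 _ f F)//.
- exact: continuous_subspaceT.
- split.
  + by move=> x _; have [] := dF x.
  + by apply: cvg_at_right_filter; exact: cF.
  + by apply: cvg_at_left_filter; exact: cF.
- by move=> x _; rewrite derive1E; have [_] := dF x.
Qed.

Lemma continuous_itv_integrable (f : R -> R) (a b : R) : continuous f ->
  mu.-integrable `[a, b] (EFin \o f).
Proof.
move=> cf; apply: continuous_compact_integrable; first exact: segment_compact.
exact: continuous_subspaceT.
Qed.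

(** The Fejér kernel [(1 - cos w) / w^2], given as the cosine transform of the triangle function:
    this form is regular at 0 and shows that only frequencies in [[0, 1]] enter. *)
Definition fejer (w : R) : R := \int[mu]_(t in `[0, 1]) ((1 - t) * cos (t * w)).

Lemma is_derive_scaled (f : R -> R) (w t l : R) :
  is_derive (t * w) (1 : R) f l -> is_derive t (1 : R) (fun t : R => f (t * w)) (w * l).
Proof.
move=> df; have dm : is_derive t (1 : R) (fun t : R => t * w) w.
  by apply: is_derive_eq; rewrite /GRing.scale /=; ring.
rewrite mulrC.
exact: (@is_derive1_comp R f (fun t => t * w) t).
Qed.

Lemma is_derive_fejer_primitive (w : R) : w != 0 -> forall t : R,
  is_derive t (1 : R) (fun t : R => (1 - t) * (sin (t * w) / w) - cos (t * w) / w ^+ 2)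
    ((1 - t) * cos (t * w)).
Proof.
move=> w0 t.
have d1 : is_derive t (1 : R) (fun t : R => sin (t * w)) (w * cos (t * w)).
  exact: is_derive_scaled.
have d2 : is_derive t (1 : R) (fun t : R => cos (t * w)) (w * (- sin (t * w))).
  exact: is_derive_scaled.
by apply: is_derive_eq; rewrite /GRing.scale /=; field.
Qed.

Lemma continuous_fejer_integrand w : continuous (fun t => (1 - t) * cos (t * w)).
Proof.
move=> t; apply: cvgM.
  by apply: cvgB; [exact: cvg_cst|exact: cvg_id].
apply: (@continuous_comp _ _ _ (fun t => t * w) cos); last exact: continuous_cos.
by apply: cvgM; [exact: cvg_id|exact: cvg_cst].
Qed.

Lemma fejerE w : w != 0 -> fejer w = (1 - cos w) / w ^+ 2.
Proof.
move=> w0; rewrite /fejer /Rintegral.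
rewrite (integral_is_derive ler01 (is_derive_fejer_primitive w0)).
  by rewrite /= mul1r !mul0r subrr subr0 mul0r sin0 cos0 mul0r mulr0; field.
exact: continuous_fejer_integrand.
Qed.

Lemma fejer0 : fejer 0 = 1 / 2.
Proof.
have dF (t : R) : is_derive t (1 : R) (fun t : R => t - t ^+ 2 / 2) ((1 - t) * cos (t * 0)).
  by rewrite mulr0 cos0; apply: is_derive_eq; rewrite /GRing.scale /=; field.
rewrite /fejer /Rintegral (integral_is_derive ler01 dF).
  by rewrite /= expr0n /= expr1n; field.
exact: continuous_fejer_integrand.
Qed.

Lemma fejer_ge0 w : 0 <= fejer w.
Proof.
have [->|w0] := eqVneq w 0; first by rewrite fejer0 divr_ge0.
by rewrite fejerE// divr_ge0 ?sqr_ge0// subr_ge0 cos_le1.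
Qed.

Lemma fejer_le w : fejer w <= 3 * (oneDsqr w)^-1.
Proof.
rewrite ler_pdivlMr; last by rewrite (lt_le_trans _ (oneDsqr_ge1 _)).
rewrite /oneDsqr.
have [->|w0] := eqVneq w 0; first by rewrite fejer0 expr0n /=; lra.
have w2 : 0 < w ^+ 2 by rewrite lt0r sqrf_eq0 w0 sqr_ge0.
rewrite fejerE// mulrAC ler_pdivrMr//.
have [_ _ _ h] := cos_sin_taylor w.
have c1 := cos_geN1 w; have c2 := cos_le1 w.
have h1 : 1 - cos w <= w ^+ 2 / 2.
  have /andP[+ _] : 0 <= cos `|w| - 1 + `|w| ^+ 2 / 2 <= `|w| ^+ 3.
    by have [] := cos_sin_taylor_ge0 (normr_ge0 w).
  by rewrite cos_norm real_normK ?num_real// => h1; lra.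
have h2 : (1 - cos w) * w ^+ 2 <= 2 * w ^+ 2.
  by apply: ler_wpM2r; [exact: ltW|lra].
lra.
Qed.

Lemma fejer_ge w : `|w| <= 1 / 4 -> 1 / 4 <= fejer w.
Proof.
have [->|w0] := eqVneq w 0; first by rewrite fejer0; lra.
move=> w4; rewrite fejerE//.
have w2 : 0 < w ^+ 2 by rewrite lt0r sqrf_eq0 w0 sqr_ge0.
rewrite ler_pdivlMr//.
have [_ _ _] := cos_sin_taylor w.
have : `|w| ^+ 3 <= 1 / 4 * w ^+ 2.
  by rewrite -[w ^+ 2]real_normK ?num_real// exprS ler_wpM2r// sqr_ge0.
by rewrite ler_norml => h /andP[_ h2]; lra.
Qed.

Lemma cos_sin_lipschitz x y : `|cos x - cos y| <= 2 * `|x - y| /\ `|sin x - sin y| <= 2 * `|x - y|.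
Proof.
have h : cabs (cexpi x - cexpi y) <= 2 * `|x - y|.
  have -> : cexpi x - cexpi y = cexpi y * (cexpi (x - y) - 1).
    by rewrite mulrBr mulr1 -cexpiD addrCA subrr addr0.
  by rewrite cabsM cabs_cexpi mul1r; exact: cabs_cexpi_sub1.
split; apply: le_trans h.
  by apply: le_trans (le_cabs_Re _); rewrite ReD ReN !Re_cexpi.
by apply: le_trans (le_cabs_Im _); rewrite ImD ImN !Im_cexpi.
Qed.

Lemma continuous_fejer : continuous fejer.
Proof.
move=> w; apply/cvgrPdist_le => e e0; near=> x.
have xw : `|w - x| <= e / 2.
  by near: x; apply: cvgr_dist_le; [exact: cvg_id|rewrite divr_gt0].
have ci (z : R) : mu.-integrable `[0, 1] (EFin \o (fun t => (1 - t) * cos (t * z))).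
  by apply: continuous_itv_integrable; exact: continuous_fejer_integrand.
rewrite /fejer -(RintegralB _ (ci w) (ci x))//.
have cI : mu.-integrable `[0, 1] (EFin \o (fun=> e)).
  by apply: continuous_itv_integrable => z; exact: cvg_cst.
have cd : mu.-integrable `[0, 1] (EFin \o (fun t => (1 - t) * cos (t * w) - (1 - t) * cos (t * x))).
  by apply: continuous_itv_integrable => z; apply: cvgB; exact: continuous_fejer_integrand.
apply: (le_trans (le_normr_Rintegral _ cd)) => //.
have eE : \int[mu]_(t in `[0, 1]) e = e.
  by rewrite Rintegral_cst// [X in fine X]lebesgue_measure_itv/= lte01 oppr0 adde0 /= mulr1.
rewrite -[leRHS]eE; apply: le_Rintegral => //; first exact: integrable_norm.
move=> t; rewrite /= in_itv/= => /andP[t0 t1].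
rewrite -mulrBr normrM; have [h _] := cos_sin_lipschitz (t * w) (t * x).
rewrite -mulrBr normrM in h.
have t1' : `|1 - t| <= 1 by rewrite ler_norml; lra.
have t0' : `|t| <= 1 by rewrite ler_norml; lra.
apply: (@le_trans _ _ (1 * (2 * (1 * (e / 2))))); last lra.
apply: ler_pM => //; apply: (le_trans h); rewrite ler_pM2l//.
by apply: ler_pM.
Unshelve. all: by end_near. Qed.

Lemma integrable_fejer : mu.-integrable setT (EFin \o fejer).
Proof.
apply/integrableP; split.
  by apply/measurable_EFinP; apply: continuous_measurable_fun; exact: continuous_fejer.
have co : continuous (fun x => 3 * (oneDsqr x)^-1).
  by move=> x; apply: cvgM; [exact: cvg_cst|exact: continuous_oneDsqrV].
have oi (x : R) : 0 <= (oneDsqr x)^-1 by rewrite invr_ge0 (le_trans ler01).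
have o0 (x : R) : 0 <= 3 * (oneDsqr x)^-1 by rewrite mulr_ge0.
apply: (@le_lt_trans _ _ (\int[mu]_x (3 * (oneDsqr x)^-1)%:E)%E).
  apply: ge0_le_integral => //.
  - apply: measurableT_comp => //.
    by apply/measurable_EFinP; apply: continuous_measurable_fun; exact: continuous_fejer.
  - by apply/measurable_EFinP; apply: continuous_measurable_fun.
  - by move=> x _; rewrite /= lee_fin ger0_norm ?fejer_ge0// fejer_le.
rewrite ge0_symfun_integralT//; last by move=> x; rewrite /= /oneDsqr sqrrN.
rewrite -set_itvcy; under eq_integral do rewrite EFinM.
rewrite ge0_integralZl_EFin//; last first.
  apply/measurable_EFinP; apply: measurable_funTS.
  by apply: continuous_measurable_fun; exact: continuous_oneDsqrV.
by rewrite integral0y_oneDsqr -!EFinM ltry.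
Qed.

Definition fejer_mass : R := \int[mu]_x fejer x.

Lemma fejer_mass_gt0 : 0 < fejer_mass.
Proof.
have ii : mu.-integrable setT (EFin \o (fun x => 1 / 4 * \1_(`[(- (1/4)), 1/4]%classic) x)).
  apply: (@le_integrable _ _ _ mu _ measurableT _ (EFin \o fejer)) => //.
  - apply/measurable_EFinP; apply: measurable_funM => //.
  - move=> x _; rewrite /= lee_fin [X in _ <= X]ger0_norm ?fejer_ge0//.
    rewrite indicE; case: (boolP (x \in _)) => [|_]; last by rewrite mulr0 normr0 fejer_ge0.
    rewrite inE /= in_itv /= -ler_norml => /fejer_ge; rewrite mulr1 ger0_norm//; lra.
  - exact: integrable_fejer.
apply: (@lt_le_trans _ _ (\int[mu]_x (1 / 4 * \1_(`[(- (1/4)), 1/4]%classic) x))).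
  rewrite /Rintegral; under eq_integral do rewrite EFinM.
  rewrite ge0_integralZl_EFin//; last first.
    by apply/measurable_EFinP.
  rewrite integral_indic// setIT [X in (_ * X)%E]lebesgue_measure_itv/= lte_fin ifT; last lra.
  rewrite -EFinB -EFinM /=; lra.
apply: le_Rintegral => //; first exact: integrable_fejer.
move=> x _; rewrite indicE; case: (boolP (x \in _)) => [|_]; last by rewrite mulr0 fejer_ge0.
rewrite inE /= in_itv /= -ler_norml => /fejer_ge; lra.
Qed.

End Fejer.

(** * A primitive of the Fejér kernel as a sine transform *)

Section FejerPrimitive.
Context {R : realType}.
Local Notation mu := (@lebesgue_measure R).

(** The factor [1 / t] comes from integrating [cos (t * w)] in [w]. It is the source of the division
    by the frequency in the smoothing inequality. *)
Definition fejer_weight (t : R) : R := (1 - t) * (t^-1 * \1_(`]0, 1]%classic) t).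

Lemma measurable_fejer_weight : measurable_fun setT fejer_weight.
Proof.
apply: measurable_funM; first exact: measurable_funB.
rewrite (_ : (fun t => _) = (fun t : R => t^-1) \_ `]0, 1]); last first.
  by apply/funext => t; rewrite patchE indicE; case: (t \in _); rewrite ?mulr1 ?mulr0.
apply/measurable_restrict => //; rewrite setTI.
have mi : measurable_fun (`]0%R, +oo[%classic : set R) (fun t : R => t^-1).
  apply: open_continuous_measurable_fun => //.
  by move=> t; rewrite inE /= in_itv /= andbT => t0; apply: cvgV; [rewrite gt_eqF|exact: cvg_id].
by apply: measurable_funS mi => //; apply: subset_itvl; rewrite bnd_simp.
Qed.

Lemma fejer_weight_bound (t w : R) :
  `|fejer_weight t * sin (t * w)| <= `|w| * \1_(`]0, 1]%classic) t.
Proof.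
rewrite /fejer_weight indicE; case: (boolP (t \in _)); last first.
  by rewrite !mulr0 mul0r normr0.
rewrite inE /= in_itv /= => /andP[t0 t1]; rewrite !mulr1 !normrM normfV.
have [h _ _ _] := cos_sin_taylor (t * w).
have t0' : 0 < `|t| by rewrite normr_gt0 gt_eqF.
rewrite -mulrA; apply: (@le_trans _ _ (1 * (`|t|^-1 * (`|t| * `|w|)))).
  apply: ler_pM => //; first by rewrite ler_norml; lra.
  by rewrite ler_pM2l ?invr_gt0// -normrM.
by rewrite mul1r mulKf// gt_eqF.
Qed.

Lemma integrable_indic01 : mu.-integrable setT (EFin \o (\1_(`]0, 1]%classic) : R -> R)).
Proof. exact: integrable_indic_itv. Qed.

Lemma measurable_weight_sin (w : R) :
  measurable_fun setT (fun t => fejer_weight t * sin (t * w)).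
Proof.
apply: measurable_funM; first exact: measurable_fejer_weight.
have ms : measurable_fun [set: R] (@sin R).
  by apply: continuous_measurable_fun; exact: continuous_sin.
by apply: (measurableT_comp ms); exact: measurable_funM.
Qed.

Lemma integrable_weight_sin (w : R) :
  mu.-integrable setT (EFin \o (fun t => fejer_weight t * sin (t * w))).
Proof.
have i1 := integrableZl measurableT `|w| integrable_indic01.
apply: le_integrable i1 => //.
  by apply/measurable_EFinP; exact: measurable_weight_sin.
move=> t _; rewrite /= lee_fin (le_trans (fejer_weight_bound t w))//.
exact: ler_norm.
Qed.

Definition fejer_prim (w : R) : R := \int[mu]_t (fejer_weight t * sin (t * w)).

Lemma is_derive_fejer_prim (w : R) : is_derive w (1 : R) fejer_prim (fejer w).
Proof.
pose f (x t : R) := fejer_weight t * sin (t * x).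
have df (x t : R) : is_derive x (1 : R) (f ^~ t) (\1_(`]0, 1]%classic) t * ((1 - t) * cos (t * x))).
  have d1 : is_derive x (1 : R) (fun x : R => sin (t * x)) (t * cos (t * x)).
    under eq_fun do rewrite mulrC; rewrite [t * x]mulrC.
    exact: is_derive_scaled.
  rewrite /f; apply: is_derive_eq; rewrite /GRing.scale /= /fejer_weight indicE.
  case: (boolP (t \in _)) => [|_]; last by rewrite !mulr0 !mul0r.
  rewrite inE /= in_itv /= => /andP[t0 _]; rewrite mulr1 mul1r.
  by field; rewrite gt_eqF.
have Iw : `](w - 1), (w + 1)[%classic w by rewrite /= in_itv /=; lra.
have intf (x : R) : `](w - 1), (w + 1)[%classic x -> mu.-integrable setT (EFin \o f x).
  by move=> _; exact: integrable_weight_sin.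
have derf (x t : R) : `](w - 1), (w + 1)[%classic x -> setT t -> derivable (f ^~ t) x 1.
  by move=> _ _; have [] := df x t.
have G0 (t : R) : 0 <= \1_(`]0, 1]%classic) t :> R by rewrite indicE.
have Gub (x t : R) : `](w - 1), (w + 1)[%classic x -> setT t ->
    `|partial1of2 f x t| <= \1_(`]0, 1]%classic) t.
  move=> _ _; rewrite partial1of2E; have [_ ->] := df x t.
  rewrite indicE; case: (boolP (t \in _)) => [|_]; last by rewrite mul0r normr0.
  rewrite inE /= in_itv /= => /andP[t0 t1]; rewrite mul1r normrM -[leRHS]mulr1.
  by apply: ler_pM => //; [rewrite ler_norml; lra|exact: cos_max].
have D := derivable_under_integral measurableT Iw intf derf G0 integrable_indic01 Gub.
have V := differentiation_under_integral measurableT Iw intf derf G0 integrable_indic01 Gub.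
have E1 : (fun x' : R => \int[mu]_(y in setT) f x' y) = fejer_prim by [].
rewrite E1 in D V.
apply: DeriveDef => //; rewrite -derive1E V.
have -> : fejer w = \int[mu]_(t in `]0, 1]) ((1 - t) * cos (t * w)).
  have ci : mu.-integrable `[0, 1] (EFin \o (fun t => (1 - t) * cos (t * w))).
    by apply: continuous_itv_integrable; exact: continuous_fejer_integrand.
  rewrite /fejer Rintegral_itv_obnd_cbnd//; apply: integrableS ci => //.
  by apply: subset_itvr; rewrite bnd_simp.
rewrite [RHS]Rintegral_mkcond; apply: eq_Rintegral => t _.
rewrite partial1of2E; have [_ ->] := df w t.
by rewrite patchE indicE; case: (t \in _); rewrite ?mul1r ?mul0r.
Qed.

Lemma fejer_prim0 : fejer_prim 0 = 0.
Proof.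
rewrite /fejer_prim; under eq_Rintegral do rewrite mulr0 sin0 mulr0.
by rewrite Rintegral_cst// mul0r.
Qed.

Lemma continuous_fejer_prim : continuous fejer_prim.
Proof. exact: is_derive_continuous is_derive_fejer_prim. Qed.

Definition fejer_cdf (w : R) : R := \int[mu]_(z in `]-oo, w]) fejer z.

Lemma fejer_cdf_sub (a b : R) : a <= b ->
  fejer_cdf b - fejer_cdf a = fejer_prim b - fejer_prim a.
Proof.
move=> ab; have iS (D : set R) : measurable D -> mu.-integrable D (EFin \o fejer).
  by move=> mD; apply: integrableS integrable_fejer.
rewrite /fejer_cdf Rintegral_itvB//; last exact: iS.
rewrite Rintegral_itv_obnd_cbnd; last exact: iS.
by rewrite /Rintegral (integral_is_derive ab is_derive_fejer_prim continuous_fejer).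
Qed.

(** Links the bounded, monotone primitive with the one expressed by frequencies. The constant
    [fejer_cdf 0] is left unevaluated, as it cancels when two laws are compared. *)
Lemma fejer_cdfE (w : R) : fejer_cdf w = fejer_cdf 0 + fejer_prim w.
Proof.
have [w0|/ltW w0] := leP 0 w.
  by have := fejer_cdf_sub w0; rewrite fejer_prim0 subr0 => <-; rewrite addrC subrK.
have := fejer_cdf_sub w0; rewrite fejer_prim0 sub0r => /eqP.
by rewrite subr_eq => /eqP ->; rewrite addrAC addNr add0r.
Qed.

Lemma fejer_cdf_bounded (w : R) : 0 <= fejer_cdf w <= fejer_mass.
Proof.
rewrite /fejer_cdf; apply/andP; split.
  by apply: Rintegral_ge0 => x _; exact: fejer_ge0.
rewrite Rintegral_mkcond; apply: le_Rintegral => //.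
- rewrite (_ : EFin \o _ = (EFin \o fejer) \_ `]-oo, w]); last first.
    by apply/funext => x; rewrite /= !patchE; case: ifP.
  have iw : mu.-integrable (`]-oo, w]%classic : set R) (EFin \o fejer).
    by apply: integrableS integrable_fejer.
  exact: (iffLR (integrable_mkcond _ _) iw).
- exact: integrable_fejer.
- by move=> x _; rewrite patchE; case: ifP => _ //; exact: fejer_ge0.
Qed.

End FejerPrimitive.

(** * Smoothed distribution functions and their Fourier form *)

Section Smoothing.
Context {R : realType} {dO : measure_display} {Omega : measurableType dO}.
Variables (P : probability Omega R) (Y : Omega -> R).
Hypothesis mY : measurable_fun setT Y.
Local Notation mu := (@lebesgue_measure R).

Definition rv_cdf (x : R) : R := fine (P [set w | Y w <= x]).

Lemma measurable_le_set (x : R) : measurable [set w | Y w <= x].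
Proof.
rewrite (_ : [set w | _] = Y @^-1` `]-oo, x]).
  by rewrite -[X in measurable X]setTI; exact: mY.
by apply/seteqP; split => w /=; rewrite in_itv.
Qed.

Lemma rv_cdfE (x : R) : P [set w | Y w <= x] = (rv_cdf x)%:E.
Proof. by rewrite /rv_cdf fineK// fin_num_measure//; exact: measurable_le_set. Qed.

Lemma rv_cdf_bounded (x : R) : 0 <= rv_cdf x <= 1.
Proof.
rewrite -!lee_fin -rv_cdfE measure_ge0/=; apply: probability_le1.
exact: measurable_le_set.
Qed.

Lemma rv_cdf_nondecreasing (x y : R) : x <= y -> rv_cdf x <= rv_cdf y.
Proof.
move=> xy; rewrite -lee_fin -!rv_cdfE; apply: le_measure.
- by rewrite inE; exact: measurable_le_set.
- by rewrite inE; exact: measurable_le_set.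
- by move=> w /= /le_trans; exact.
Qed.

Let smooth (b : R) (q : Omega * R) : \bar R :=
  (fejer q.2 * \1_(`]-oo, b]%classic) (q.2 + Y q.1))%:E.

Let measurable_smooth b : measurable_fun setT (smooth b).
Proof.
apply/measurable_EFinP; apply: measurable_funM.
  have mf : measurable_fun [set: R] fejer.
    by apply: continuous_measurable_fun; exact: continuous_fejer.
  exact: (measurableT_comp mf measurable_snd).
have mi : measurable_fun [set: R] (\1_(`]-oo, b]%classic) : R -> R) by exact: measurable_indic.
apply: (measurableT_comp mi); apply: measurable_funD; first exact: measurable_snd.
exact: (measurableT_comp mY measurable_fst).
Qed.

Let smooth_ge0 b q : (0 <= smooth b q)%E.
Proof. by rewrite lee_fin mulr_ge0 ?fejer_ge0// indicE. Qed.

Lemma measurable_fejer_comp (g : R -> R) (b : R) : continuous g ->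
  measurable_fun setT (fun w => g (b - Y w)).
Proof.
move=> cg; apply: (@measurableT_comp _ _ _ _ _ _ g) => //.
  exact: continuous_measurable_fun.
exact: measurable_funB.
Qed.

Lemma integrable_fejer_prim (b : R) :
  P.-integrable setT (fun w => (fejer_prim (b - Y w))%:E).
Proof.
apply: measurable_bounded_integrable => //.
- by rewrite [X in (X < _)%E](probability_setT P) ltry.
- by apply: measurable_fejer_comp; exact: continuous_fejer_prim.
- exists (`|fejer_cdf 0 : R| + @fejer_mass R); split; first exact: num_real.
  move=> M hM w _; apply: le_trans (ltW hM).
  have := fejer_cdfE (b - Y w); have /andP[h1 h2] := fejer_cdf_bounded (b - Y w).
  move=> h; have -> : fejer_prim (b - Y w) = fejer_cdf (b - Y w) - fejer_cdf 0 by rewrite h; ring.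
  by rewrite (le_trans (ler_normB _ _))// addrC lerD2l ger0_norm.
Qed.

Lemma integrable_cdf_fejer (b : R) :
  mu.-integrable setT (fun z => (rv_cdf (b - z) * fejer z)%:E).
Proof.
have mc : measurable_fun setT (fun z : R => rv_cdf (b - z)).
  apply: (@measurableT_comp _ _ _ _ _ _ rv_cdf); last exact: measurable_funB.
  by apply: nondecreasing_measurable => // x y; exact: rv_cdf_nondecreasing.
apply: (le_integrable measurableT _ _ integrable_fejer).
  apply/measurable_EFinP; apply: measurable_funM => //.
  by apply: continuous_measurable_fun; exact: continuous_fejer.
move=> z _; rewrite /= lee_fin normrM ler_piMl//.
by have /andP[h0 h1] := rv_cdf_bounded (b - z); rewrite ger0_norm.
Qed.

(** By Tonelli, both sides are the mass of the pairs with [z + Y w <= b] under the product of [P]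
    and the measure of density [fejer]. *)
Lemma smoothed_cdf (b : R) :
  \int[mu]_z (rv_cdf (b - z) * fejer z) =
  fejer_cdf 0 + Rintegral P setT (fun w => fejer_prim (b - Y w)).
Proof.
have H := @fubini_tonelli _ _ _ _ _ P mu (smooth b) (measurable_smooth b) (smooth_ge0 b).
have E1 : (\int[mu]_z (rv_cdf (b - z) * fejer z)%:E = \int[mu]_y \int[P]_x smooth b (x, y))%E.
  apply: eq_integral => z _; rewrite /smooth /=.
  under eq_integral do rewrite EFinM.
  rewrite ge0_integralZl_EFin ?fejer_ge0//; last first.
    apply/measurable_EFinP.
    have mi : measurable_fun [set: R] (\1_(`]-oo, b]%classic) : R -> R) by exact: measurable_indic.
    by apply: (measurableT_comp mi); apply: measurable_funD.
  rewrite mulrC EFinM -rv_cdfE; congr (_ * _)%E.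
  rewrite -(setIT [set w | _]) -integral_indic//; last exact: measurable_le_set.
  apply: eq_integral => w _; rewrite !indicE; congr ((nat_of_bool _)%:R%:E).
  by apply/idP/idP; rewrite !inE /= in_itv /= lerBrDl.
have E2 : (\int[P]_x \int[mu]_y smooth b (x, y) = \int[P]_x (fejer_cdf (b - Y x))%:E)%E.
  apply: eq_integral => w _; rewrite /smooth /=.
  have iS : mu.-integrable (`]-oo, (b - Y w)]%classic : set R) (EFin \o fejer).
    by apply: integrableS integrable_fejer.
  rewrite /fejer_cdf /Rintegral fineK; last exact: integrable_fin_num.
  rewrite [RHS]integral_mkcond; apply: eq_integral => z _.
  rewrite patchE indicE.
  have -> : (z + Y w \in (`]-oo, b]%classic : set R)) = (z \in (`]-oo, (b - Y w)]%classic : set R)).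
    by apply/idP/idP; rewrite !inE /= !in_itv /= lerBrDr.
  by case: (z \in _); rewrite ?mulr1 ?mulr0.
rewrite {1}/Rintegral E1 -H E2.
rewrite -[LHS]/(Rintegral P setT (fun x => fejer_cdf (b - Y x))).
under eq_Rintegral do rewrite fejer_cdfE.
rewrite RintegralD//; last 2 first.
- exact: finite_measure_integrable_cst.
- exact: integrable_fejer_prim.
by rewrite Rintegral_cst// [X in fine X](probability_setT P) mulr1.
Qed.

Hypothesis EY : P.-integrable setT (EFin \o Y).

Definition ecos (t : R) : R := Rintegral P setT (fun w => cos (t * Y w)).
Definition esin (t : R) : R := Rintegral P setT (fun w => sin (t * Y w)).

Lemma integrable_trig (f : R -> R) (a t : R) : continuous f -> (forall x, `|f x| <= 1) ->
  P.-integrable setT (EFin \o (fun w => f (t * (a + Y w)))).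
Proof.
move=> cf f1; apply: measurable_bounded_integrable => //.
- by rewrite [X in (X < _)%E](probability_setT P) ltry.
- apply: (@measurableT_comp _ _ _ _ _ _ f); first exact: continuous_measurable_fun.
  by apply: measurable_funM => //; exact: measurable_funD.
- exists 1; split; first exact: num_real.
  by move=> M hM w _; apply: le_trans (ltW hM); exact: f1.
Qed.

Lemma expectation_sin (b t : R) :
  Rintegral P setT (fun w => sin (t * (b - Y w))) =
  sin (t * b) * ecos t - cos (t * b) * esin t.
Proof.
have ic := integrable_trig 0 t (@continuous_cos R) (@cos_max R).
have is_ := integrable_trig 0 t (@continuous_sin R) (@sin_max R).
have ic' : P.-integrable setT (EFin \o (fun w => cos (t * Y w))).
  by move: ic; under eq_fun do rewrite add0r.
have is' : P.-integrable setT (EFin \o (fun w => sin (t * Y w))).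
  by move: is_; under eq_fun do rewrite add0r.
under eq_Rintegral do rewrite mulrBr sinB.
rewrite RintegralB//; last 2 first.
- exact: (@fin_integrableZ _ _ _ P (sin (t * b)) (fun w => cos (t * Y w)) ic').
- exact: (@fin_integrableZ _ _ _ P (cos (t * b)) (fun w => sin (t * Y w)) is').
by rewrite !RintegralZl.
Qed.

Let kern (b : R) (q : Omega * R) : \bar R :=
  (fejer_weight q.2 * sin (q.2 * (b - Y q.1)))%:E.

(** Fubini's theorem exchanges the expectation with the frequency integral. The bound [|b - Y|] on
    []0, 1]] compensates the singularity of the weight at 0, and this is where the first moment of
    [Y] enters. *)
Lemma expectation_fejer_prim (b : R) :
  Rintegral P setT (fun w => fejer_prim (b - Y w)) =
    \int[mu]_t (fejer_weight t * (sin (t * b) * ecos t - cos (t * b) * esin t)) /\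
  mu.-integrable setT
    (EFin \o (fun t => fejer_weight t * (sin (t * b) * ecos t - cos (t * b) * esin t))).
Proof.
have mk : measurable_fun setT (kern b).
  apply/measurable_EFinP; apply: measurable_funM.
    exact: (measurableT_comp measurable_fejer_weight measurable_snd).
  have ms : measurable_fun [set: R] (@sin R).
    by apply: continuous_measurable_fun; exact: continuous_sin.
  apply: (measurableT_comp ms); apply: measurable_funM; first exact: measurable_snd.
  by apply: measurable_funB => //; exact: (measurableT_comp mY measurable_fst).
have mbY : measurable_fun setT (fun w => b - Y w) by exact: measurable_funB.
have ik : (P \x mu)%E.-integrable setT (kern b).
  apply/(integrable12ltyP P mu mk).
  apply: (@le_lt_trans _ _ (\int[P]_x (`|b - Y x|)%:E)%E).
    apply: ge0_le_integral => //.
    - by move=> x _; apply: integral_ge0.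
    - apply: (@measurable_fun_fubini_tonelli_F _ _ _ _ _ mu (fun q => `|kern b q|%E)) => //.
      exact: measurableT_comp.
    - by apply/measurable_EFinP; exact: measurableT_comp.
    - move=> w _; apply: (@le_trans _ _ (\int[mu]_t (`|b - Y w| * \1_(`]0%R, 1%R]%classic) t)%:E)%E).
        apply: ge0_le_integral => //.
        + apply: measurableT_comp => //; apply/measurable_EFinP => /=.
          exact: (measurable_weight_sin (b - Y w)).
        + by apply/measurable_EFinP; apply: measurable_funM.
        + by move=> t _; rewrite /kern /= lee_fin fejer_weight_bound.
      under eq_integral do rewrite EFinM.
      rewrite ge0_integralZl_EFin//; last by apply/measurable_EFinP.
      rewrite integral_indic// setIT [X in (_ * X)%E]lebesgue_measure_itv /= lte01.
      by rewrite oppr0 adde0 mule1.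
  have : P.-integrable setT (fun w => (b - Y w)%:E).
    apply: fin_integrableB => //.
    exact: finite_measure_integrable_cst.
  by move=> /integrableP[].
have F := Fubini ik.
have E t : fejer_weight t * (sin (t * b) * ecos t - cos (t * b) * esin t) =
    Rintegral P setT (fun w => fejer_weight t * sin (t * (b - Y w))).
  rewrite -expectation_sin RintegralZl//.
  have := integrable_trig (- b) (- t) (@continuous_sin R) (@sin_max R).
  apply: eq_integrable => // w _ /=; congr (sin _)%:E; ring.
have iE t : P.-integrable setT (EFin \o (fun w => fejer_weight t * sin (t * (b - Y w)))).
  apply: (@fin_integrableZ _ _ _ P _ (fun w => sin (t * (b - Y w)))).
  have := integrable_trig (- b) (- t) (@continuous_sin R) (@sin_max R).
  apply: eq_integrable => // w _ /=; congr (sin _)%:E; ring.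
have EE : (fun t => (fejer_weight t * (sin (t * b) * ecos t - cos (t * b) * esin t))%:E) =
    (fun t => \int[P]_x kern b (x, t))%E.
  apply/funext => t; rewrite E /Rintegral fineK//.
  exact: (integrable_fin_num measurableT (iE t)).
split.
  rewrite /Rintegral EE -F; congr fine; apply: eq_integral => w _.
  rewrite /fejer_prim /Rintegral fineK//.
  exact: (integrable_fin_num measurableT (integrable_weight_sin (b - Y w))).
rewrite (_ : EFin \o _ = (fun t => \int[P]_x kern b (x, t))%E)//.
have mG : measurable_fun setT (fun t => \int[P]_x kern b (x, t))%E.
  exact: (measurable_fubini_G ik).
apply/integrableP; split => //.
apply: le_lt_trans (iffLR (integrable21ltyP P mu mk) ik).
have makern : measurable_fun setT (fun q => `|kern b q|%E) by exact: measurableT_comp.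
apply: ge0_le_integral => //.
- exact: measurableT_comp.
- exact: (@measurable_fun_fubini_tonelli_G _ _ _ _ _ P (fun q => `|kern b q|%E)).
- move=> t _; apply: le_abse_integral => //.
  by have /integrableP[] := iE t.
Qed.

End Smoothing.

(** * The smoothing inequality *)

Section EsseenInequality.
Context {R : realType}.
Local Notation mu := (@lebesgue_measure R).

Let inI (h : R) : R -> R := \1_(`[(- h), h]%classic).

Let integrable_cut (h : R) : mu.-integrable setT (fun z => (inI h z * fejer z)%:E).
Proof.
apply: (le_integrable measurableT _ _ integrable_fejer).
  apply/measurable_EFinP; apply: measurable_funM; first exact: measurable_indic.
  by apply: continuous_measurable_fun; exact: continuous_fejer.
move=> z _; rewrite /= lee_fin normrM ler_piMl// /inI indicE.
by case: (z \in _); rewrite ?normr1 ?normr0.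
Qed.

(** With three quarters of the mass inside the window, an a priori bound on the distance comes back
    in [fejer_average] with weight one quarter against three quarters; the ratio 1/3 makes the
    bootstrap converge. *)
Lemma fejer_cut_mass : exists h : R, 0 <= h /\
  3 / 4 * fejer_mass <= \int[mu]_z (inI h z * fejer z).
Proof.
pose f (n : nat) (z : R) := (inI n%:R z * fejer z)%:E.
have mf n : measurable_fun setT (f n).
  by have /integrableP[] := integrable_cut n%:R.
have [] := @dominated_convergence _ _ R mu setT measurableT f (EFin \o fejer) (EFin \o fejer) mf.
- by have /integrableP[] := @integrable_fejer R.
- apply: aeW => z _; apply: cvg_near_cst; near=> n.
  rewrite /f /inI indicE mem_set ?mul1r//= in_itv/= -ler_norml.
  by near: n; exact: nbhs_infty_ger.
- exact: integrable_fejer.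
- apply: aeW => z n _; rewrite /f /= lee_fin normrM ger0_norm; last by rewrite /inI indicE.
  rewrite ger0_norm ?fejer_ge0// ler_piMl ?fejer_ge0// /inI indicE.
  by case: (z \in _).
move=> _ _ cv.
have Lf : (\int[mu]_z (EFin \o fejer) z)%E = (@fejer_mass R)%:E.
  by rewrite /fejer_mass /Rintegral fineK//; exact: (integrable_fin_num measurableT integrable_fejer).
rewrite Lf in cv.
have /fine_cvgP[_ cv'] := cv.
have L0 := @fejer_mass_gt0 R.
have : \forall n \near \oo, 3 / 4 * fejer_mass <= \int[mu]_z (inI n%:R z * fejer z).
  have l4 : 0 < @fejer_mass R / 4 by rewrite divr_gt0.
  move/cvgrPdist_le : cv' => /(_ _ l4); apply: filterS => n /=.
  rewrite -/(Rintegral mu setT (fun z => inI n%:R z * fejer z)).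
  by rewrite ler_norml => /andP[_ h]; lra.
move=> [n _ /(_ n (leqnn n)) hn].
by exists n%:R.
Unshelve. all: by end_near. Qed.

Lemma fejer_average (D : R -> R) (dl De K h : R) :
  mu.-integrable setT (fun z => (D z * fejer z)%:E) ->
  (forall z, `|z| <= h -> dl <= D z) -> (forall z, - De <= D z) -> 0 <= dl -> 0 <= De ->
  3 / 4 * fejer_mass <= \int[mu]_z (inI h z * fejer z) ->
  \int[mu]_z (D z * fejer z) <= K ->
  3 / 4 * fejer_mass * dl <= K + De * fejer_mass / 4.
Proof.
move=> iD Dh Dge dl0 De0; set A := \int[mu]_z (inI h z * fejer z) => hA hK.
have iA := integrable_cut h; have iF := @integrable_fejer R.
have : (dl + De) * A - De * fejer_mass <= \int[mu]_z (D z * fejer z).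
  rewrite -(fin_RintegralZ _ iA) -(fin_RintegralZ _ iF) -fin_RintegralB; last 2 first.
  - exact: fin_integrableZ.
  - exact: (fin_integrableZ De iF).
  apply: le_Rintegral => //.
    by apply: fin_integrableB; [exact: fin_integrableZ|exact: (fin_integrableZ De iF)].
  move=> z _; rewrite mulrA -mulrBl ler_wpM2r ?fejer_ge0// /inI indicE.
  case: (boolP (z \in _)) => [|_]; last by rewrite mulr0 sub0r.
  by rewrite inE /= in_itv /= -ler_norml => /Dh; rewrite mulr1 addrK.
have : (dl + De) * (3 / 4 * fejer_mass) <= (dl + De) * A by rewrite ler_wpM2l// addr_ge0.
lra.
Qed.

(** A gap between a nondecreasing and a Lipschitz function persists on one side: to the right of
    [x0] if [F1] is above, to the left if below. The shift by [h] places the whole window [|z| <= h]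
    on that side. *)
Lemma cdf_window (F1 F2 : R -> R) (m h x0 z : R) : 0 <= m ->
  (forall x y, x <= y -> F1 x <= F1 y) ->
  (forall x y, x <= y -> F2 y - F2 x <= m * (y - x)) -> `|z| <= h ->
  F1 x0 - F2 x0 - m * (2 * h) <= F1 (x0 + h - z) - F2 (x0 + h - z) /\
  F2 x0 - F1 x0 - m * (2 * h) <= - (F1 (x0 - h - z) - F2 (x0 - h - z)).
Proof.
move=> m0 F1m lip; rewrite ler_norml => /andP[z1 z2]; split.
  have e1 : x0 <= x0 + h - z by lra.
  have h1 := F1m _ _ e1; have h2 := lip _ _ e1.
  have : m * (x0 + h - z - x0) <= m * (2 * h) by apply: ler_wpM2l => //; lra.
  lra.
have e1 : x0 - h - z <= x0 by lra.
have h1 := F1m _ _ e1; have h2 := lip _ _ e1.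
have : m * (x0 - (x0 - h - z)) <= m * (2 * h) by apply: ler_wpM2l => //; lra.
lra.
Qed.

(** The cut-off frequency is normalised to 1; callers rescale the variables, so [m] plays the part
    of the Lipschitz constant divided by the cut-off. [k t] bounds the gap of the characteristic
    functions divided by [t], and [C] is uniform over all probability spaces. *)
Lemma esseen : exists C : R, 0 <= C /\
  forall (d1 d2 : measure_display) (O1 : measurableType d1) (O2 : measurableType d2)
    (P1 : probability O1 R) (P2 : probability O2 R) (Y1 : O1 -> R) (Y2 : O2 -> R)
    (m K : R) (k : R -> R),
  measurable_fun setT Y1 -> measurable_fun setT Y2 ->
  P1.-integrable setT (EFin \o Y1) -> P2.-integrable setT (EFin \o Y2) ->
  0 <= m -> 0 <= K ->
  (forall x y, x <= y -> rv_cdf P2 Y2 y - rv_cdf P2 Y2 x <= m * (y - x)) ->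
  mu.-integrable `]0, 1] (EFin \o k) -> \int[mu]_(t in `]0, 1]) k t <= K ->
  (forall t, 0 < t <= 1 -> `|ecos P1 Y1 t - ecos P2 Y2 t| <= t * k t) ->
  (forall t, 0 < t <= 1 -> `|esin P1 Y1 t - esin P2 Y2 t| <= t * k t) ->
  forall x, `|rv_cdf P1 Y1 x - rv_cdf P2 Y2 x| <= C * (m + K).
Proof.
have [h [h0 hA]] := fejer_cut_mass.
have L0 := @fejer_mass_gt0 R; set L := @fejer_mass R in L0 hA.
exists (3 * h + 4 / L); split; first by rewrite addr_ge0// ?mulr_ge0// invr_ge0 ltW.
move=> d1 d2 O1 O2 P1 P2 Y1 Y2 m K k mY1 mY2 iY1 iY2 m0 K0 lip ik kK hc hs.
pose F1 := rv_cdf P1 Y1; pose F2 := rv_cdf P2 Y2.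
(* [2 * m * h] is lost by sliding over the window; the rest is the integral bound [2 * K] divided by
   the mass [3 / 4 * L]. *)
pose a := 2 * m * h + 8 / (3 * L) * K.
have a0 : 0 <= a by rewrite addr_ge0// !mulr_ge0// invr_ge0 mulr_ge0// ltW.
have diffE b : `|\int[mu]_z ((F1 (b - z) - F2 (b - z)) * fejer z)| <= 2 * K /\
    mu.-integrable setT (fun z => ((F1 (b - z) - F2 (b - z)) * fejer z)%:E).
  have i1 := integrable_cdf_fejer P1 mY1 b; have i2 := integrable_cdf_fejer P2 mY2 b.
  split; last by under eq_fun do rewrite mulrBl; exact: fin_integrableB.
  under eq_Rintegral do rewrite mulrBl.
  rewrite (fin_RintegralB i1 i2) (smoothed_cdf P1 mY1) (smoothed_cdf P2 mY2).
  have [-> j1] := expectation_fejer_prim mY1 iY1 b.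
  have [-> j2] := expectation_fejer_prim mY2 iY2 b.
  rewrite opprD addrACA subrr add0r -(fin_RintegralB j1 j2).
  have ikT : mu.-integrable setT (EFin \o (fun t => 2 * (k \_ `]0, 1]) t)).
    apply: (@fin_integrableZ _ _ _ mu 2 (k \_ `]0, 1])).
    rewrite (_ : (fun x => _) = (EFin \o k) \_ `]0, 1]).
      exact: (iffLR (integrable_mkcond _ _) ik).
    by apply/funext => t; rewrite /= !patchE; case: ifP.
  have jB := fin_integrableB j1 j2.
  apply: (le_trans (le_normr_Rintegral _ jB)) => //.
  apply: (@le_trans _ _ (\int[mu]_t (2 * (k \_ `]0, 1]) t))).
    apply: le_Rintegral => //; first exact: integrable_norm.
    move=> t _; rewrite -mulrBr normrM /fejer_weight patchE indicE.
    case: (boolP (t \in _)) => [|_]; last by rewrite !mulr0 normr0 mul0r.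
    rewrite inE /= in_itv /= => t01; have /andP[t0 t1] := t01.
    have hct := hc t t01; have hst := hs t t01.
    have k0 : 0 <= k t.
      by rewrite -(pmulr_rge0 _ t0); exact: le_trans (normr_ge0 _) hct.
    rewrite mulr1 normrM normfV [`|t|]gtr0_norm//.
    set c1 := ecos _ _ _ in hct *; set c2 := ecos _ _ _ in hct *.
    set s1 := esin _ _ _ in hst *; set s2 := esin _ _ _ in hst *.
    have -> : sin (t * b) * c1 - cos (t * b) * s1 - (sin (t * b) * c2 - cos (t * b) * s2) =
      sin (t * b) * (c1 - c2) - cos (t * b) * (s1 - s2) by ring.
    have h1 : `|sin (t * b) * (c1 - c2) - cos (t * b) * (s1 - s2)| <= 2 * (t * k t).
      rewrite (le_trans (ler_normB _ _))// mulr2n mulrDl mul1r lerD// normrM -[leRHS]mul1r.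
        by apply: ler_pM => //; exact: sin_max.
      by apply: ler_pM => //; exact: cos_max.
    have t1' : `|1 - t| <= 1 by rewrite ler_norml; lra.
    apply: (@le_trans _ _ (1 * t^-1 * (2 * (t * k t)))).
      apply: ler_pM => //; first by rewrite mulr_ge0// invr_ge0 ltW.
      by rewrite ler_wpM2r// invr_ge0 ltW.
    by rewrite mul1r mulrCA mulKf ?gt_eqF.
  rewrite (fin_RintegralZ _ _).
    by rewrite ler_pM2l// -Rintegral_mkcond.
  rewrite (_ : (fun x => _) = (EFin \o k) \_ `]0, 1]).
    exact: (iffLR (integrable_mkcond _ _) ik).
  by apply/funext => t; rewrite /= !patchE; case: ifP.
have F1m := rv_cdf_nondecreasing P1 mY1.
have conv dl De : 3 / 4 * L * dl <= 2 * K + De * L / 4 -> dl <= 8 / (3 * L) * K + De / 3.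
  have -> : 8 / (3 * L) * K + De / 3 = (2 * K + De * L / 4) * (4 / (3 * L)).
    by field; rewrite gt_eqF.
  by move=> H; rewrite mulrA ler_pdivlMr ?mulr_gt0//; lra.
(* Bootstrap: an a priori bound [De] on the distance improves to [a + De / 3]. *)
have step De : 0 <= De -> (forall x, `|F1 x - F2 x| <= De) ->
    forall x, `|F1 x - F2 x| <= a + De / 3.
  move=> De0 HDe x0.
  have HDe' x : - De <= F1 x - F2 x <= De by rewrite -ler_norml.
  rewrite ler_norml; apply/andP; split.
    have [neg|pos] := leP (F2 x0 - F1 x0 - m * (2 * h)) 0.
      have : 0 <= 8 / (3 * L) * K by rewrite !mulr_ge0// invr_ge0 mulr_ge0// ltW.
      have : 0 <= De / 3 by rewrite divr_ge0.
      by rewrite /a; lra.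
    have [d1' d2'] := diffE (x0 - h).
    have NE : (fun z => - (F1 (x0 - h - z) - F2 (x0 - h - z)) * fejer z) =
      (fun z => -1 * ((F1 (x0 - h - z) - F2 (x0 - h - z)) * fejer z)).
      by apply/funext => z; rewrite mulN1r mulNr.
    have iD : mu.-integrable setT
        (fun z => (- (F1 (x0 - h - z) - F2 (x0 - h - z)) * fejer z)%:E).
      rewrite (_ : (fun z => _) =
        (fun z => (-1 * ((F1 (x0 - h - z) - F2 (x0 - h - z)) * fejer z))%:E)).
        exact: (fin_integrableZ (-1) d2').
      by apply/funext => z; rewrite mulN1r mulNr.
    have H : 3 / 4 * L * (F2 x0 - F1 x0 - m * (2 * h)) <= 2 * K + De * L / 4.
      apply: (@fejer_average _ _ _ _ h iD) => //.
      - by move=> z zh; have [] := cdf_window x0 m0 F1m lip zh.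
      - by move=> z; rewrite lerN2; have /andP[] := HDe' (x0 - h - z).
      - exact: ltW.
      - rewrite NE (fin_RintegralZ _ d2') mulN1r.
        by move: d1'; rewrite ler_norml => /andP[d3 _]; rewrite lerNl.
    have := conv _ _ H; rewrite /a; lra.
  have [neg|pos] := leP (F1 x0 - F2 x0 - m * (2 * h)) 0.
    have : 0 <= 8 / (3 * L) * K by rewrite !mulr_ge0// invr_ge0 mulr_ge0// ltW.
    have : 0 <= De / 3 by rewrite divr_ge0.
    by rewrite /a; lra.
  have [d1' d2'] := diffE (x0 + h).
  have H : 3 / 4 * L * (F1 x0 - F2 x0 - m * (2 * h)) <= 2 * K + De * L / 4.
    apply: (@fejer_average _ _ _ _ h d2') => //.
    - by move=> z zh; have [] := cdf_window x0 m0 F1m lip zh.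
    - by move=> z; have /andP[] := HDe' (x0 + h - z).
    - exact: ltW.
    - by move: d1'; rewrite ler_norml => /andP[].
  have := conv _ _ H; rewrite /a; lra.
(* [3 / 2 * a] is the fixed point of [De -> a + De / 3]. The iteration starts from the trivial bound
   1. *)
have iter n x : `|F1 x - F2 x| <= 3 / 2 * a + (1 / 3) ^+ n.
  elim: n x => [|n IH] x.
    have /andP[a1 a2] := rv_cdf_bounded P1 mY1 x.
    have /andP[a3 a4] := rv_cdf_bounded P2 mY2 x.
    by rewrite expr0 ler_norml /F1 /F2; lra.
  have n0 : 0 <= (1 / 3 : R) ^+ n by rewrite exprn_ge0// divr_ge0.
  have De0 : 0 <= 3 / 2 * a + (1 / 3) ^+ n by lra.
  by rewrite exprS; apply: (le_trans (step _ De0 IH x)); lra.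
move=> x; apply: (@le_trans _ _ (3 / 2 * a)).
  apply/ler_addgt0Pr => e e0.
  have [|n hn] := @expr_small R (1 / 3) e _ e0; first by apply/andP; split; lra.
  by apply: (le_trans (iter n x)); rewrite lerD2l.
have -> : (3 * h + 4 / L) * (m + K) = 3 / 2 * a + 3 * h * K + 4 / L * m.
  by rewrite /a; field; rewrite gt_eqF.
have : 0 <= 3 * h * K by rewrite !mulr_ge0.
have : 0 <= 4 / L * m by rewrite mulr_ge0// divr_ge0// ltW.
lra.
Qed.

End EsseenInequality.

(** * The normal distribution *)

Section NormalCharacteristicFunction.
Context {R : realType}.
Local Notation mu := (@lebesgue_measure R).
Variable s : R.
Hypothesis s0 : s != 0.

Local Notation N := (normal_prob 0 s).
Let p := normal_pdf 0 s.

Let s2 : 0 < s ^+ 2.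
Proof. by rewrite lt0r sqrf_eq0 s0 sqr_ge0. Qed.

Let pE (x : R) : p x = normal_peak s * expR (- x ^+ 2 / (2 * s ^+ 2)).
Proof.
rewrite /p /normal_pdf (negbTE s0) /normal_fun subr0.
by congr (_ * expR (_ / _)); rewrite mulr_natl.
Qed.

Lemma integral_normal_prob (f : R -> \bar R) : N.-integrable setT f ->
  (\int[N]_x f x = \int[mu]_x (f x * (normal_pdf 0 s x)%:E))%E.
Proof.
move=> fi; rewrite -(Radon_Nikodym_change_of_variables (normal_prob_dominates 0 s))//=.
have mf := measurable_int _ fi.
apply: ae_eq_integral => //.
- apply: emeasurable_funM => //; apply: (measurable_int mu).
  by apply: Radon_Nikodym_integrable; exact: normal_prob_dominates.
- apply: emeasurable_funM => //; apply/measurable_EFinP.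
  exact: measurable_normal_pdf.
- apply: ae_eqe_mul2l; rewrite Radon_NikodymE//=; first exact: normal_prob_dominates.
  move=> dom; case: cid => /= h [h1 h2 h3].
  apply: integral_ae_eq => //=.
  + by apply/measurable_EFinP; exact: measurable_normal_pdf.
  + by move=> A _ mA; rewrite -h3.
Qed.

(** Serves to prove integrability under [N], where [integral_normal_prob] would be circular. *)
Lemma ge0_integral_normal_prob (f : R -> \bar R) : (forall x, (0 <= f x)%E) ->
  measurable_fun setT f ->
  (\int[N]_x f x = \int[mu]_x (f x * (normal_pdf 0 s x)%:E))%E.
Proof.
move=> f0 mf; have dom := normal_prob_dominates 0 s.
rewrite -(Radon_Nikodym_SigmaFinite.change_of_variables dom)//.
have i1 := Radon_Nikodym_SigmaFinite.f_integrable dom.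
apply: ae_eq_integral => //.
- by apply: emeasurable_funM => //; exact: (measurable_int mu).
- apply: emeasurable_funM => //; apply/measurable_EFinP.
  exact: measurable_normal_pdf.
- apply: ae_eqe_mul2l; apply: integral_ae_eq => //=.
  + by apply/measurable_EFinP; exact: measurable_normal_pdf.
  + by move=> A _ mA; rewrite -Radon_Nikodym_SigmaFinite.f_integral.
Qed.

Let is_derive_p (x : R) : is_derive x (1 : R) p (- (x / s ^+ 2) * p x).
Proof.
have -> : p = (fun x => normal_peak s * expR (- x ^+ 2 / (2 * s ^+ 2))) by apply/funext.
have d1 : is_derive x (1 : R) (fun x : R => - x ^+ 2 / (2 * s ^+ 2)) (- (x / s ^+ 2)).
  by apply: is_derive_eq; rewrite /GRing.scale /=; field.
have d2 := @is_derive1_comp R expR (fun x => - x ^+ 2 / (2 * s ^+ 2)) x _ _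
  (is_derive_expR _) d1.
have d3 : is_derive x (1 : R) (fun x : R => expR (- x ^+ 2 / (2 * s ^+ 2)))
  (expR (- x ^+ 2 / (2 * s ^+ 2)) * (- (x / s ^+ 2))) by exact: d2.
by apply: is_derive_eq; rewrite /GRing.scale /=; ring.
Qed.

Let p0 (x : R) : 0 <= p x. Proof. exact: normal_pdf_ge0. Qed.

Let mp : measurable_fun [set: R] p. Proof. exact: measurable_normal_pdf. Qed.

Let c2 : R := 2 * `|s| * normal_peak s.

Let c20 : 0 <= c2. Proof. by rewrite !mulr_ge0// normal_peak_ge0. Qed.

(** Half of the Gaussian exponent absorbs the factor [|x|], because [y * expR (- y ^+ 2) <= 1]. The
    other half is, up to a constant, the density of variance [2 * s ^+ 2], hence integrable. *)
Let xp_bound (x : R) : `|x| * p x <= c2 * expR (- x ^+ 2 / (4 * s ^+ 2)).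
Proof.
rewrite pE /c2 mulrCA.
have -> : 2 * `|s| * normal_peak s * expR (- x ^+ 2 / (4 * s ^+ 2)) =
  normal_peak s * (2 * `|s| * expR (- x ^+ 2 / (4 * s ^+ 2))) by ring.
rewrite ler_wpM2l ?normal_peak_ge0//.
have sp : 0 < `|s| by rewrite normr_gt0.
pose y := `|x| / (2 * `|s|).
have ys : `|x| = 2 * `|s| * y by rewrite /y mulrC divfK// mulf_neq0// gt_eqF.
have y2 : y ^+ 2 = x ^+ 2 / (4 * s ^+ 2).
  rewrite /y expr_div_n exprMn !real_normK ?num_real//.
  by congr (_ / (_ * _)); rewrite expr2; ring.
have -> : - x ^+ 2 / (2 * s ^+ 2) = - y ^+ 2 + - y ^+ 2 by rewrite y2; field.
have -> : - x ^+ 2 / (4 * s ^+ 2) = - y ^+ 2 by rewrite y2; field.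
rewrite expRD ys.
have : y * expR (- y ^+ 2) <= 1.
  rewrite expRN ler_pdivrMr ?expR_gt0// mul1r.
  have := expR_ge1Dx (y ^+ 2); have := sqr_ge0 (y - 1); nra.
move=> /(ler_wpM2r (expR_ge0 (- y ^+ 2))); rewrite mul1r => h.
have -> : 2 * `|s| * y * (expR (- y ^+ 2) * expR (- y ^+ 2)) =
  2 * `|s| * (y * expR (- y ^+ 2) * expR (- y ^+ 2)) by ring.
by rewrite ler_pM2l// mulr_gt0.
Qed.

Let s' : R := Num.sqrt 2 * s.
Let s'0 : s' != 0.
Proof. by rewrite mulf_neq0// gt_eqF// sqrtr_gt0. Qed.

Let gauss_half (x : R) :
  expR (- x ^+ 2 / (4 * s ^+ 2)) = (normal_peak s')^-1 * normal_pdf 0 s' x.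
Proof.
rewrite /normal_pdf (negbTE s'0) /normal_fun subr0 mulKf ?gt_eqF ?normal_peak_gt0//.
by congr (expR (_ / _)); rewrite /s' exprMn sqr_sqrtr// -mulr_natl; ring.
Qed.

Lemma integrable_x_normal_pdf : mu.-integrable setT (fun x => (`|x| * p x)%:E).
Proof.
have i0 : mu.-integrable setT (fun x => (c2 * (normal_peak s')^-1 * normal_pdf 0 s' x)%:E).
  by apply: fin_integrableZ; exact: integrable_normal_pdf.
apply: (le_integrable measurableT _ _ i0).
  by apply/measurable_EFinP; apply: measurable_funM; [by []|exact: mp].
move=> x _; rewrite /= lee_fin normrM normr_id [`|p x|]ger0_norm//.
by apply: le_trans (xp_bound x) _; rewrite gauss_half mulrA ler_norm.
Qed.

Let ip : mu.-integrable setT (fun x => (p x)%:E).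
Proof. exact: integrable_normal_pdf. Qed.

(* The last hypothesis makes [F] vanish at infinity. *)
Lemma integral_derivative_eq0 (F f : R -> R) (c : R) :
  (forall x : R, is_derive x (1 : R) F (f x)) -> continuous f ->
  mu.-integrable setT (fun x => (f x)%:E) -> (forall x, `|x| * `|F x| <= c) ->
  \int[mu]_x f x = 0.
Proof.
move=> dF cf fi Fc.
pose g (n : nat) (x : R) := (\1_(`[(- n%:R), n%:R]%classic) x * f x)%:E.
have mg n : measurable_fun setT (g n).
  apply/measurable_EFinP; apply: measurable_funM; first exact: measurable_indic.
  exact: continuous_measurable_fun.
have [] := @dominated_convergence _ _ R mu setT measurableT g (EFin \o f)
  (fun x => `|(f x)%:E|%E) mg.
- by have /integrableP[] := fi.
- apply: aeW => x _; apply: cvg_near_cst; near=> n.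
  rewrite /g indicE mem_set ?mul1r//= in_itv/= -ler_norml.
  by near: n; exact: nbhs_infty_ger.
- exact: integrable_abse.
- apply: aeW => x n _; rewrite /g /= lee_fin normrM indicE ler_piMl//.
  by case: (x \in _); rewrite ?normr1 ?normr0.
move=> _ _ cv.
have gE n : (\int[mu]_x g n x)%E = (F n%:R - F (- n%:R))%:E.
  rewrite -(integral_is_derive _ dF cf); last by rewrite (@le_trans _ _ 0)// oppr_le0.
  rewrite [RHS]integral_mkcond; apply: eq_integral => x _.
  by rewrite /g patchE indicE; case: (x \in _); rewrite ?mul1r ?mul0r.
have cv0 : (fun n => (\int[mu]_x g n x)%E) @ \oo --> (0%R)%:E.
  have -> : (fun n => (\int[mu]_x g n x)%E) = EFin \o (fun n : nat => F n%:R - F (- n%:R)).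
    by apply/funext => n; rewrite gE.
  apply/fine_cvgP; split; first by apply: nearW => n.
  apply/cvgrPdist_le => e e0; near=> n.
  have n0 : 0 < n%:R :> R by rewrite ltr0n; near: n; exact: nbhs_infty_gt.
  have ne : 2 * c / e <= n%:R by near: n; exact: nbhs_infty_ger.
  rewrite sub0r normrN /=.
  have h1 : n%:R * `|F n%:R| <= c by have := Fc n%:R; rewrite [`|n%:R|]gtr0_norm.
  have h2 : n%:R * `|F (- n%:R)| <= c.
    by have := Fc (- n%:R); rewrite [`|- n%:R|]normrN [`|n%:R|]gtr0_norm.
  have h3 := ler_normB (F n%:R) (F (- n%:R)).
  rewrite ler_pdivrMr// in ne; rewrite -(ler_pM2l n0).
  apply: le_trans ne; apply: (@le_trans _ _ (n%:R * (`|F n%:R| + `|F (- n%:R)|))).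
    by rewrite ler_pM2l.
  by rewrite mulrDr; lra.
have := cvg_unique _ cv cv0 => /(_ (@ereal_hausdorff R)) E.
by rewrite /Rintegral -[X in fine X]/(\int[mu]_x (EFin \o f) x)%E E.
Unshelve. all: by end_near. Qed.

(** * Cosine and sine transforms of the density at once, from [f' = f1] and [f1' = - f] *)

Section TrigonometricPair.
Variables f f1 : R -> R.
Hypotheses (df : forall x : R, is_derive x (1 : R) f (f1 x))
  (df1 : forall x : R, is_derive x (1 : R) f1 (- f x))
  (fb : forall x, `|f x| <= 1) (f1b : forall x, `|f1 x| <= 1).

Let Phi (t : R) : R := \int[mu]_x (f (t * x) * p x).

Let cf : continuous f. Proof. exact: is_derive_continuous df. Qed.
Let cf1 : continuous f1. Proof. exact: is_derive_continuous df1. Qed.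
Let cp : continuous p. Proof. exact: is_derive_continuous is_derive_p. Qed.

Let continuous_scaled (g : R -> R) (t : R) : continuous g -> continuous (fun x => g (t * x)).
Proof.
move=> cg x; apply: (@continuous_comp _ _ _ (fun x => t * x) g); last exact: cg.
by apply: cvgM; [exact: cvg_cst|exact: cvg_id].
Qed.

Let mscaled (g : R -> R) (t : R) : continuous g -> measurable_fun setT (fun x => g (t * x)).
Proof. by move=> cg; apply: continuous_measurable_fun; exact: continuous_scaled. Qed.

Let integrable_trig_p (t : R) : mu.-integrable setT (fun x => (f (t * x) * p x)%:E).
Proof.
apply: (le_integrable measurableT _ _ ip).
  by apply/measurable_EFinP; apply: measurable_funM; [exact: mscaled|exact: mp].
by move=> x _; rewrite /= lee_fin normrM ler_piMl.
Qed.

Let integrable_x_trig_p (t : R) : mu.-integrable setT (fun x => (x * f1 (t * x) * p x)%:E).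
Proof.
apply: (le_integrable measurableT _ _ integrable_x_normal_pdf).
  apply/measurable_EFinP; apply: measurable_funM; last exact: mp.
  by apply: measurable_funM => //; exact: mscaled.
move=> x _; rewrite /= lee_fin -mulrA !normrM normr_id ler_wpM2l//.
by rewrite ler_piMl.
Qed.

(** Gaussian integration by parts: the derivative of [f1 (t * x) * p x] has integral 0. *)
Let integral_x_trig (t : R) : \int[mu]_x (x * f1 (t * x) * p x) = - (s ^+ 2 * t) * Phi t.
Proof.
pose F x := f1 (t * x) * p x.
pose F' x := - t * (f (t * x) * p x) - (s ^+ 2)^-1 * (x * f1 (t * x) * p x).
have dF (x : R) : is_derive x (1 : R) F (F' x).
  have d1 : is_derive x (1 : R) (fun x => f1 (t * x)) (t * (- f (t * x))).
    under eq_fun do rewrite mulrC; rewrite [t * x]mulrC.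
    exact: is_derive_scaled.
  have d2 := is_derive_p x.
  by rewrite /F; apply: is_derive_eq; rewrite /GRing.scale /= /F'; field.
have cF' : continuous F'.
  move=> x; apply: cvgB; apply: cvgM; try exact: cvg_cst.
    by apply: cvgM; [exact: continuous_scaled|exact: cp].
  apply: cvgM; last exact: cp.
  by apply: cvgM; [exact: cvg_id|exact: continuous_scaled].
have i1 := fin_integrableZ (- t) (integrable_trig_p t).
have i2 := fin_integrableZ (s ^+ 2)^-1 (integrable_x_trig_p t).
have F0 := @integral_derivative_eq0 F F' c2 dF cF' (fin_integrableB i1 i2).
have {F0} : \int[mu]_x F' x = 0.
  apply: F0 => x; rewrite /F normrM [`|p x|]ger0_norm//.
  apply: (@le_trans _ _ (`|x| * p x)); first by rewrite ler_wpM2l// ler_piMl.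
  apply: (le_trans (xp_bound x)); rewrite ler_piMr// expR_le1.
  by rewrite mulNr oppr_le0 mulr_ge0 ?sqr_ge0// invr_ge0 mulr_ge0// ltW.
rewrite /F' (fin_RintegralB i1 i2) (fin_RintegralZ _ (integrable_trig_p t)).
rewrite (fin_RintegralZ _ (integrable_x_trig_p t)) -/(Phi t).
set I := Rintegral _ _ _ => /eqP; rewrite subr_eq0 => /eqP h.
have -> : I = s ^+ 2 * ((s ^+ 2)^-1 * I) by rewrite mulrA divff ?mul1r// gt_eqF.
by rewrite -h; ring.
Qed.

Let is_derive_Phi (t : R) : is_derive t (1 : R) Phi (- (s ^+ 2 * t) * Phi t).
Proof.
pose k (r x : R) := f (r * x) * p x.
have dk (r x : R) : is_derive r (1 : R) (k ^~ x) (x * f1 (r * x) * p x).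
  have d1 : is_derive r (1 : R) (fun r => f (r * x)) (x * f1 (r * x)).
    exact: is_derive_scaled.
  by rewrite /k; apply: is_derive_eq; rewrite /GRing.scale /=; ring.
have It : `](t - 1), (t + 1)[%classic t by rewrite /= in_itv /=; lra.
have intk (x : R) : `](t - 1), (t + 1)[%classic x -> mu.-integrable setT (EFin \o k x).
  by move=> _; exact: integrable_trig_p.
have derk (x y : R) : `](t - 1), (t + 1)[%classic x -> setT y -> derivable (k ^~ y) x 1.
  by move=> _ _; have [] := dk x y.
have G0 (x : R) : 0 <= `|x| * p x by rewrite mulr_ge0.
have Gub (x y : R) : `](t - 1), (t + 1)[%classic x -> setT y ->
    `|partial1of2 k x y| <= `|y| * p y.
  move=> _ _; rewrite partial1of2E; have [_ ->] := dk x y.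
  rewrite -mulrA !normrM ler_wpM2l// [`|p y|]ger0_norm// ler_piMl//.
have D := derivable_under_integral measurableT It intk derk G0 integrable_x_normal_pdf Gub.
have V := differentiation_under_integral measurableT It intk derk G0 integrable_x_normal_pdf Gub.
have E1 : (fun x' : R => \int[mu]_(y in setT) k x' y) = Phi by [].
rewrite E1 in D V.
apply: DeriveDef => //; rewrite -derive1E V -integral_x_trig.
apply: eq_Rintegral => x _; rewrite partial1of2E; have [_ ->] := dk t x.
by [].
Qed.

(** The transform satisfies [Phi' = - s^2 t Phi], so its product with [exp (s^2 t^2 / 2)] is
    constant. *)
Lemma normal_trig_integral (t : R) :
  \int[mu]_x (f (t * x) * p x) = f 0 * expR (- (s ^+ 2 * t ^+ 2 / 2)).
Proof.
pose Psi (t : R) := Phi t * expR (s ^+ 2 * t ^+ 2 / 2).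
have dPsi (x : R) : is_derive x (1 : R) Psi 0.
  have d0 := is_derive_Phi x.
  have d1 : is_derive x (1 : R) (fun x : R => s ^+ 2 * x ^+ 2 / 2) (s ^+ 2 * x).
    by apply: is_derive_eq; rewrite /GRing.scale /=; field.
  have d2 : is_derive x (1 : R) (fun x : R => expR (s ^+ 2 * x ^+ 2 / 2))
      (expR (s ^+ 2 * x ^+ 2 / 2) * (s ^+ 2 * x)).
    exact: (@is_derive1_comp R expR (fun x => s ^+ 2 * x ^+ 2 / 2) x).
  by rewrite /Psi; apply: is_derive_eq; rewrite /GRing.scale /=; ring.
have := is_derive_0_is_cst t 0 dPsi.
rewrite /Psi expr0n /= mulr0 mul0r expR0 mulr1 => h.
have -> : f 0 = Phi 0.
  rewrite /Phi; under eq_Rintegral do rewrite mul0r.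
  rewrite (fin_RintegralZ _ ip).
  by rewrite /Rintegral integral_normal_pdf mulr1.
by rewrite -h -mulrA -expRD subrr expR0 mulr1.
Qed.

End TrigonometricPair.

Lemma integrable_normal_id (c : R) : N.-integrable setT (EFin \o (fun x => c * x)).
Proof.
apply/integrableP; split; first by apply/measurable_EFinP; exact: measurable_funM.
rewrite ge0_integral_normal_prob//; last first.
  by apply: measurableT_comp => //; apply/measurable_EFinP; exact: measurable_funM.
have ic : mu.-integrable setT (fun x => (`|c| * (`|x| * p x))%:E).
  by apply: fin_integrableZ; exact: integrable_x_normal_pdf.
have /integrableP[_] := ic; apply: le_lt_trans.
rewrite le_eqVlt; apply/orP; left; apply/eqP; apply: eq_integral => x _.
by rewrite /= -EFinM; congr (_%:E); rewrite !normrM normr_id [`|p x|]ger0_norm// mulrA !normr_id.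
Qed.

End NormalCharacteristicFunction.

(** * A scaled normal variable: transforms and Lipschitz distribution function *)

Section NormalVariable.
Context {R : realType}.
Local Notation mu := (@lebesgue_measure R).
Variables (s c : R).
Hypotheses (s0 : 0 < s) (c0 : 0 < c).

Let N : probability (measurableTypeR R) R := normal_prob 0 s.
Let Z : measurableTypeR R -> R := fun x => c * x.

Let sn0 : s != 0. Proof. by rewrite gt_eqF. Qed.

Lemma normal_variable_measurable : measurable_fun setT Z.
Proof. exact: measurable_funM. Qed.

Let normal_trig (f : R -> R) (t : R) : continuous f -> (forall x, `|f x| <= 1) ->
  Rintegral N setT (fun x => f (t * Z x)) = \int[mu]_x (f (t * c * x) * normal_pdf 0 s x).
Proof.
move=> cf f1; have iN : N.-integrable setT (fun x => (f (t * Z x))%:E).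
  have := integrable_trig N normal_variable_measurable 0 t cf f1.
  by under eq_fun do rewrite add0r.
rewrite /Rintegral (integral_normal_prob iN); congr fine.
by apply: eq_integral => x _; rewrite /Z mulrA -EFinM.
Qed.

Lemma normal_ecos (t : R) : ecos N Z t = expR (- (s ^+ 2 * (t * c) ^+ 2 / 2)).
Proof.
rewrite /ecos (normal_trig _ (@continuous_cos R) (@cos_max R)).
have h (x : R) : is_derive x (1 : R) (fun x => - sin x) (- cos x).
  by apply: is_derive_eq.
rewrite (normal_trig_integral sn0 (@is_derive_cos R) h) ?cos0 ?mul1r//.
- exact: cos_max.
- by move=> x; rewrite normrN; exact: sin_max.
Qed.

Lemma normal_esin (t : R) : esin N Z t = 0.
Proof.
rewrite /esin (normal_trig _ (@continuous_sin R) (@sin_max R)).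
rewrite (normal_trig_integral sn0 (@is_derive_sin R) (@is_derive_cos R)) ?sin0 ?mul0r//.
- exact: sin_max.
- exact: cos_max.
Qed.

Lemma normal_cdf_lipschitz (x y : R) : x <= y ->
  rv_cdf N Z y - rv_cdf N Z x <= normal_peak s / c * (y - x).
Proof.
move=> xy; have mZ := normal_variable_measurable.
have xyc : x / c <= y / c by rewrite ler_pM2r ?invr_gt0.
pose A : set R := `]x / c, y / c]%classic.
have mA : measurable A by exact: measurable_itv.
have NA : (N A <= (normal_peak s / c * (y - x))%:E)%E.
  rewrite /N /normal_prob.
  apply: (@le_trans _ _ (\int[mu]_(z in A) (normal_peak s)%:E)%E).
    apply: ge0_le_integral => //.
    - by move=> z _; rewrite lee_fin normal_pdf_ge0.
    - apply: measurable_funTS; apply/measurable_EFinP; exact: measurable_normal_pdf.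
    - by move=> z _; rewrite lee_fin normal_pdf_ub.
  rewrite integral_cst// [X in (_ * X)%E]lebesgue_measure_itv /= lte_fin.
  case: ifPn => _; first by rewrite -EFinB -EFinM lee_fin -mulrBl -mulrA [c^-1 * _]mulrC.
  by rewrite mule0 lee_fin mulr_ge0 ?subr_ge0// divr_ge0 ?normal_peak_ge0 ?ltW.
rewrite lerBlDl -lee_fin EFinD -!rv_cdfE//.
apply: le_trans (leeD2l _ NA).
apply: le_trans (_ : N ([set w | (Z w <= x)%R] `|` A) <= _)%E.
  apply: le_measure.
  - by rewrite inE; exact: measurable_le_set.
  - by rewrite inE; apply: measurableU => //; exact: measurable_le_set.
  - move=> w /=; rewrite /Z => wy; have [wx|wx] := leP (c * w) x; [by left|right].
    by rewrite /A /= in_itv /= ltr_pdivrMr// mulrC wx ler_pdivlMr// mulrC.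
apply: measureU2 => //; exact: measurable_le_set.
Qed.

End NormalVariable.

(** * From Markov chains to Fourier kernels *)

Section LinearExtension.
Context {R : realType} {d : measure_display} {E : measurableType d}.
Implicit Types (f g : E -> R[i]).

Definition bounded_cmeasurable f : Prop :=
  cmeasurable f /\ exists M : R, forall x, cabs (f x) <= M.

Definition cindic (A : set E) : E -> R[i] := fun x => (\1_A x)%:C.

Lemma cmeasurable_cindic A : measurable A -> cmeasurable (cindic A).
Proof. by move=> mA; apply: cmeasurable_real; exact: measurable_indic. Qed.

Lemma cabs_cindic_le1 A x : cabs (cindic A x) <= 1.
Proof.
by rewrite /cindic cabs_real indicE; case: (x \in A); rewrite ?normr1 ?normr0.
Qed.

Lemma bounded_cindic A : measurable A -> bounded_cmeasurable (cindic A).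
Proof.
move=> mA; split; first exact: cmeasurable_cindic.
by exists 1 => x; exact: cabs_cindic_le1.
Qed.

Lemma bounded_cmeasurable_cst (c : R[i]) : bounded_cmeasurable (fun _ => c).
Proof. by split; [exact: cmeasurable_cst|exists (cabs c)]. Qed.

Lemma bounded_cmeasurable_lin (a : R[i]) f g : bounded_cmeasurable f ->
  bounded_cmeasurable g -> bounded_cmeasurable (fun x => a * f x + g x).
Proof.
move=> [mf [Mf hf]] [mg [Mg hg]]; split.
  by apply: cmeasurableD => //; apply: cmeasurableM => //; exact: cmeasurable_cst.
exists (cabs a * Mf + Mg) => x; rewrite (le_trans (cabsD _ _))// cabsM lerD//.
by rewrite ler_wpM2l ?cabs_ge0.
Qed.

Lemma bounded_cmeasurableM f g : bounded_cmeasurable f ->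
  bounded_cmeasurable g -> bounded_cmeasurable (fun x => f x * g x).
Proof.
move=> [mf [Mf hf]] [mg [Mg hg]]; split; first exact: cmeasurableM.
by exists (Mf * Mg) => x; rewrite cabsM ler_pM ?cabs_ge0.
Qed.

(** Linearity and a bound in the uniform norm are enough to pass from indicators to bounded
    functions, which are uniform limits of step functions. *)
Definition sup_functional (L : (E -> R[i]) -> R[i]) : Prop :=
  (forall (a : R[i]) f g, bounded_cmeasurable f -> bounded_cmeasurable g ->
     L (fun x => a * f x + g x) = a * L f + L g) /\
  exists C : R, forall f (M : R), cmeasurable f -> (forall x, cabs (f x) <= M) ->
     cabs (L f) <= C * M.

Lemma sum_ord_lt (J t : nat) : (\sum_(j < J) (j < t)%N)%N = minn J t.
Proof.
elim: J => [|J IH]; first by rewrite big_ord0 min0n.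
rewrite big_ord_recr /= IH; case: (ltnP J t) => Jt.
  by rewrite (minn_idPl Jt) addn1.
by rewrite (minn_idPr (leqW Jt)) addn0.
Qed.

Lemma sup_functional_agree_real L1 L2 (h : E -> R) (M : R) :
  sup_functional L1 -> sup_functional L2 ->
  (forall A, measurable A -> L1 (cindic A) = L2 (cindic A)) ->
  measurable_fun setT h -> (forall x, 0 <= h x <= M) ->
  L1 (fun x => (h x)%:C) = L2 (fun x => (h x)%:C).
Proof.
move=> [L1l [C1 L1b]] [L2l [C2 L2b]] ind mh hM.
apply/eqP; rewrite -subr_eq0; apply/eqP/cabs_eq0/eqP; rewrite eq_le cabs_ge0 andbT.
apply/ler_addgt0Pr => e e0; rewrite add0r.
(* The mesh [m^-1] is chosen so that the two functionals together contribute at most [e] on a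
   function of size [m^-1]. *)
pose m : R := (`|C1| + `|C2|) / e + 1.
have m0 : 0 < m by rewrite ltr_wpDl// divr_ge0 ?addr_ge0// ltW.
pose A (j : nat) : set E := [set x | j.+1%:R <= h x * m].
have mA j : measurable (A j).
  rewrite (_ : A j = (fun x => h x * m) @^-1` `[j.+1%:R, +oo[).
    by rewrite -[X in measurable X]setTI; apply: measurable_funM.
  by apply/seteqP; split => x /=; rewrite in_itv/= andbT.
(* [s J] is the step function [truncn (m * h) / m], within [1 / m] of [h]. *)
pose s (J : nat) (x : E) : R[i] := \sum_(j < J) (m^-1)%:C * cindic (A j) x.
have sS J : s J.+1 = fun x => (m^-1)%:C * cindic (A J) x + s J x.
  by apply/funext => x; rewrite /s big_ord_recr /= addrC.
have s0 : s 0%N = fun _ => 0 by apply/funext => x; rewrite /s big_ord0.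
have bs J : bounded_cmeasurable (s J).
  elim: J => [|J IH]; first by rewrite s0; exact: bounded_cmeasurable_cst.
  by rewrite sS; apply: bounded_cmeasurable_lin => //; exact: bounded_cindic.
have L0 L : (forall (a : R[i]) f g, bounded_cmeasurable f -> bounded_cmeasurable g ->
     L (fun x => a * f x + g x) = a * L f + L g) -> L (fun _ : E => 0) = 0.
  move=> Ll; have := Ll (-1) _ _ (bounded_cmeasurable_cst 0) (bounded_cmeasurable_cst 0).
  by rewrite mulr0 addr0 mulN1r addNr.
have Ls J : L1 (s J) = L2 (s J).
  elim: J => [|J IH]; first by rewrite s0 !L0.
  by rewrite sS L1l ?L2l ?IH ?ind//; exact: bounded_cindic.
pose J := Num.truncn (M * m).
have sE x : s J x = ((Num.truncn (h x * m))%:R / m)%:C.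
  rewrite /s -mulr_sumr /cindic -rmorph_sum /= -rmorphM /=; congr (_%:C).
  rewrite mulrC; congr (_ * _); have tJ : (Num.truncn (h x * m) <= J)%N.
    by apply: le_truncn; rewrite ler_pM2r//; have /andP[] := hM x.
  rewrite -[in RHS](minn_idPr tJ) -sum_ord_lt natr_sum; apply: eq_bigr => j _.
  rewrite indicE; congr ((nat_of_bool _)%:R); rewrite truncn_gt_nat.
  by apply/idP/idP; rewrite inE.
have bh : bounded_cmeasurable (fun x => (h x)%:C).
  split; first exact: cmeasurable_real.
  by exists M => x; have /andP[h0 h1] := hM x; rewrite cabs_real ger0_norm.
pose D x := (-1) * s J x + (h x)%:C.
have Dm x : cabs (D x) <= m^-1.
  have /andP[h0 _] := hM x.
  have -> : D x = (h x - (Num.truncn (h x * m))%:R / m)%:C.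
    by rewrite /D sE mulN1r [RHS]rmorphB addrC.
  rewrite cabs_real.
  have hm0 : 0 <= h x * m by rewrite mulr_ge0// ltW.
  have /andP[t1 t2] := truncn_itv hm0; set t := (Num.truncn (h x * m)) in t1 t2 *.
  rewrite -natr1 in t2.
  have -> : h x - t%:R / m = (h x * m - t%:R) / m by field; rewrite gt_eqF.
  rewrite normrM [`|m^-1|]gtr0_norm ?invr_gt0// ler_piMl ?invr_ge0 ?ltW//.
  by rewrite ger0_norm; lra.
have bD : bounded_cmeasurable D by exact: bounded_cmeasurable_lin.
have E1 : L1 (fun x => (h x)%:C) = L1 D + L1 (s J).
  by rewrite L1l// mulN1r addrAC addNr add0r.
have E2 : L2 (fun x => (h x)%:C) = L2 D + L1 (s J).
  by rewrite Ls L2l// mulN1r addrAC addNr add0r.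
rewrite E1 E2 opprD addrACA subrr addr0 (le_trans (cabsD _ _))// cabsN.
apply: (@le_trans _ _ ((`|C1| + `|C2|) * m^-1)).
  rewrite mulrDl; apply: lerD.
    apply: (le_trans (L1b _ _ bD.1 Dm)); rewrite ler_wpM2r ?invr_ge0 ?ler_norm//.
    exact: ltW.
  apply: (le_trans (L2b _ _ bD.1 Dm)); rewrite ler_wpM2r ?invr_ge0 ?ler_norm//.
  exact: ltW.
rewrite ler_pdivrMr// /m mulrDr mulr1 mulrCA divff ?mulr1 ?gt_eqF//.
by rewrite lerDl ltW.
Qed.

Lemma sup_functional_agree L1 L2 f :
  sup_functional L1 -> sup_functional L2 ->
  (forall A, measurable A -> L1 (cindic A) = L2 (cindic A)) ->
  bounded_cmeasurable f -> L1 f = L2 f.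
Proof.
move=> S1 S2 ind [[mr mi] [M hf]].
have real (h : E -> R) : measurable_fun setT h -> (forall x, `|h x| <= M) ->
    L1 (fun x => (h x)%:C) = L2 (fun x => (h x)%:C).
  move=> mh hM.
  (* Shifting by [M] makes the function nonnegative; the constant is removed again through the
     indicator of the whole space. *)
  have h1 : L1 (fun x => (h x + M)%:C) = L2 (fun x => (h x + M)%:C).
    apply: (@sup_functional_agree_real _ _ _ (M + M)) => //.
      exact: measurable_funD.
    by move=> x; have := hM x; rewrite ler_norml; lra.
  have bT : bounded_cmeasurable (cindic setT) by exact: bounded_cindic.
  have bh : bounded_cmeasurable (fun x => (h x + M)%:C).
    split; first by apply: cmeasurable_real; exact: measurable_funD.
    exists (M + M) => x; rewrite cabs_real ger0_norm; have := hM x; rewrite ler_norml; lra.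
  have -> : (fun x => (h x)%:C) = (fun x => (- M)%:C * cindic setT x + (h x + M)%:C).
    apply/funext => x; rewrite /cindic indicT mulr1 -rmorphD /=.
    by congr (_%:C); ring.
  by case: (S1) => -> // _; case: (S2) => -> // _; rewrite h1 ind.
have bc (h : E -> R) : measurable_fun setT h -> (forall x, `|h x| <= M) ->
    bounded_cmeasurable (fun x => (h x)%:C).
  move=> mh hM; split; first exact: cmeasurable_real.
  by exists M => x; rewrite cabs_real.
have hr x : `|complex.Re (f x)| <= M by exact: le_trans (le_cabs_Re _) (hf x).
have him x : `|complex.Im (f x)| <= M by exact: le_trans (le_cabs_Im _) (hf x).
have -> : f = fun x => 'i * (complex.Im (f x))%:C + (complex.Re (f x))%:C.
  by apply/funext => x; rewrite {1}(complexE (f x)) addrC.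
case: (S1) => -> //; [|exact: bc..]; move=> _.
case: (S2) => -> //; [|exact: bc..]; move=> _.
by rewrite (real _ mr hr) (real _ mi him).
Qed.

End LinearExtension.

Section BoundedIntegral.
Context {R : realType} {d : measure_display} {T : measurableType d}.
Variable m : {measure set T -> \bar R}.
Hypothesis m1 : m setT = 1%E.

Lemma cint_bounded (F : T -> R[i]) : bounded_cmeasurable F -> cintegrable m F.
Proof.
by move=> [mF [M hF]]; apply: (cintegrable_bounded _ mF hF); rewrite m1 ltry.
Qed.

Lemma cabs_cint_bounded (F : T -> R[i]) (M : R) : cmeasurable F ->
  (forall x, cabs (F x) <= M) -> cabs (cint m F) <= M.
Proof.
move=> mF hF; rewrite -lee_fin (le_trans (cabs_cint _))//.
  by apply: cint_bounded; split => //; exists M.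
by apply: (le_trans (normL1_le m mF (measurable_cst M) hF)); rewrite /= integral_cst// m1 mule1.
Qed.

Lemma sup_functional_cint {d' : measure_display} {E : measurableType d'}
    (F : (E -> R[i]) -> T -> R[i]) :
  (forall f, bounded_cmeasurable f -> bounded_cmeasurable (F f)) ->
  (forall (a : R[i]) f g, bounded_cmeasurable f -> bounded_cmeasurable g ->
     F (fun x => a * f x + g x) = fun x => a * F f x + F g x) ->
  (exists C : R, forall f (M : R), cmeasurable f -> (forall x, cabs (f x) <= M) ->
     forall x, cabs (F f x) <= C * M) ->
  sup_functional (fun f => cint m (F f)).
Proof.
move=> Fb Fl [C FC]; split.
  move=> a f g bf bg; rewrite Fl// cint_lin//; exact/cint_bounded/Fb.
exists C => f M mf hf; apply: cabs_cint_bounded; last exact: FC.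
by have [] : bounded_cmeasurable (F f) by apply: Fb; split => //; exists M.
Qed.

End BoundedIntegral.

(** * Products of functions along a path of the chain *)

Section MarkovPaths.
Context {R : realType} {d : measure_display} {E : measurableType d}.
Context {dO : measure_display} {Omega : measurableType dO}.
Variables (Q : R.-pker E ~> E) (nu : probability E R) (P : probability Omega R).
Variable X : nat -> Omega -> E.
Hypothesis HX : markov_chain P X Q nu.
Implicit Types (f g : E -> R[i]).

Let mX n : measurable_fun setT (X n). Proof. by case: HX => ? _. Qed.
Let nu1 : (nu : {measure set E -> \bar R}) setT = 1%E. Proof. exact: probability_setT. Qed.
Let P1 : (P : {measure set Omega -> \bar R}) setT = 1%E. Proof. exact: probability_setT. Qed.

Fixpoint path_prod (fs : seq (E -> R[i])) (k : nat) (w : Omega) : R[i] :=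
  if fs is f :: fs' then f (X k w) * path_prod fs' k.+1 w else 1.

(** The nested product [f0 Q(f1 Q(f2 ...))], which is the conditional expectation of [path_prod]
    given the starting point. *)
Fixpoint kernel_prod (fs : seq (E -> R[i])) (x : E) : R[i] :=
  if fs is f :: fs' then f x * kop Q (kernel_prod fs') x else 1.

Fixpoint all_bounded (fs : seq (E -> R[i])) : Prop :=
  if fs is f :: fs' then bounded_cmeasurable f /\ all_bounded fs' else True.

Lemma all_bounded_cat fs gs : all_bounded (fs ++ gs) <-> all_bounded fs /\ all_bounded gs.
Proof.
elim: fs => [|f fs IH] /=; first by split => [|[]].
by rewrite IH; split => [[? []]|[[]]].
Qed.

Lemma bounded_kop f : bounded_cmeasurable f -> bounded_cmeasurable (kop Q f).
Proof.
move=> [mf [M hf]]; split; first exact: cmeasurable_kop.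
by exists M => x; exact: cabs_kop_bounded.
Qed.

Lemma bounded_comp f k : bounded_cmeasurable f -> bounded_cmeasurable (fun w => f (X k w)).
Proof.
move=> [[mr mi] [M hf]]; split; last by exists M => w; exact: hf.
split; [exact: (measurableT_comp mr (mX k))|exact: (measurableT_comp mi (mX k))].
Qed.

Lemma bounded_kernel_prod fs : all_bounded fs -> bounded_cmeasurable (kernel_prod fs).
Proof.
elim: fs => [|f fs IH] /=; first by move=> _; exact: bounded_cmeasurable_cst.
by move=> [bf /IH bfs]; apply: bounded_cmeasurableM => //; exact: bounded_kop.
Qed.

Lemma bounded_path_prod fs k : all_bounded fs -> bounded_cmeasurable (path_prod fs k).
Proof.
elim: fs k => [|f fs IH] k /=; first by move=> _; exact: bounded_cmeasurable_cst.
move=> [bf /(IH k.+1) bfs]; apply: (bounded_cmeasurableM (bounded_comp k bf) bfs).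
Qed.

Lemma kop_lin_bounded (a : R[i]) f g : bounded_cmeasurable f -> bounded_cmeasurable g ->
  kop Q (fun x => a * f x + g x) = fun x => a * kop Q f x + kop Q g x.
Proof.
move=> bf bg; apply/funext => x; rewrite /kop cint_lin//;
  by apply: cint_bounded => //; exact: kernel_total.
Qed.

Section Position.
Variables pre post : seq (E -> R[i]).
Hypotheses (bpre : all_bounded pre) (bpost : all_bounded post).

Lemma sup_functional_kernel_prod :
  sup_functional (fun f => cint nu (kernel_prod (pre ++ f :: post))).
Proof.
have bb ps f : all_bounded ps -> bounded_cmeasurable f -> all_bounded (ps ++ f :: post).
  by move=> bps bf; apply/all_bounded_cat.
apply: (sup_functional_cint nu1 (F := fun f => kernel_prod (pre ++ f :: post))).
- by move=> f bf; apply: bounded_kernel_prod; exact: bb.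
- move=> a f g bf bg; elim: pre bpre => [|f0 fs IH] /=.
    by move=> _; apply/funext => x; ring.
  move=> [b0 bfs]; rewrite IH// kop_lin_bounded; [|exact/bounded_kernel_prod/bb..].
  by apply/funext => x; ring.
- elim: pre bpre => [|f0 fs IH] /=.
    have [mk [C hC]] := bounded_kop (bounded_kernel_prod bpost).
    by move=> _; exists C => f M mf hf x; rewrite cabsM mulrC ler_pM ?cabs_ge0.
  move=> [[m0 [M0 h0]] bfs]; have [C hC] := IH bfs.
  exists (M0 * C) => f M mf hf x; rewrite cabsM -mulrA ler_pM ?cabs_ge0//.
  apply: cabs_kop_bounded; last exact: hC.
  have bf : bounded_cmeasurable f by split => //; exists M.
  by have [] := bounded_kernel_prod (bb _ _ bfs bf).
Qed.

Lemma sup_functional_path_prod :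
  sup_functional (fun f => cint P (path_prod (pre ++ f :: post) 0)).
Proof.
have bb ps f : all_bounded ps -> bounded_cmeasurable f -> all_bounded (ps ++ f :: post).
  by move=> bps bf; apply/all_bounded_cat.
apply: (sup_functional_cint P1 (F := fun f => path_prod (pre ++ f :: post) 0)).
- by move=> f bf; apply: bounded_path_prod; exact: bb.
- move=> a f g bf bg; elim: pre 0%N bpre => [|f0 fs IH] k /=.
    by move=> _; apply/funext => w; ring.
  by move=> [b0 bfs]; rewrite IH//; apply/funext => w; ring.
- elim: pre 0%N bpre => [|f0 fs IH] k /=.
    have [mk [C hC]] := bounded_path_prod k.+1 bpost.
    by move=> _; exists C => f M mf hf w; rewrite cabsM mulrC ler_pM ?cabs_ge0.
  move=> [[m0 [M0 h0]] bfs]; have [C hC] := IH k.+1 bfs.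
  by exists (M0 * C) => f M mf hf w; rewrite cabsM -mulrA ler_pM ?cabs_ge0// hC.
Qed.

End Position.

Lemma path_prod_cindic (As : seq (set E)) k w :
  path_prod [seq cindic A | A <- As] k w =
  cindic [set w | forall j, (j < size As)%N -> nth setT As j (X (k + j) w)] w.
Proof.
elim: As k => [|A As IH] k /=.
  by rewrite /cindic indicE mem_set.
rewrite IH /cindic -rmorphM /=; congr (_%:C); rewrite !indicE -natrM mulnb.
congr ((nat_of_bool _)%:R); apply/andP/idP; rewrite !inE /=.
  move=> [Ak h] [|j] /= js; first by rewrite addn0.
  by rewrite addnS -addSn; exact: h.
move=> h; split; first by have := h 0%N (ltn0Sn _); rewrite addn0.
by move=> j js; have := h j.+1 js; rewrite addnS -addSn.
Qed.

Lemma cint_real {d1 : measure_display} {T : measurableType d1}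
    (m : {measure set T -> \bar R}) (f : T -> R) :
  cint m (fun x => (f x)%:C) = (Rintegral m setT f)%:C.
Proof. by apply: complex_eq; rewrite ?cint_ReE ?cint_ImE//= /Rintegral integral0. Qed.

Lemma cint_cindic_mul (m : {measure set E -> \bar R}) (A : set E) (F : E -> \bar R) :
  (forall x, F x \is a fin_num) ->
  cint m (fun x => cindic A x * (fine (F x))%:C) = (fine (\int[m]_(x in A) F x)%E)%:C.
Proof.
move=> Ffin; under [X in cint m X]eq_fun do rewrite /cindic -rmorphM /=.
rewrite cint_real /Rintegral; congr ((fine _)%:C).
rewrite [RHS]integral_mkcond; apply: eq_integral => x _.
rewrite patchE indicE; case: (x \in A); last by rewrite mul0r.
by rewrite mul1r fineK.
Qed.

Definition all_measurable (As : seq (set E)) : Prop :=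
  forall k, (k < size As)%N -> measurable (nth setT As k).

Lemma all_measurable_cons A As : all_measurable (A :: As) ->
  measurable A /\ all_measurable As.
Proof. by move=> h; split; [exact: (h 0%N)|move=> k ks; exact: (h k.+1)]. Qed.

Lemma fdd_bounds As : all_measurable As ->
  measurable_fun setT (fdd Q As) /\ forall x, (0 <= fdd Q As x <= 1)%E.
Proof.
elim: As => [|A As IH] /=.
  by move=> _; split; [exact: measurable_cst|move=> x; rewrite lee01 lexx].
move=> /all_measurable_cons[mA /IH[mF F01]].
have F0 x : (0 <= fdd Q As x)%E by have /andP[] := F01 x.
have F1 x : (fdd Q As x <= 1)%E by have /andP[] := F01 x.
split.
  under eq_fun do rewrite integral_mkcond.
  apply: measurable_kernel_integral.
    by move=> x; rewrite patchE; case: ifP.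
  by apply/(measurable_restrictT _ mA); exact: measurable_funS mF.
move=> x; apply/andP; split; first exact: integral_ge0.
rewrite (@le_trans _ _ (\int[Q x]_(y in A) (cst 1 y))%E)//.
  by apply: ge0_le_integral => //; exact: measurable_funS mF.
by rewrite integral_cst// mul1e -(kernel_total Q x) le_measure// inE.
Qed.

Lemma fdd_fin As x : all_measurable As -> fdd Q As x \is a fin_num.
Proof.
move=> /fdd_bounds[_ /(_ x)/andP[F0 F1]].
by rewrite ge0_fin_numE// (le_lt_trans F1)// ltry.
Qed.

(** [fdd] integrates against the kernel before testing its first set, so it corresponds to
    [kernel_prod] after one more application of [Q]. *)
Lemma kop_kernel_prod_cindic As x : all_measurable As ->
  kop Q (kernel_prod [seq cindic A | A <- As]) x = (fine (fdd Q As x))%:C.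
Proof.
elim: As x => [|A As IH] x /=.
  move=> _; have -> : (fun _ : E => 1) = (fun _ => (1 : R)%:C) by [].
  by rewrite /kop cint_real /Rintegral integral_cst//= kernel_total mule1.
move=> /all_measurable_cons[mA mAs].
rewrite /kop -cint_cindic_mul; last by move=> y; exact: fdd_fin.
by congr (cint _ _); apply/funext => y; rewrite -IH.
Qed.

Lemma path_kernel_prod_cindic A As : measurable A -> all_measurable As ->
  cint P (path_prod [seq cindic A | A <- A :: As] 0) =
  cint nu (kernel_prod [seq cindic A | A <- A :: As]).
Proof.
move=> mA mAs; have [_ /(_ A As mA mAs) H] := HX.
have -> : kernel_prod [seq cindic A | A <- A :: As] =
    fun x => cindic A x * (fine (fdd Q As x))%:C.
  by apply/funext => x /=; rewrite kop_kernel_prod_cindic.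
rewrite cint_cindic_mul; last by move=> x; exact: fdd_fin.
pose S := [set w | forall j, (j < size (A :: As))%N -> nth setT (A :: As) j (X j w)].
have -> : path_prod [seq cindic A | A <- A :: As] 0 = fun w => (\1_S w)%:C.
  by apply/funext => w; rewrite path_prod_cindic.
have mS : measurable S.
  rewrite (_ : S = \bigcap_(j in [set j | (j < size (A :: As))%N])
      (X j @^-1` nth setT (A :: As) j)).
    apply: bigcap_measurableType => j js; rewrite -[X in measurable X]setTI; apply: mX => //.
    by case: j js => [//|j]; exact: mAs.
  by apply/seteqP; split => w /= h j; exact: h.
rewrite cint_real -H /Rintegral integral_indic// setIT.
congr ((fine (P _))%:C); apply/seteqP; split => w /=.
  by move=> h; split; [exact: (h 0%N)|move=> k; exact: (h k.+1)].
by move=> [h0 h] [//|k]; exact: h.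
Qed.

(** Both sides are linear in each factor. The induction is on the number of general factors in
    front: the last of them is tested on indicators, which moves it into the list of sets, until the
    law of the chain given by [HX] applies. *)
Lemma path_kernel_prod_mixed pre As : all_bounded pre -> all_measurable As ->
  cint P (path_prod (pre ++ [seq cindic A | A <- As]) 0) =
  cint nu (kernel_prod (pre ++ [seq cindic A | A <- As])).
Proof.
elim/last_ind: pre As => [|pre f IH] As /=.
  move=> _; case: As => [|A As]; last by move=> /all_measurable_cons[]; exact: path_kernel_prod_cindic.
  move=> _; have -> : kernel_prod [::] = (fun _ => (1 : R)%:C) by [].
  have -> : path_prod [::] 0 = (fun _ => (1 : R)%:C) by [].
  by rewrite !cint_real /Rintegral !integral_cst//= P1 nu1.
rewrite -cats1 => /all_bounded_cat[bpre [bf _]] mAs; rewrite -catA /=.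
have bAs : all_bounded [seq cindic A | A <- As].
  elim: (As) mAs => //= B Bs IHB /all_measurable_cons[mB mBs].
  by split; [exact: bounded_cindic|exact: IHB].
apply: (sup_functional_agree (sup_functional_path_prod bpre bAs)
          (sup_functional_kernel_prod bpre bAs) _ bf) => A mA.
by apply: (IH (A :: As)) => // -[|k] //; exact: mAs.
Qed.

Lemma path_kernel_prod fs : all_bounded fs ->
  cint P (path_prod fs 0) = cint nu (kernel_prod fs).
Proof. by move=> bfs; have := path_kernel_prod_mixed (As := [::]) bfs; rewrite /= cats0; apply. Qed.

Lemma bounded_cexpi (u : R) (xi : E -> R) : measurable_fun setT xi ->
  bounded_cmeasurable (fun x => cexpi (u * xi x)).
Proof.
move=> mxi; split; last by exists 1 => x; rewrite cabs_cexpi.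
by apply: cmeasurable_cexpi; exact: measurable_funM.
Qed.

Lemma charfun_partial_sum (xi : E -> R) (mxi : measurable_fun setT xi) (u : R) n :
  cint P (fun w => cexpi (u * partial_sum X xi n w)) =
  cint nu (iter n (kopt Q xi u) (fun _ => 1)).
Proof.
pose e x := cexpi (u * xi x).
have be : all_bounded (nseq n e) by elim: n => //= n IH; split => //; exact: bounded_cexpi.
have b1 : bounded_cmeasurable (fun _ : E => (1 : R[i])) by exact: bounded_cmeasurable_cst.
(* The constant factor stands for [X 0], which does not occur in the sum. *)
have := @path_kernel_prod ((fun _ => 1) :: nseq n e) (conj b1 be).
have pE k w : path_prod (nseq n e) k w = cexpi (u * \sum_(k <= j < k + n) xi (X j w)).
  elim: n k {be} => [|n IH] k /=; first by rewrite addn0 big_geq// mulr0 cexpi0.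
  rewrite IH addSnnS [in RHS]big_ltn; last by rewrite addnS ltnS leq_addr.
  by rewrite [in RHS]mulrDr [in RHS]cexpiD.
have kE x : kop Q (kernel_prod (nseq n e)) x = iter n (kopt Q xi u) (fun _ => 1) x.
  elim: n x {be pE} => [|n IH] x /=.
    have -> : (fun _ : E => 1) = (fun _ => (1 : R)%:C) by [].
    by rewrite /kop cint_real /Rintegral integral_cst//= kernel_total mule1.
  by rewrite /kopt -/(kopt Q xi u) /=; congr (cint _ _); apply/funext => y; rewrite IH.
move=> /=; under [in LHS]eq_fun do rewrite mul1r pE.
under [in RHS]eq_fun do rewrite mul1r kE.
by rewrite /partial_sum => <-.
Qed.

Section Stationary.
Hypothesis Hinv : forall A : set E, measurable A -> nu A = (\int[nu]_x Q x A)%E.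

Lemma integral_fdd_stationary n A : measurable A ->
  (\int[nu]_x fdd Q (rcons (nseq n setT) A) x)%E = nu A.
Proof.
move=> mA; have mAs k : all_measurable (rcons (nseq k setT) A).
  move=> j; rewrite size_rcons size_nseq ltnS => jn.
  by rewrite nth_rcons size_nseq nth_nseq; do 2?case: ifP => //.
elim: n => [|n IH].
  by rewrite Hinv//; apply: eq_integral => x _; rewrite /= integral_cst// mul1e.
have [mF F01] := fdd_bounds (mAs n).
by rewrite [LHS](integral_kernel_inv Hinv)// => x; have /andP[] := F01 x.
Qed.

Lemma law_stationary n A : measurable A -> P (X n @^-1` A) = nu A.
Proof.
move=> mA; have [_ H] := HX; case: n => [|n].
  have /= := H A [::] mA; rewrite integral_cst// mul1e => <-//.
  by congr (P _); apply/seteqP; split => w //= [].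
have := H setT (rcons (nseq n setT) A) measurableT.
rewrite integral_fdd_stationary// => <-; last first.
  move=> j; rewrite size_rcons size_nseq ltnS => jn.
  by rewrite nth_rcons size_nseq nth_nseq; do 2?case: ifP => //.
congr (P _); apply/seteqP; split => w /=.
  move=> Aw; split => // k; rewrite size_rcons size_nseq ltnS nth_rcons size_nseq nth_nseq.
  by case: ltngtP => // ->.
move=> [_ /(_ n)]; rewrite size_rcons size_nseq ltnSn nth_rcons size_nseq ltnn eqxx.
by apply.
Qed.

Lemma integrable_stationary (xi : E -> R) n : measurable_fun setT xi ->
  nu.-integrable setT (EFin \o xi) -> P.-integrable setT (EFin \o (xi \o X n)).
Proof.
move=> mxi /integrableP[_ ixi]; apply/integrableP; split.
  by apply/measurable_EFinP; exact: measurableT_comp.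
apply: le_lt_trans ixi.
have mn : measurable_fun setT (fun x => (`|(xi x)%:E|)%E).
  by apply: measurableT_comp => //; exact/measurable_EFinP.
have -> : (\int[nu]_x `|(EFin \o xi) x| = \int[pushforward P (X n)]_x `|(xi x)%:E|)%E.
  by apply: eq_measure_integral => A mA _; exact: (esym (law_stationary n mA)).
by rewrite ge0_integral_pushforward.
Qed.

Lemma measurable_partial_sum (xi : E -> R) n : measurable_fun setT xi ->
  measurable_fun setT (partial_sum X xi n).
Proof.
move=> mxi; apply: measurable_sum => k; exact: measurableT_comp.
Qed.

Lemma integrable_partial_sum (xi : E -> R) n : measurable_fun setT xi ->
  nu.-integrable setT (EFin \o xi) -> P.-integrable setT (EFin \o partial_sum X xi n).
Proof.
move=> mxi ixi.
have -> : EFin \o partial_sum X xi n = (fun w => \sum_(1 <= k < n.+1) (xi (X k w))%:E)%E.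
  by apply/funext => w; rewrite /= sumEFin.
by apply: integrable_sum => // k _; exact: integrable_stationary.
Qed.

End Stationary.

End MarkovPaths.

(** * Rate of convergence and convergence in law *)

Section KolmogorovRate.
Context {R : realType}.
Local Notation mu := (@lebesgue_measure R).

Lemma integral_truncated_constant (K1 K2 cut : R) : 0 <= cut -> 0 <= K1 ->
  mu.-integrable `]0, 1] (EFin \o (fun t => K1 * \1_`]0, cut] t + K2)) /\
  \int[mu]_(t in `]0, 1]) (K1 * \1_`]0, cut] t + K2) <= K1 * cut + K2.
Proof.
move=> cut0 K10.
have m1 : mu (`]0, 1] : set R) = 1%E.
  by rewrite lebesgue_measure_itv /= lte_fin ltr01 -EFinD subr0.
have i1 : mu.-integrable `]0, 1] (fun t => (\1_`]0, cut] t)%:E).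
  apply/integrableP; split; first by apply/measurable_EFinP; exact: measurable_indic.
  under eq_integral do rewrite gee0_abs ?lee_fin//.
  rewrite integral_indic// (@le_lt_trans _ _ (mu (`]0, 1] : set R)))// ?m1 ?ltry//.
  by rewrite -[X in (_ <= X)%E]m1; apply: le_measure; rewrite ?inE//; exact: measurableI.
have ic : mu.-integrable `]0, 1] (fun _ => K2%:E).
  apply/integrableP; split; first exact: measurable_cst.
  by rewrite integral_cst// [X in (_ * X)%E]m1 mule1 ltry.
have iz : mu.-integrable `]0, 1] (fun t => K1%:E * (\1_`]0, cut] t)%:E)%E.
  exact: integrableZl.
split.
  rewrite (_ : _ \o _ = (fun t => K1%:E * (\1_`]0, cut] t)%:E + K2%:E)%E); last first.
    by apply/funext => t; rewrite /= EFinD EFinM.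
  exact: integrableD.
rewrite /Rintegral; under eq_integral do rewrite EFinD EFinM.
rewrite integralD// integralZl// integral_indic// integral_cst// [X in (K2%:E * X)%E]m1.
rewrite mule1.
have le : (mu ((`]0%R, cut]%classic : set R) `&` (`]0%R, 1%R]%classic : set R)) <= cut%:E)%E.
  apply: (@le_trans _ _ (mu (`]0%R, cut]%classic : set R))).
    by apply: le_measure; rewrite ?inE//; exact: measurableI.
  rewrite lebesgue_measure_itv /= lte_fin; case: ifP => _; last by rewrite lee_fin.
  by rewrite -EFinD subr0.
have fin : mu ((`]0, cut]%classic : set R) `&` (`]0, 1]%classic : set R)) \is a fin_num.
  by rewrite ge0_fin_numE ?measure_ge0// (le_lt_trans le)// ltry.
rewrite fineD//; last by rewrite fin_numM.
rewrite lerD2r fineM// ler_wpM2l// -lee_fin fineK//.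
Qed.

(** The exponential dominates the power series term of order [k.+1]; hence a cut-off [y] equal to a
    small power of [n] already makes the Gaussian factor [O(1/n)]. *)
Lemma expR_neg_pow_le (q y : R) (k n : nat) : 0 < q -> 0 <= y -> (0 < n)%N ->
  n%:R <= (y ^+ 2) ^+ k.+1 ->
  expR (- (q * y ^+ 2)) <= (k.+1)`!%:R / q ^+ k.+1 / n%:R.
Proof.
move=> q0 y0 n0 ny.
have z0 : 0 <= q * y ^+ 2 by rewrite mulr_ge0 ?sqr_ge0 ?ltW.
have nR : 0 < n%:R :> R by rewrite ltr0n.
have F0 : 0 < (k.+1)`!%:R :> R by rewrite ltr0n fact_gt0.
have Q0 : 0 < q ^+ k.+1 by rewrite exprn_gt0.
have h : q ^+ k.+1 * n%:R / (k.+1)`!%:R <= expR (q * y ^+ 2).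
  apply: le_trans (expR_ge1Dxn k z0); rewrite exprMn ler_wpDl//.
  by rewrite ler_wpM2r ?invr_ge0 ?ler_wpM2l// ltW.
have -> : (k.+1)`!%:R / q ^+ k.+1 / n%:R = (q ^+ k.+1 * n%:R / (k.+1)`!%:R)^-1.
  by rewrite !invfM invrK mulrC mulrA [LHS]mulrC mulrA.
by rewrite expRN lef_pV2 ?posrE ?expR_gt0// !mulr_gt0 ?invr_gt0.
Qed.

(** [A] comes from the Lipschitz term, [B] from frequencies below the cut-off and [D] from those
    above. The dominant contribution is [B * q * y ^+ 3 / rt]. *)
Lemma rate_arith (A B D q y rt : R) : 0 <= A -> 0 <= B -> 0 <= D -> 0 <= q ->
  1 <= y -> 0 < rt ->
  A / rt + (B * (1 + q * y ^+ 2) * (y / rt) + D / (rt * rt) / (y / rt)) <=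
  (A + B * (1 + q) + D) * (y ^+ 3 / rt).
Proof.
move=> A0 B0 D0 q0 y1 rt0.
have y0 : 0 < y by lra.
have y31 : 1 <= y ^+ 3 by exact: exprn_ege1.
have y21 : 1 <= y ^+ 2 by exact: exprn_ege1.
have iy1 : y^-1 <= 1 by rewrite invf_le1.
have -> : A / rt + (B * (1 + q * y ^+ 2) * (y / rt) + D / (rt * rt) / (y / rt)) =
    (A + (B * (y + q * y ^+ 3) + D * y^-1)) / rt by field; rewrite !gt_eqF.
rewrite [leRHS]mulrA ler_wpM2r//; first by rewrite invr_ge0 ltW.
have h1 : A <= A * y ^+ 3 by rewrite ler_peMr.
have h2 : B * (y + q * y ^+ 3) <= B * (1 + q) * y ^+ 3.
  rewrite -mulrA ler_wpM2l// mulrDl mul1r lerD2r.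
  by rewrite exprS ler_peMr// ltW.
have h3 : D * y^-1 <= D * y ^+ 3 by rewrite ler_wpM2l// (le_trans iy1).
rewrite [leRHS]mulrDl [(A + _) * _]mulrDl -[leRHS]addrA.
exact: lerD h1 (lerD h2 h3).
Qed.

Variables (d : measure_display) (Omega : measurableType d) (P : probability Omega R).
Variables (S : nat -> Omega -> R) (a : nat -> R -> R[i]).
Hypotheses (mS : forall n, measurable_fun setT (S n))
  (iS : forall n, P.-integrable setT (EFin \o S n))
  (Sa : forall n u, cint P (fun w => cexpi (u * S n w)) = a n u).
Variables (sigma2 C u1 c K : R).
Hypotheses (sigma0 : 0 < sigma2) (C0 : 0 <= C) (u10 : 0 < u1) (c0 : 0 < c) (K0 : 0 <= K).
Hypothesis small_u : forall u n, `|u| <= u1 ->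
  cabs (a n u - (expR (- (n%:R * (u ^+ 2 / 2 * sigma2))))%:C) <= C * (`|u| + n%:R * `|u| ^+ 3).
Hypothesis decay : forall u n, `|u| <= u1 -> cabs (a n u) <= K * expR (- (c * (n%:R * u ^+ 2))).

(** A decay rate common to the characteristic function and to the Gaussian, at frequency
    [u1 * t]. *)
Let q := Num.min c (sigma2 / 2) * u1 ^+ 2.

Let q0 : 0 < q.
Proof.
by rewrite mulr_gt0 ?exprn_gt0// lt_min c0 /= divr_gt0.
Qed.

(* The cut-off frequency is [u1 * y / sqrt n]. *)
Lemma charfun_gap (n : nat) (y rt t : R) : 0 < rt -> rt * rt = n%:R -> 1 <= y ->
  0 < t <= 1 ->
  cabs (a n (u1 * t) - (expR (- (n%:R * ((u1 * t) ^+ 2 / 2 * sigma2))))%:C) <=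
  t * (C * u1 * (1 + u1 ^+ 2 * y ^+ 2) * \1_`]0, y / rt] t
       + (K + 1) * expR (- (q * y ^+ 2)) / (y / rt)).
Proof.
move=> rt0 rtE y1 /andP[t0 t1].
have y0 : 0 < y by rewrite (lt_le_trans ltr01).
have cut0 : 0 < y / rt by rewrite divr_gt0.
have ut0 : 0 < u1 * t by rewrite mulr_gt0.
have utu : `|u1 * t| <= u1 by rewrite gtr0_norm// ger_pMr.
have K2 : 0 <= (K + 1) * expR (- (q * y ^+ 2)) by rewrite mulr_ge0 ?expR_ge0// addr_ge0.
have qE : q * y ^+ 2 <= n%:R * (u1 * t) ^+ 2 * Num.min c (sigma2 / 2) \/ t <= y / rt.
  have [|tc] := leP t (y / rt); [by right|left].
  have yt : y <= rt * t by rewrite mulrC -ler_pdivrMr// ltW.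
  rewrite -rtE /q.
  have -> : rt * rt * (u1 * t) ^+ 2 * Num.min c (sigma2 / 2) =
    Num.min c (sigma2 / 2) * u1 ^+ 2 * (rt * t) ^+ 2 by ring.
  by rewrite ler_pM2l// ler_pXn2r// nnegrE ltW// mulr_gt0.
have B0 : 0 <= C * u1 * (1 + u1 ^+ 2 * y ^+ 2).
  by rewrite !mulr_ge0 ?addr_ge0 ?mulr_ge0 ?sqr_ge0// ltW.
have [tc|tc] := leP t (y / rt).
  rewrite indicE mem_set; last by rewrite /= in_itv /= t0.
  apply: (le_trans (small_u n utu)); rewrite gtr0_norm// mulr1.
  rewrite [leRHS]mulrDr; apply: (@le_trans _ _ (t * (C * u1 * (1 + u1 ^+ 2 * y ^+ 2)))); last first.
    by rewrite lerDl mulr_ge0 ?divr_ge0// ltW.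
  have tr : rt * t <= y by rewrite mulrC -ler_pdivlMr.
  have tr2 : (rt * t) ^+ 2 <= y ^+ 2 by rewrite ler_pXn2r// nnegrE ltW// mulr_gt0.
  have -> : u1 * t + n%:R * (u1 * t) ^+ 3 = u1 * t * (1 + u1 ^+ 2 * (rt * t) ^+ 2).
    by rewrite -rtE; ring.
  have -> : t * (C * u1 * (1 + u1 ^+ 2 * y ^+ 2)) = C * (u1 * t * (1 + u1 ^+ 2 * y ^+ 2)).
    by ring.
  by rewrite !(ler_wpM2l, lerD2l)// ?mulr_ge0 ?sqr_ge0// ltW.
rewrite indicE memNset; last by rewrite /= in_itv /= t0 /= leNgt tc.
rewrite mulr0 add0r.
have {}qE : q * y ^+ 2 <= n%:R * (u1 * t) ^+ 2 * Num.min c (sigma2 / 2).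
  by case: qE => // /(lt_le_trans tc); rewrite ltxx.
have nu0 : 0 <= n%:R * (u1 * t) ^+ 2 by rewrite mulr_ge0 ?sqr_ge0.
apply: (@le_trans _ _ ((K + 1) * expR (- (q * y ^+ 2)))); last first.
  by move: K2; set Z := _ * _ => K2; rewrite mulrCA ler_peMr// ler_pdivlMr// mul1r ltW.
rewrite (le_trans (cabsD _ _))// cabsN mulrDl mul1r lerD//.
  apply: (le_trans (decay n utu)); rewrite ler_wpM2l// ler_expR lerN2.
  by rewrite (le_trans qE)// mulrC ler_wpM2r// ge_min lexx.
rewrite cabs_real ger0_norm ?expR_ge0// ler_expR lerN2 (le_trans qE)//.
have -> : n%:R * ((u1 * t) ^+ 2 / 2 * sigma2) = n%:R * (u1 * t) ^+ 2 * (sigma2 / 2) by ring.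
by rewrite ler_wpM2l// ge_min lexx orbT.
Qed.

Lemma kolmogorov_rate_aux (s : R) (k : nat) : 0 < s -> exists M : R, 0 <= M /\
  forall (n : nat) (y x : R), (0 < n)%N -> 1 <= y -> n%:R <= (y ^+ 2) ^+ k.+1 ->
  `|rv_cdf P (S n) (Num.sqrt sigma2 * Num.sqrt n%:R * x) -
    fine (normal_prob 0 s [set z | z <= s * x])| <= M * (y ^+ 3 / Num.sqrt n%:R).
Proof.
move=> s0; have [Ce [Ce0 He]] := esseen (R := R).
pose sg := Num.sqrt sigma2.
have sg0 : 0 < sg by rewrite sqrtr_gt0.
have sg2 : sg ^+ 2 = sigma2 by rewrite sqr_sqrtr// ltW.
pose A := normal_peak s * s / (u1 * sg).
pose B := C * u1.
pose D := (K + 1) * ((k.+1)`!%:R / q ^+ k.+1).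
have A0 : 0 <= A by rewrite !mulr_ge0 ?invr_ge0 ?mulr_ge0 ?normal_peak_ge0// ltW.
have B0 : 0 <= B by rewrite mulr_ge0// ltW.
have D0 : 0 <= D by rewrite !mulr_ge0 ?invr_ge0 ?exprn_ge0 ?addr_ge0// ltW.
exists (Ce * (A + B * (1 + u1 ^+ 2) + D)); split.
  by rewrite mulr_ge0// !addr_ge0// mulr_ge0// addr_ge0 ?sqr_ge0.
move=> n y x n0 y1 ny; set rt := Num.sqrt n%:R.
have rt0 : 0 < rt by rewrite sqrtr_gt0 ltr0n.
have rtE : rt * rt = n%:R by rewrite -expr2 sqr_sqrtr.
have y0 : 0 < y by rewrite (lt_le_trans ltr01).
(* [c2] gives the normal variable [c2 * z] the variance [u1 ^+ 2 * sigma2 * n] of the Gaussian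
   approximation of [u1 * S n]. Keeping [s] free covers both the limit [N(0, sigma2)] and the
   standard normal law. *)
pose c2 := u1 * sg * rt / s.
have c20 : 0 < c2 by rewrite divr_gt0 ?mulr_gt0.
(* The division by [y / rt] turns the bound above the cut-off into one for the gap divided by
   [t]. *)
pose K2 := (K + 1) * expR (- (q * y ^+ 2)) / (y / rt).
pose K1 := B * (1 + u1 ^+ 2 * y ^+ 2).
have K10 : 0 <= K1 by rewrite mulr_ge0// addr_ge0// mulr_ge0// sqr_ge0.
have cut0 : 0 <= y / rt by rewrite divr_ge0// ltW.
have K20 : 0 <= K2 by rewrite divr_ge0// mulr_ge0 ?expR_ge0// addr_ge0.
have [ik Ik] := integral_truncated_constant K2 cut0 K10.
have mY1 : measurable_fun setT (fun w => u1 * S n w) by exact: measurable_funM.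
have cE t : n%:R * ((u1 * t) ^+ 2 / 2 * sigma2) = s ^+ 2 * (t * c2) ^+ 2 / 2.
  by rewrite /c2 -sg2 -rtE; field; rewrite gt_eqF.
have gap t : 0 < t <= 1 -> cabs (a n (u1 * t) - (expR (- (s ^+ 2 * (t * c2) ^+ 2 / 2)))%:C) <=
    t * (K1 * \1_`]0, y / rt] t + K2).
  by move=> t01; rewrite -cE; exact: charfun_gap.
have ReE t : ecos P (fun w => u1 * S n w) t = complex.Re (a n (u1 * t)).
  rewrite -Sa cint_ReE; apply: eq_Rintegral => w _.
  by rewrite Re_cexpi mulrCA mulrA.
have ImE t : esin P (fun w => u1 * S n w) t = complex.Im (a n (u1 * t)).
  rewrite -Sa cint_ImE; apply: eq_Rintegral => w _.
  by rewrite Im_cexpi mulrCA mulrA.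
have h := He _ _ _ _ P (normal_prob 0 s) (fun w => u1 * S n w) (fun z => c2 * z)
  (normal_peak s / c2) (K1 * (y / rt) + K2) (fun t => K1 * \1_`]0, y / rt] t + K2).
have mY2 : measurable_fun setT (fun z : measurableTypeR R => c2 * z).
  exact: normal_variable_measurable.
have {h} := h mY1 mY2.
have iY1 : P.-integrable setT (EFin \o (fun w => u1 * S n w)).
  rewrite (_ : _ \o _ = (fun w => u1%:E * (EFin \o S n) w)%E); last first.
    by apply/funext => w; rewrite /= EFinM.
  exact: integrableZl.
move=> /(_ iY1 (integrable_normal_id (lt0r_neq0 s0) c2)).
have m0 : 0 <= normal_peak s / c2 by rewrite divr_ge0 ?normal_peak_ge0// ltW.
have KK : 0 <= K1 * (y / rt) + K2 by rewrite addr_ge0// mulr_ge0.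
move=> /(_ m0 KK (fun x y => @normal_cdf_lipschitz _ _ _ s0 c20 x y) ik Ik).
have hc t : 0 < t <= 1 -> `|ecos P (fun w => u1 * S n w) t -
    ecos (normal_prob 0 s) (fun z => c2 * z) t| <= t * (K1 * \1_`]0, y / rt] t + K2).
  move=> t01; apply: le_trans (gap t t01); rewrite ReE normal_ecos//.
  by apply: le_trans (le_cabs_Re _); rewrite ReD ReN.
have hs t : 0 < t <= 1 -> `|esin P (fun w => u1 * S n w) t -
    esin (normal_prob 0 s) (fun z => c2 * z) t| <= t * (K1 * \1_`]0, y / rt] t + K2).
  move=> t01; apply: le_trans (gap t t01); rewrite ImE normal_esin//.
  by apply: le_trans (le_cabs_Im _); rewrite ImD ImN.
move=> /(_ hc hs (u1 * (sg * rt * x))).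
have -> : rv_cdf P (fun w => u1 * S n w) (u1 * (sg * rt * x)) = rv_cdf P (S n) (sg * rt * x).
  congr (fine (P _)); apply/seteqP; split => w /=; by rewrite ler_pM2l.
have -> : rv_cdf (normal_prob 0 s) (fun z => c2 * z) (u1 * (sg * rt * x)) =
    fine (normal_prob 0 s [set z | z <= s * x]).
  have e : u1 * (sg * rt * x) = c2 * (s * x) by rewrite /c2; field; rewrite gt_eqF.
  by congr (fine (normal_prob 0 s _)); apply/seteqP; split => z /=; rewrite e ler_pM2l.
move=> /le_trans; apply; rewrite -[leRHS]mulrA ler_wpM2l//.
have hK2 : K2 <= D / (rt * rt) / (y / rt).
  rewrite /K2 ler_wpM2r ?invr_ge0// /D rtE -mulrA ler_wpM2l ?addr_ge0//.
  by apply: expR_neg_pow_le => //; exact: ltW.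
have -> : normal_peak s / c2 = A / rt.
  by rewrite /A /c2; field; rewrite !gt_eqF.
apply: le_trans (rate_arith A0 B0 D0 (sqr_ge0 u1) y1 rt0).
by rewrite lerD2l lerD2l.
Qed.

Lemma kolmogorov_rate (s tau : R) : 0 < s -> tau < 1 -> exists M : R, 0 <= M /\
  forall (n : nat) (x : R), (0 < n)%N ->
  `|rv_cdf P (S n) (Num.sqrt sigma2 * Num.sqrt n%:R * x) -
    fine (normal_prob 0 s [set z | z <= s * x])| <= M * n%:R `^ (- (tau / 2)).
Proof.
move=> s0 tau1; pose tau' := Num.max tau 0.
have tau'1 : tau' < 1 by rewrite gt_max tau1 ltr01.
(* With [y = n^e], the rate [y^3 / sqrt n] is [n^(3 e - 1/2) = n^(- tau' / 2)]. Then [k] is large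
   enough for [n <= y^(2 (k + 1))]. *)
pose e : R := (1 - tau') / 6.
have e0 : 0 < e by rewrite divr_gt0// subr_gt0.
pose k := Num.truncn (e * 2)^-1.
have ek : 1 <= e * 2 * k.+1%:R.
  have i0 : 0 <= (e * 2)^-1 by rewrite invr_ge0 mulr_ge0// ltW.
  have /andP[_ h] := truncn_itv i0.
  by rewrite -ler_pdivrMl ?mulr1 ?ltW// mulr_gt0.
have [M [M0 hM]] := kolmogorov_rate_aux k s0.
exists M; split => // n x n0; have n1 : 1 <= n%:R :> R by rewrite ler1n.
apply: (le_trans (hM n (n%:R `^ e) x n0 _ _)).
- by rewrite -[leLHS](powRr0 n%:R); apply: ler_powR => //; exact: ltW.
- rewrite -!powR_mulrn ?powR_ge0// -!powRrM -[leLHS]powRr1//.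
  by apply: ler_powR => //; rewrite mulrA.
rewrite ler_wpM2l// -powR12_sqrt// -powR_mulrn ?powR_ge0// -powRrM -powRN -powRD; last first.
  by apply/implyP => _; rewrite gt_eqF// (lt_le_trans ltr01).
apply: ler_powR => //.
have h : tau <= tau' by rewrite le_max lexx.
by rewrite /e; lra.
Qed.

End KolmogorovRate.

(** * From distribution functions to convergence in law *)

Section StepApproximation.
Context {R : realType} {d : measure_display} {Omega : measurableType d}.
Variables (P : probability Omega R) (Y : Omega -> R).
Hypothesis mY : measurable_fun setT Y.

Let below (x : R) : Omega -> R := \1_[set w | Y w <= x].

Let integrable_bounded (f : Omega -> R) (M : R) : measurable_fun setT f ->
  (forall w, `|f w| <= M) -> P.-integrable setT (EFin \o f).
Proof.
move=> mf fM; apply/integrableP; split; first exact/measurable_EFinP.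
apply: (@le_lt_trans _ _ (\int[P]_w (cst M%:E w))%E).
  by apply: ge0_le_integral => //; 
    [do 2?apply: measurableT_comp => //; exact/measurable_EFinP|move=> w _; rewrite lee_fin].
by rewrite integral_cst// [X in (_ * X)%E](probability_setT P) mule1 ltry.
Qed.

Let measurable_below x : measurable_fun setT (below x).
Proof. by apply: measurable_indic; exact: measurable_le_set. Qed.

Let belowE x w : below x w = (Y w <= x)%R%:R.
Proof.
rewrite /below indicE; case: (boolP (Y w <= x)) => h; first by rewrite mem_set.
by rewrite memNset//=; apply/negP.
Qed.

Let below_bounded x w : `|below x w| <= 1.
Proof. by rewrite belowE; case: (Y w <= x); rewrite ?normr1 ?normr0. Qed.

Let below_mono x y w : x <= y -> below x w <= below y w.
Proof.
move=> xy; rewrite !belowE ler_nat; case: (boolP (Y w <= x)) => //= h.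
by rewrite (le_trans h xy).
Qed.

Let integral_below x : \int[P]_w below x w = rv_cdf P Y x.
Proof.
rewrite /Rintegral integral_indic//; last exact: measurable_le_set.
by rewrite setIT.
Qed.

Lemma step_approximation (h : R -> R) (M eps : R) (x : nat -> R) (J : nat) :
  continuous h -> (forall y, `|h y| <= M) -> 0 <= eps -> (forall j, x j <= x j.+1) ->
  (forall j y, (j < J)%N -> x j < y <= x j.+1 -> `|h y - h (x j)| <= eps) ->
  `|\int[P]_w h (Y w) - \sum_(j < J) h (x j) * (rv_cdf P Y (x j.+1) - rv_cdf P Y (x j))|
  <= eps + M * (1 - (rv_cdf P Y (x J) - rv_cdf P Y (x 0%N))).
Proof.
move=> ch hM e0 x_mono osc.
have M0 : 0 <= M by exact: le_trans (hM 0).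
pose G (n : nat) w := \sum_(j < n) h (x j) * (below (x j.+1) w - below (x j) w).
have GS n : G n.+1 = fun w => G n w + h (x n) * (below (x n.+1) w - below (x n) w).
  by apply/funext => w; rewrite /G big_ord_recr.
have ib y : P.-integrable setT (fun w => (below y w)%:E).
  exact: (integrable_bounded (measurable_below y) (below_bounded y)).
have ibb y z : P.-integrable setT (fun w => (below y w - below z w)%:E).
  exact: fin_integrableB.
have iG n : P.-integrable setT (fun w => (G n w)%:E) /\
    \int[P]_w G n w = \sum_(j < n) h (x j) * (rv_cdf P Y (x j.+1) - rv_cdf P Y (x j)).
  elim: n => [|n [iGn IH]].
    have -> : G 0%N = fun _ => 0 by apply/funext => w; rewrite /G big_ord0.
    by rewrite big_ord0 /Rintegral integral0; split => //; exact: (fin_integrable_cst (probability_setT P)).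
  have iz : P.-integrable setT (fun w => (h (x n) * (below (x n.+1) w - below (x n) w))%:E).
    exact: fin_integrableZ.
  rewrite GS; split; first exact: fin_integrableD.
  by rewrite fin_RintegralD// IH fin_RintegralZ// fin_RintegralB// !integral_below big_ord_recr.
have mh : measurable_fun setT (fun w => h (Y w)).
  by apply: measurableT_comp mY; exact: continuous_measurable_fun.
have ih : P.-integrable setT (fun w => (h (Y w))%:E).
  exact: (integrable_bounded mh (fun w => hM (Y w))).
have [iGJ <-] := iG J.
rewrite -fin_RintegralB//; apply: (le_trans (le_normr_Rintegral measurableT _)).
  exact: fin_integrableB.
pose U w := eps + M * (1 - (below (x J) w - below (x 0%N) w)).
have iU1 : P.-integrable setT (fun w => (1 - (below (x J) w - below (x 0%N) w))%:E).
  by apply: fin_integrableB => //; exact: (fin_integrable_cst (probability_setT P)).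
have iU2 : P.-integrable setT (fun w => (M * (1 - (below (x J) w - below (x 0%N) w)))%:E).
  exact: fin_integrableZ.
have iU : P.-integrable setT (fun w => (U w)%:E).
  by apply: fin_integrableD => //; exact: (fin_integrable_cst (probability_setT P)).
have UE : \int[P]_w U w = eps + M * (1 - (rv_cdf P Y (x J) - rv_cdf P Y (x 0%N))).
  rewrite fin_RintegralD//; last exact: (fin_integrable_cst (probability_setT P)).
  rewrite fin_RintegralZ// fin_RintegralB//; last exact: (fin_integrable_cst (probability_setT P)).
  rewrite fin_RintegralB// !integral_below !Rintegral_cst//.
  by rewrite ![X in fine X](probability_setT P) /= !mulr1.
rewrite -UE; apply: le_Rintegral => //.
  have iB : P.-integrable setT (fun w => (h (Y w) - G J w)%:E) by exact: fin_integrableB.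
  exact: (integrable_norm iB).
move=> w _; have tele : below (x J) w - below (x 0%N) w =
    \sum_(j < J) (below (x j.+1) w - below (x j) w).
  by rewrite -(big_mkord xpredT (fun j => below (x j.+1) w - below (x j) w)) telescope_sumr.
(* The increments of the indicators sum to 1 inside []x 0, x J]] and to 0 outside: the first term is
   the tail, bounded by [M], and the second the oscillation on a single cell. *)
have hG : h (Y w) - G J w = h (Y w) * (1 - (below (x J) w - below (x 0%N) w)) +
    \sum_(j < J) (h (Y w) - h (x j)) * (below (x j.+1) w - below (x j) w).
  under [in RHS]eq_bigr do rewrite mulrBl.
  by rewrite sumrB -mulr_sumr -tele /G; ring.
have inc01 a b : a <= b -> 0 <= below b w - below a w <= 1.
  move=> ab; rewrite subr_ge0 below_mono//= lerBlDr (le_trans (ler_norm _))//.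
  by rewrite (le_trans (below_bounded _ _))// lerDl belowE.
have x0J : x 0%N <= x J.
  by elim: (J) => // n IH; exact: le_trans IH (x_mono n).
have /andP[I0 I1] := inc01 _ _ x0J.
rewrite hG (le_trans (ler_normD _ _))// addrC lerD//; last first.
  by rewrite normrM ler_pM// ger0_norm ?subr_ge0.
apply: (le_trans (ler_norm_sum _ _ _)).
apply: (@le_trans _ _ (\sum_(j < J) eps * (below (x j.+1) w - below (x j) w))); last first.
  by rewrite -mulr_sumr -tele ler_piMr.
apply: ler_sum => j _; have /andP[j0 _] := inc01 _ _ (x_mono j).
rewrite normrM [`|below _ _ - _|]ger0_norm//.
have [h1|h1] := leP (Y w) (x j).
  by rewrite !belowE h1 (le_trans h1 (x_mono j)) subrr !mulr0.
have [h2|h2] := leP (Y w) (x j.+1); last first.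
  by rewrite !belowE (lt_geF h1) (lt_geF h2) subrr !mulr0.
by rewrite ler_wpM2r// osc// h1 h2.
Qed.

Lemma cdf_tight (eps : R) : 0 < eps -> exists A : R, 0 < A /\
  1 - (rv_cdf P Y A - rv_cdf P Y (- A)) <= eps.
Proof.
move=> e0; pose X : {RV P >-> R} := HB.pack Y (isMeasurableFun.Build _ _ _ _ Y mY).
have XE r : fine (cdf X r) = rv_cdf P Y r.
  by congr (fine (P _)); apply/seteqP; split => w /=; rewrite in_itv.
have e20 : 0 < eps / 2 by rewrite divr_gt0.
have /fine_cvg/cvgrPdist_lt/(_ _ e20)[M1 [_ h1]] := cvg_cdfy1 X.
have /fine_cvg/cvgrPdist_lt/(_ _ e20)[M2 [_ h2]] := cvg_cdfNy0 X.
pose A := 1 + (`|M1| + `|M2|).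
have A1 : M1 < A by rewrite /A; have := ler_norm M1; have := normr_ge0 M2; lra.
have A2 : - A < M2 by rewrite /A; have := ler_norm (- M2); rewrite normrN; have := normr_ge0 M1; lra.
exists A; split; first by rewrite /A; have := normr_ge0 M1; have := normr_ge0 M2; lra.
have := h1 _ A1; have := h2 _ A2; rewrite /= !XE sub0r normrN => k2 k1.
have := ler_norm (rv_cdf P Y (- A)); have := ler_norm (1 - rv_cdf P Y A); lra.
Qed.

End StepApproximation.

(** Uniform continuity from compactness of the segment; only [x] is confined to it. *)
Lemma heine_segment {R : realType} (h : R -> R) (A eps : R) : continuous h -> 0 < eps ->
  exists2 dl : R, 0 < dl & forall x y, - A <= x <= A -> `|y - x| <= dl -> `|h y - h x| <= eps.
Proof.
move=> ch e0; have /compact_near_coveringP cA := @segment_compact R (- A) A.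
have e20 : 0 < eps / 2 by rewrite divr_gt0.
have := cA R (0^'+) (fun dl x => forall y, `|y - x| <= dl -> `|h y - h x| <= eps) _.
have cover x : `[- A, A]%classic x -> \forall x' \near x & dl \near 0^'+,
    forall y, `|y - x'| <= dl -> `|h y - h x'| <= eps.
  move=> _; have /cvgrPdist_le/(_ _ e20)/nbhs_ballP[r /= r0 hr] := ch x.
  exists (ball x (r / 2), [set dl | dl < r / 2]) => /=.
    split; first by apply: nbhsx_ballx; rewrite divr_gt0.
    by apply: nbhs_right_lt; rewrite divr_gt0.
  move=> [x' dl] /= [xx' dlr] y yx'.
  have b1 : ball x r x' by apply: (le_ball _ xx'); lra.
  have b2 : ball x r y.
    rewrite /ball /= in xx' *; have := ler_distD x' x y; rewrite (distrC x' y); lra.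
  have := hr _ b1; have := hr _ b2 => k2 k1.
  have := ler_distD (h x) (h y) (h x'); rewrite (distrC (h y) (h x)); lra.
move=> /(_ _ cover) [r /= r0 hr].
exists (r / 2); first by rewrite divr_gt0.
move=> x y xA; apply: (hr (r / 2)); rewrite ?divr_gt0//=.
  by rewrite /ball_ /= sub0r normrN gtr0_norm ?divr_gt0// ltr_pdivrMr// ltr_pMr// ltr1n.
Qed.

Lemma conv_in_law_cdf {R : realType} {d : measure_display} {Omega : measurableType d}
    (P : probability Omega R) (Y : nat -> Omega -> R)
    (mu : probability (measurableTypeR R) R) :
  (forall n, measurable_fun setT (Y n)) ->
  (forall eps : R, 0 < eps -> exists N, forall n x, (N <= n)%N ->
     `|rv_cdf P (Y n) x - fine (mu [set z | z <= x])| <= eps) ->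
  conv_in_law P Y mu.
Proof.
move=> mY hF h ch [M0 hM0].
have [M M1 hM] : exists2 M, 0 < M & forall x, `|h x| <= M.
  exists (`|M0| + 1); first by rewrite ltr_wpDl.
  by move=> x; rewrite (le_trans (hM0 x))// (le_trans (ler_norm _))// lerDl.
apply/cvgrPdist_le => eps eps0.
have mid : measurable_fun setT (id : measurableTypeR R -> R) by exact: measurable_id.
pose F x := rv_cdf mu id x.
pose e := eps / 4.
have e0 : 0 < e by rewrite divr_gt0.
have eM0 : 0 < e / (2 * M) by rewrite divr_gt0// mulr_gt0.
have [A [A0 tA]] := cdf_tight mu mid eM0.
have [dl dl0 osc] := heine_segment A ch e0.
pose J := (Num.truncn (2 * A / dl)).+1.
have J0 : 0 < J%:R :> R by rewrite ltr0n.
have Jdl : 2 * A / J%:R <= dl.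
  have v0 : 0 <= 2 * A / dl by rewrite divr_ge0 ?mulr_ge0// ltW.
  have /andP[_ vJ] := truncn_itv v0.
  by rewrite ler_pdivrMr// [dl * _]mulrC -ler_pdivrMr// ltW.
pose r := 2 * A / J%:R.
have r0 : 0 < r by rewrite divr_gt0 ?mulr_gt0.
pose x (j : nat) : R := - A + j%:R * r.
have x_mono j : x j <= x j.+1.
  by rewrite /x -natr1 mulrDl mul1r addrA lerDl ltW.
have x0 : x 0%N = - A by rewrite /x mul0r addr0.
have xJ : x J = A by rewrite /x /r mulrC divfK ?gt_eqF//; ring.
have oscx j y : (j < J)%N -> x j < y <= x j.+1 -> `|h y - h (x j)| <= e.
  move=> jJ /andP[y1 y2]; apply: osc.
    have xle i k : (i <= k)%N -> x i <= x k.
      by move=> ik; rewrite /x lerD2l ler_wpM2r ?ler_nat// ltW.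
    by rewrite -[in X in X && _]x0 -xJ !xle// ltnW.
  have yx : 0 <= y - x j by rewrite subr_ge0 ltW.
  rewrite ger0_norm// (le_trans _ Jdl)// lerBlDl (le_trans y2)//.
  by rewrite /x -natr1 mulrDl mul1r addrA.
(* Each of the [J] cells and the tail pays at most [2 * M] times this precision, for a total of [e].
   The two oscillations and the two tails of size [e / 2] add [3 * e]. *)
have theta0 : 0 < e / (2 * M * (J%:R + 1)).
  by rewrite divr_gt0// !mulr_gt0// addr_gt0.
have [N hN] := hF _ theta0; exists N => // n /= Nn.
have s1 := step_approximation P (mY n) ch hM (ltW e0) x_mono oscx.
have s2 := step_approximation mu mid ch hM (ltW e0) x_mono oscx.
set S1 := \sum_(j < J) _ in s1; set S2 := \sum_(j < J) _ in s2.
rewrite x0 xJ in s1 s2; set th := e / _ in theta0 hN.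
have FnF y : `|rv_cdf P (Y n) y - F y| <= th by exact: hN.
have S12 : `|S1 - S2| <= J%:R * (M * (2 * th)).
  rewrite /S1 /S2 -sumrB (le_trans (ler_norm_sum _ _ _))//.
  rewrite -[X in X%:R * _](card_ord J) mulr_natl -sumr_const ler_sum// => j _.
  rewrite -mulrBr normrM ler_pM//.
  have := FnF (x j.+1); have := FnF (x j); rewrite !ler_norml.
  move=> /andP[a1 a2] /andP[b1 b2]; apply/andP; rewrite -!/(F _); split; lra.
have thE : (J%:R + 1) * (M * (2 * th)) = e.
  by rewrite /th; field; rewrite !gt_eqF// addr_gt0.
have tE : M * (e / (2 * M)) = e / 2 by field; rewrite gt_eqF.
have t2 : M * (1 - (F A - F (- A))) <= e / 2 by rewrite -tE ler_wpM2l// ltW.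
have t1 : M * (1 - (rv_cdf P (Y n) A - rv_cdf P (Y n) (- A))) <= e / 2 + M * (2 * th).
  apply: (@le_trans _ _ (M * (1 - (F A - F (- A)) + 2 * th))); last by rewrite mulrDr lerD2r.
  apply: ler_wpM2l; first exact: ltW.
  have := FnF A; have := FnF (- A); rewrite !ler_norml.
  move=> /andP[a1 a2] /andP[b1 b2]; lra.
have {}s1 := le_trans s1 (lerD (lexx e) t1).
have {}s2 := le_trans s2 (lerD (lexx e) t2).
apply: (le_trans (ler_distD S2 _ _)).
have eE : eps = (e + e / 2) + (J%:R * (M * (2 * th)) + (e + (e / 2 + M * (2 * th)))).
  have -> : (e + e / 2) + (J%:R * (M * (2 * th)) + (e + (e / 2 + M * (2 * th)))) =
     3 * e + (J%:R + 1) * (M * (2 * th)) by field.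
  by rewrite thE /e; field.
rewrite [leRHS]eE lerD//.
apply: (le_trans (ler_distD S1 _ _)); rewrite lerD//; first by rewrite distrC.
by rewrite distrC.
Qed.

(** * Consequences of the hypotheses *)

Section PoissonEquation.
Context {R : realType} {d : measure_display} {E : measurableType d}.
Variables (Q : R.-pker E ~> E) (nu : probability E R).
Variables (B : set (E -> R[i])) (nB : (E -> R[i]) -> R) (xi : E -> R) (xic : E -> R[i]).
Hypotheses (HB : banach_fun_space B nB) (HQ : bounded_op B nB (kop Q))
  (HxiB : B (fun x => (xi x)%:C)) (Hxic : B xic)
  (Hxic_lim : (fun N : nat =>
     nB (fun x => \sum_(n < N) iter n (kop Q) (fun y => (xi y)%:C) x - xic x)) @ \oo --> (0 : R)).

Let S (N : nat) (x : E) : R[i] := \sum_(n < N) iter n (kop Q) (fun y => (xi y)%:C) x.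

Let SS N : S N.+1 = fun x => 1 * S N x + iter N (kop Q) (fun y => (xi y)%:C) x.
Proof. by apply/funext => x; rewrite /S big_ord_recr mul1r. Qed.

Let banach_lin (a : R[i]) f g : B f -> B g -> B (fun x => a * f x + g x).
Proof. by move=> Bf Bg; have [[_ _ BD BZ _] _] := HB; apply: BD => //; exact: BZ. Qed.

Let BS N : B (S N).
Proof.
have [QB _ _] := HQ; elim: N => [|N IH].
  by have [[_ B0 _ _ _] _] := HB; rewrite (_ : S 0 = fun _ => 0)//;
    apply/funext => x; rewrite /S big_ord0.
by rewrite SS; apply: banach_lin => //; elim: N {IH} => //= n; exact: QB.
Qed.

Let kop0 : kop Q (fun _ => 0) = fun _ => 0.
Proof.
have -> : (fun _ : E => 0) = (fun _ => (0 : R)%:C) :> (E -> R[i]) by [].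
by apply/funext => x; rewrite /kop cint_real /Rintegral integral0.
Qed.

Let kop_S N : kop Q (S N) = fun x => S N.+1 x - (xi x)%:C.
Proof.
have [QB Ql _] := HQ; elim: N => [|N IH].
  rewrite (_ : S 0 = fun _ => 0); last by apply/funext => x; rewrite /S big_ord0.
  by rewrite kop0; apply/funext => x; rewrite /S big_ord1 subrr.
rewrite {1}SS Ql//; last by elim: N {IH} => //= n; exact: QB.
by apply/funext => x; rewrite IH mul1r [in RHS]SS mul1r addrAC.
Qed.

Let D N x := (-1) * xic x + S N x.

Let BD N : B (D N). Proof. exact: banach_lin. Qed.

Let D_small (eps : R) : 0 < eps -> exists N, forall n, (N <= n)%N -> nB (D n) <= eps.
Proof.
move=> e0; have /cvgrPdist_le/(_ _ e0)[N _ hN] := Hxic_lim; exists N => n Nn.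
have /= := hN n Nn; rewrite sub0r normrN => h; apply: le_trans (ler_norm _) (le_trans _ h).
rewrite le_eqVlt; apply/orP; left; apply/eqP; congr (`|nB _|); apply/funext => x.
by rewrite /D mulN1r addrC.
Qed.

(** The defect [f] equals [r N] for every [N], and [r N] tends to 0 in norm by boundedness of [Q] on
    [B]. The identity holds at every point, not only almost everywhere, because a function of norm 0
    in [B] is the zero function. *)
Lemma poisson_equation x : (xi x)%:C = xic x - kop Q xic x.
Proof.
have [QB Ql [c Qc]] := HQ; have [[_ B0 _ _ nB0] [nBeq nBD nBZ _]] := HB.
pose f x := (-1) * kop Q xic x + (xic x - (xi x)%:C).
pose r N x := (-1) * D N.+1 x + kop Q (D N) x.
have fr N : f = r N.
  apply/funext => z; rewrite /f /r /D Ql// kop_S; ring.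
have Bf : B f by rewrite (fr 0%N); apply: banach_lin => //; exact: QB.
suff f0 : f = fun _ => 0.
  have /eqP : f x = 0 by rewrite f0.
  by rewrite /f mulN1r addrCA addrA subr_eq0 => /eqP.
apply: nBeq => //; apply/eqP; rewrite eq_le nB0// andbT.
apply/ler_addgt0Pr => e e0; rewrite add0r.
have d0 : 0 < e / (`|c| + 1) by rewrite divr_gt0// ltr_wpDl.
have [N hN] := D_small d0.
have B1 : B (fun x => (-1) * D N.+1 x).
  by have [[_ _ _ BZ _] _] := HB; apply: BZ; exact: BD.
have B2 : B (kop Q (D N)) by exact/QB/BD.
rewrite (fr N) /r (le_trans (nBD _ _ B1 B2))//.
rewrite nBZ; last exact: BD.
rewrite cabsN cabs1 mul1r.
apply: (@le_trans _ _ (e / (`|c| + 1) + `|c| * (e / (`|c| + 1)))).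
  rewrite lerD//; first by apply: hN; exact: leqnSn.
  apply: (le_trans (Qc _ (BD N))); apply: (@le_trans _ _ (`|c| * nB (D N))).
    by rewrite ler_wpM2r ?ler_norm// nB0//; exact: BD.
  by rewrite ler_wpM2l// hN.
by rewrite -{1}[e / _]mul1r -mulrDl addrC mulrC divfK// gt_eqF// ltr_wpDl.
Qed.

Hypothesis (c1 : R) (emb : forall f, B f -> (normL1 nu f <= (c1 * nB f)%:E)%E).

Let Im_S N x : complex.Im (S N x) = 0.
Proof.
have it n y : complex.Im (iter n (kop Q) (fun y => (xi y)%:C) y) = 0.
  elim: n y => [//|n IH] y; rewrite [LHS](cint_ImE (Q y) (iter n (kop Q) _)) /Rintegral.
  by under eq_integral do rewrite IH; rewrite integral0.
by elim: N => [|N IH]; rewrite /S ?big_ord0// big_ord_recr ImD it addr0 IH.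
Qed.

(** The partial sums are real, so the imaginary part of [xic] is bounded by the modulus of the
    remainder, which vanishes in [L^1(nu)]. *)
Lemma poisson_solution_real : {ae nu, forall x, complex.Im (xic x) = 0}.
Proof.
have [[Bm _ _ _ nB0] _] := HB.
have mI : cmeasurable (fun x => (complex.Im (xic x))%:C).
  by apply: cmeasurable_real; have [] := Bm _ Hxic.
suff I0 : (normL1 nu (fun x => (complex.Im (xic x))%:C) <= 0)%E.
  by move: (normL1_le0_eq0 mI I0); apply: filterS => x /(f_equal (@complex.Re R)).
apply/lee_addgt0Pr => e e0; rewrite add0e.
have d0 : 0 < e / (`|c1| + 1) by rewrite divr_gt0// ltr_wpDl.
have [N hN] := D_small d0.
have mD : cmeasurable (D N) by exact: Bm (BD N).
apply: (@le_trans _ _ (normL1 nu (D N))).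
  apply: ge0_le_integral => //.
  - by move=> x _; rewrite lee_fin cabs_ge0.
  - by apply/measurable_EFinP; exact: measurable_cabs.
  - by apply/measurable_EFinP; exact: measurable_cabs.
  - move=> x _; rewrite lee_fin cabs_real (le_trans _ (le_cabs_Im _))//.
    by rewrite /D ImD Im_S addr0 mulN1r ImN normrN.
apply: (le_trans (emb (BD N))); rewrite lee_fin.
apply: (@le_trans _ _ ((`|c1| + 1) * nB (D N))).
  rewrite ler_wpM2r ?(nB0 _ (BD N))//.
  by rewrite (le_trans (ler_norm _))// lerDl.
by rewrite -ler_pdivlMl ?ltr_wpDl// mulrC hN.
Qed.

End PoissonEquation.

Section Psi.
Context {R : realType} {d : measure_display} {E : measurableType d}.
Variables (Q : R.-pker E ~> E) (nu : probability E R).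
Hypothesis Hinv : forall A : set E, measurable A -> nu A = (\int[nu]_x Q x A)%E.

(** Identifies the complex expression defining [psi] with the conditional variance of the real part.
    Equality almost everywhere survives an application of [Q] by invariance. *)
Lemma variance_residual_real (f : E -> R[i]) (sigma2 : R) : cmeasurable f ->
  {ae nu, forall x, complex.Im (f x) = 0} ->
  (\int[nu]_x ((cabs (f x)) ^+ 3)%:E < +oo)%E ->
  {ae nu, forall x, kop Q (fun z => f z ^+ 2) x - kop Q f x ^+ 2 - sigma2%:C =
    (Rintegral (Q x) setT (fun y => complex.Re (f y) ^+ 2) -
     complex.Re (kop Q f x) ^+ 2 - sigma2)%:C}.
Proof.
move=> mf If f3.
have mc : measurable_fun setT (fun x => cabs (f x)) by exact: measurable_cabs.
have f3' : (\int[nu]_x (`|cabs (f x)| ^+ 3)%:E < +oo)%E.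
  by under eq_integral do rewrite ger0_norm ?cabs_ge0//.
have [i1 i2] := cube_integrable (probability_setT nu) mc f3'.
have m2 : cmeasurable (fun z => f z ^+ 2) by exact: cmeasurableM.
have ci1 : cintegrable nu f.
  apply: cintegrableP => //; have /integrableP[_] := i1.
  by apply: le_lt_trans; rewrite le_eqVlt; apply/orP; left; apply/eqP;
    apply: eq_integral => x _; rewrite /= ger0_norm ?cabs_ge0.
have ci2 : cintegrable nu (fun z => f z ^+ 2).
  apply: cintegrableP => //; have /integrableP[_] := i2.
  apply: le_lt_trans; rewrite le_eqVlt; apply/orP; left; apply/eqP.
  by apply: eq_integral => x _; rewrite /= expr2 cabsM ger0_norm// sqr_ge0.
have mr : measurable_fun setT (fun x => complex.Re (f x)) by have [] := mf.
have mr1 : cmeasurable (fun x => (complex.Re (f x))%:C) by exact: cmeasurable_real.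
have mr2 : cmeasurable (fun x => (complex.Re (f x) ^+ 2)%:C).
  by apply: cmeasurable_real; exact: measurable_funX.
have fE x : complex.Im (f x) = 0 -> f x = (complex.Re (f x))%:C.
  by move=> h; apply: complex_eq.
have e1 : {ae nu, forall x, f x = (complex.Re (f x))%:C} by apply: filterS If => x /fE.
have e2 : {ae nu, forall x, f x ^+ 2 = (complex.Re (f x) ^+ 2)%:C}.
  by apply: filterS e1 => x h; rewrite [in LHS]h -rmorphXn.
have k1 := kop_ae_eq Hinv ci1 mr1 e1; have k2 := kop_ae_eq Hinv ci2 mr2 e2.
near=> x.
have -> : kop Q (fun z => f z ^+ 2) x = kop Q (fun z => (complex.Re (f z) ^+ 2)%:C) x by near: x.
have -> : kop Q f x = kop Q (fun z => (complex.Re (f z))%:C) x by near: x.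
by rewrite /kop !cint_real -rmorphXn /= -!rmorphB.
Unshelve. all: by end_near.
Qed.

End Psi.

Section SummableRoots.
Context {R : realType}.

Lemma geometric_half_sum (P : nat) : \sum_(p < P) (2^-1 : R) ^+ p.+1 <= 1.
Proof.
suff -> : \sum_(p < P) (2^-1 : R) ^+ p.+1 = 1 - 2^-1 ^+ P.
  by rewrite lerBlDr lerDl exprn_ge0.
elim: P => [|P IH]; first by rewrite big_ord0 expr0 subrr.
by rewrite big_ord_recr /= IH exprS; field.
Qed.

Lemma bounded_sum_small (w : nat -> R) (W : R) :
  (forall P, \sum_(p < P) w p <= W) -> forall eps, 0 < eps -> exists P, w P <= eps.
Proof.
move=> wW eps e0; apply: contrapT => /forallNP h.
have lb P : P%:R * eps <= \sum_(p < P) w p.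
  elim: P => [|P IH]; first by rewrite mul0r big_ord0.
  rewrite big_ord_recr /= -natr1 mulrDl mul1r lerD// ltW// ltNge; exact/negP/h.
have := le_trans (lb (Num.truncn (`|W| / eps)).+1) (wW _).
have v0 : 0 <= `|W| / eps by rewrite divr_ge0// ltW.
have /andP[_] := truncn_itv v0; rewrite ltr_pdivrMr// => h1 h2.
by have := lt_le_trans h1 (le_trans h2 (ler_norm _)); rewrite ltxx.
Qed.

Lemma powR_three_halves (x : R) : 0 <= x -> x `^ (3 / 2) = x * Num.sqrt x.
Proof.
move=> x0; have -> : 3 / 2 = 1 + 2^-1 :> R by field.
by rewrite powRD ?powRr1 ?powR12_sqrt//; apply/implyP; rewrite gt_eqF// addr_gt0 ?invr_gt0.
Qed.

Lemma summable_roots (I : nat -> \bar R) : (forall p, (0 <= I p)%E) ->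
  (\sum_(0 <= p <oo) poweR (I p) (2 / 3) < +oo)%E ->
  exists w W, [/\ forall p : nat, 0 < w p,
    forall p, (I p <= (w p * Num.sqrt (w p))%:E)%E,
    forall P, \sum_(p < P) w p <= W &
    forall eps : R, 0 < eps -> exists P : nat, w P <= eps].
Proof.
move=> I0 Ifin; set V := (\sum_(0 <= p <oo) _)%E in Ifin.
have V0 : (0 <= V)%E by apply: nneseries_ge0 => n _ _; exact: poweR_ge0.
have Vfin : V \is a fin_num by rewrite ge0_fin_numE.
have part P : (\sum_(0 <= p < P) poweR (I p) (2 / 3) <= V)%E.
  by apply: nneseries_lim_ge => n _ _; exact: poweR_ge0.
have If p : I p \is a fin_num.
  rewrite ge0_fin_numE//; have := le_lt_trans (part p.+1) Ifin.
  rewrite big_nat_recr//; case: (I p) (I0 p) => [r _ _| _|] //; first by rewrite ltry.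
  have r0 : 2 / 3 != 0 :> R by rewrite mulf_neq0// invr_eq0.
  rewrite (poweRyr r0) [X in (X < _)%E]addey ?ltxx//.
  by rewrite gt_eqF// (lt_le_trans ltNy0)// sume_ge0// => i _; exact: poweR_ge0.
pose v p := fine (I p) `^ (2 / 3).
have vE p : poweR (I p) (2 / 3) = (v p)%:E by rewrite -{1}(fineK (If p)) poweR_EFin.
have v0 p : 0 <= v p by exact: powR_ge0.
(* [v p] is the [L^(3/2)] norm itself, which may vanish; the geometric term makes the weight
   positive, as Young's inequality divides by its square root, and keeps the sum finite. *)
pose w p := v p + 2^-1 ^+ p.+1.
have w0 p : 0 < w p by rewrite ltr_wpDl// exprn_gt0.
have wW P : \sum_(p < P) w p <= fine V + 1.
  rewrite big_split /= lerD ?geometric_half_sum// -lee_fin fineK//.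
  apply: le_trans (part P); rewrite big_mkord -sumEFin.
  by apply: lee_sum => i _; rewrite vE.
exists w, (fine V + 1); split => //; last exact: bounded_sum_small wW.
move=> p; rewrite -(fineK (If p)) lee_fin.
have f0 : 0 <= fine (I p) by rewrite fine_ge0.
have -> : fine (I p) = v p `^ (3 / 2).
  by rewrite /v -powRrM (_ : 2 / 3 * (3 / 2) = 1) ?powRr1//; field.
rewrite -(powR_three_halves (ltW (w0 p))).
apply: ge0_ler_powR; rewrite ?nnegrE ?divr_ge0//; first exact: ltW.
by rewrite lerDl exprn_ge0.
Qed.

End SummableRoots.

Section Hypotheses.
Context {R : realType} {d : measure_display} {E : measurableType d}.
Variables (Q : R.-pker E ~> E) (nu : probability E R).
Variables (B : set (E -> R[i])) (nB : (E -> R[i]) -> R).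
Hypothesis HB : banach_fun_space B nB.

Lemma geometric_mixing (kappa0 c : R) : kappa0 < 1 -> 0 <= c ->
  (forall (n : nat) f, (0 < n)%N -> B f ->
     nB (fun x => iter n (kop Q) f x - cint nu f) <= c * kappa0 ^+ n * nB f) ->
  forall eps : R, 0 < eps -> exists l : nat, forall f, B f ->
    nB (fun x => iter l (kop Q) f x - cint nu f) <= eps * nB f.
Proof.
move=> k1 c0 H eps e0; have [[_ _ _ _ nB0] _] := HB.
(* For a negative [kappa0] one step suffices, since the bound is then nonpositive. *)
have [k0|k0] := leP 0 kappa0; last first.
  exists 1%N => f Bf; apply: (le_trans (H 1%N f isT Bf)); rewrite ler_wpM2r ?nB0//.
  by rewrite expr1 (le_trans _ (ltW e0))// mulr_ge0_le0// ltW.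
have d0 : 0 < eps / (c + 1) by rewrite divr_gt0// ltr_wpDl.
have [|n hn] := @expr_small _ kappa0 _ _ d0; first by rewrite k0.
exists n.+1 => f Bf; apply: (le_trans (H n.+1 f isT Bf)); rewrite ler_wpM2r ?nB0//.
apply: (@le_trans _ _ ((c + 1) * (eps / (c + 1)))).
  rewrite ler_pM ?exprn_ge0// ?lerDl// (le_trans _ hn)// exprS ler_piMl ?exprn_ge0//.
  exact: ltW.
by rewrite mulrC divfK// gt_eqF// ltr_wpDl.
Qed.

(** Homogeneity extends the bound from the unit ball; a function of norm 0 is the zero function. *)
Lemma twist_small_scaled (xi : E -> R) (c t : R) : measurable_fun setT xi ->
  (forall f, B f -> nB f <= 1 ->
     (\int[nu]_x (cabs (cexpi (t * xi x) - 1) * cabs (f x))%:E <= (c * `|t|)%:E)%E) ->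
  forall f, B f ->
    (\int[nu]_x (cabs (cexpi (t * xi x) - 1) * cabs (f x))%:E <= (`|c| * `|t| * nB f)%:E)%E.
Proof.
move=> mxi H f Bf; have [[Bm _ _ BZ nB0] [nBeq _ nBZ _]] := HB.
have [f0|f0] := eqVneq (nB f) 0.
  rewrite (nBeq f Bf f0) integral0_eq ?lee_fin; last by move=> x _; rewrite cabs0 mulr0.
  by rewrite !mulr_ge0// nB0//; have [[_ ? _ _ _] _] := HB.
have fp : 0 < nB f by rewrite lt_neqAle eq_sym f0 nB0.
have Bg : B (fun x => ((nB f)^-1)%:C * f x) by exact: BZ.
have ng : nB (fun x => ((nB f)^-1)%:C * f x) <= 1.
  by rewrite nBZ// cabs_real gtr0_norm ?invr_gt0// mulVf.
have mf : measurable_fun setT (fun x => cabs (f x)) by apply: measurable_cabs; exact: Bm.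
have me : measurable_fun setT (fun x => cabs (cexpi (t * xi x) - 1)).
  apply: measurable_cabs; apply: cmeasurableB; last exact: cmeasurable_cst.
  by apply: cmeasurable_cexpi; exact: measurable_funM.
have -> : (\int[nu]_x (cabs (cexpi (t * xi x) - 1) * cabs (f x))%:E =
    (nB f)%:E * \int[nu]_x (cabs (cexpi (t * xi x) - 1) * cabs (((nB f)^-1)%:C * f x))%:E)%E.
  rewrite -ge0_integralZl//; last first.
  - by rewrite lee_fin ltW.
  - by move=> x _; rewrite lee_fin mulr_ge0 ?cabs_ge0.
  - apply/measurable_EFinP; apply: measurable_funM => //.
    by apply: measurable_cabs; exact: Bm.
  apply: eq_integral => x _; rewrite -EFinM cabsM cabs_real gtr0_norm ?invr_gt0//.
  by congr (_%:E); field.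
apply: (@le_trans _ _ ((nB f)%:E * (`|c| * `|t|)%:E)%E).
  rewrite lee_wpmul2l ?lee_fin ?nB0// (le_trans (H _ Bg ng))// lee_fin.
  by rewrite ler_wpM2r// ler_norm.
by rewrite -EFinM lee_fin mulrC.
Qed.

Lemma ess_spectral_radius_ge0 T : 0 <= ess_spectral_radius B nB T.
Proof.
apply: lb_le_inf.
  by exists (powR (ess_norm B nB (iter 1 T)) (1%:R^-1)); exists 1%N.
by move=> _ [n _ <-]; exact: powR_ge0.
Qed.

End Hypotheses.

Unset Implicit Arguments.
Set Strict Implicit.

Theorem theorem2p1
  (R : realType) (d : measure_display) (E : measurableType d)
  (Q : R.-pker E ~> E) (nu : probability E R)
  (* nu is Q-invariant *)
  (Hinv : forall A : set E, measurable A -> nu A = (\int[nu]_x Q x A)%E)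
  (dO : measure_display) (Omega : measurableType dO) (P : probability Omega R)
  (X : nat -> Omega -> E)
  (* (X_n) Markov chain with transition Q and initial law mu0 = nu *)
  (HX : markov_chain P X Q nu)
  (xi : E -> R)
  (Hxi_meas : measurable_fun setT xi)
  (Hxi_int : nu.-integrable setT (fun x => (xi x)%:E))
  (Hxi_0 : (\int[nu]_x (xi x)%:E = 0)%E)
  (* hypothesis (H): the Banach space B *)
  (B : set (E -> R[i])) (nB : (E -> R[i]) -> R)
  (HB : banach_fun_space B nB)
  (HB_L3 : forall f, B f -> (\int[nu]_x ((cabs (f x)) ^+ 3)%:E < +oo)%E)
  (HxiB : B (fun x => (xi x)%:C))
  (* Q f(x) is well defined for f in B *)
  (HQ_def : forall f, B f -> forall x : E,
     (Q x).-integrable setT (fun y => (complex.Re (f y))%:E) /\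
     (Q x).-integrable setT (fun y => (complex.Im (f y))%:E))
  (* (H1) *)
  (H1 : geom_ergodic B nB Q nu)
  (* xic = \sum_{n>=0} Q^n xi, the sum converging in B *)
  (xic : E -> R[i]) (Hxic : B xic)
  (Hxic_lim : (fun N : nat =>
       nB (fun x => \sum_(n < N) iter n (kop Q) (fun y => (xi y)%:C) x - xic x))
       @ \oo --> (0 : R))
  (* sigma^2 = nu(xic^2) - nu((Q xic)^2), assumed > 0 *)
  (sigma2 : R)
  (Hsigma2 : cint nu (fun x => xic x ^+ 2) - cint nu (fun x => kop Q xic x ^+ 2)
             = sigma2%:C)
  (Hsigma2_pos : 0 < sigma2)
  (* (H2), with psi = Q(xic^2) - (Q xic)^2 - sigma^2 1 *)
  (H2 : (\sum_(0 <= p <oo)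
           poweR (\int[nu]_x (powR (cabs (iter p (kop Q)
                     (fun y => kop Q (fun z => xic z ^+ 2) y
                               - kop Q xic y ^+ 2 - sigma2%:C) x)) (3 / 2))%:E)
                 (2 / 3) < +oo)%E)
  (* (H3) *)
  (H3 : exists (c delta : R), 0 < delta /\
     forall t : R, `|t| < delta -> forall f, B f -> nB f <= 1 ->
       (\int[nu]_x (cabs (cexpi (t * xi x) - 1) * cabs (f x))%:E
          <= (c * `|t|)%:E)%E)
  (* (H4) *)
  (H4 : exists (a b : R), a < 0 < b /\
     exists (kappa c : R), kappa < 1 /\ 0 <= c /\
     forall t : R, a < t < b ->
       [/\ bounded_op B nB (kopt Q xi t),
           (forall (n : nat) f, (0 < n)%N -> B f ->
              nB (iter n (kopt Q xi t) f)
                <= c * kappa ^+ n * nB f + c * Rintegral nu setT (fun x => cabs (f x))) &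
           ess_spectral_radius B nB (kopt Q xi t) <= kappa]) :
  conv_in_law P (fun n w => partial_sum X xi n w / Num.sqrt (n%:R))
              (normal_prob 0 (Num.sqrt sigma2))
  /\
  forall tau : R, tau < 1 ->
    exists (C : R) (N : nat), forall n : nat, (N <= n)%N -> forall x : R,
      `| fine (P [set w | partial_sum X xi n w / (Num.sqrt sigma2 * Num.sqrt (n%:R)) <= x])
         - fine (normal_prob 0 1 [set y : R | y <= x]) |
        <= C * powR (n%:R) (- (tau / 2)).
Proof.
have [B1 [c1 emb] HQ [kappa0 [c0 [k01 [c00 Hmix]]]]] := H1.
have [QB Ql [qB Qc]] := HQ.
have [[Bm _ _ _ nB0] _] := HB.
have BQ f : B f -> forall x, cintegrable (Q x) f by move=> Bf x; exact: HQ_def.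
have mxic : cmeasurable xic by exact: Bm.
have mg : measurable_fun setT (fun x => complex.Re (xic x)) by have [] := mxic.
have mh : measurable_fun setT (fun x => complex.Re (kop Q xic x)).
  by have [] := cmeasurable_kop Q mxic.
have pois := poisson_equation HB HQ HxiB Hxic Hxic_lim.
have xiE x : xi x = complex.Re (xic x) - complex.Re (kop Q xic x).
  by have /(f_equal (@complex.Re R)) := pois x; rewrite ReD ReN.
have gh x : Rintegral (Q x) setT (fun y => complex.Re (xic y)) = complex.Re (kop Q xic x).
  by rewrite /kop cint_ReE.
have cube f : B f -> exists G : R, (\int[nu]_x (`|complex.Re (f x)| ^+ 3)%:E)%E = G%:E.
  move=> Bf; have [mr _] := Bm _ Bf.
  have le3 : (\int[nu]_x (`|complex.Re (f x)| ^+ 3)%:E <= \int[nu]_x ((cabs (f x)) ^+ 3)%:E)%E.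
    apply: ge0_le_integral => //.
    - by apply/measurable_EFinP/measurable_funX; exact: measurableT_comp.
    - by apply/measurable_EFinP/measurable_funX/measurable_cabs; exact: Bm.
    - by move=> x _; rewrite lee_fin lerXn2r ?nnegrE ?cabs_ge0// le_cabs_Re.
  exists (fine (\int[nu]_x (`|complex.Re (f x)| ^+ 3)%:E)); rewrite fineK// ge0_fin_numE.
    exact: le_lt_trans le3 (HB_L3 _ Bf).
  by apply: integral_ge0 => x _; rewrite lee_fin exprn_ge0.
have [G3 HG3] := cube _ Hxic; have [H3' HH3] := cube _ (QB _ Hxic).
have realx := poisson_solution_real HB HQ HxiB Hxic Hxic_lim emb.
have psiE := variance_residual_real Hinv sigma2 mxic realx (HB_L3 _ Hxic).
pose psi x := kop Q (fun z => xic z ^+ 2) x - kop Q xic x ^+ 2 - sigma2%:C.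
have mpsi : cmeasurable psi.
  have m2 : cmeasurable (fun z => xic z ^+ 2) by exact: cmeasurableM.
  apply: cmeasurableB; last exact: cmeasurable_cst.
  apply: cmeasurableB; first exact: cmeasurable_kop.
  by apply: cmeasurableM; exact: cmeasurable_kop.
pose I p := (\int[nu]_x (powR (cabs (iter p (kop Q) psi x)) (3 / 2))%:E)%E.
have I0 p : (0 <= I p)%E by apply: integral_ge0 => x _; rewrite lee_fin powR_ge0.
have [w [W [w0 wI wW w_small]]] := summable_roots I0 H2.
have psiw p : (\int[nu]_x (cabs (iter p (kop Q) psi x) *
    Num.sqrt (cabs (iter p (kop Q) psi x)))%:E <= (w p * Num.sqrt (w p))%:E)%E.
  apply: le_trans (wI p); rewrite /I le_eqVlt; apply/orP; left; apply/eqP.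
  by apply: eq_integral => x _; rewrite powR_three_halves ?cabs_ge0.
have [C [C0 hC]] := charfun_gaussian_bound Hinv mg mh gh xiE HG3 HH3 mpsi psiE
  (ltW Hsigma2_pos) w0 psiw wW w_small.
(* Ensures [|u| <= 1] and then [u ^+ 2 / 2 * sigma2 <= 1], as [u ^+ 2 <= |u|]. *)
pose u5 := Num.min 1 (2 / sigma2).
have u50 : 0 < u5 by rewrite lt_min ltr01 divr_gt0.
have CF u n : `|u| <= u5 -> cabs (cint nu (iter n (kopt Q xi u) (fun _ => 1)) -
    (expR (- (n%:R * (u ^+ 2 / 2 * sigma2))))%:C) <= C * (`|u| + n%:R * `|u| ^+ 3).
  rewrite le_min => /andP[u1 u2]; apply: hC => //.
  rewrite mulrAC ler_pdivrMr// mul1r -ler_pdivlMr// (le_trans _ u2)//.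
  by rewrite -real_normK ?num_real// expr2 ler_piMl.
have {H3} [c3 [d3 [d30 H3]]] := H3.
have HF3 u : `|u| < d3 -> forall f, B f ->
    (\int[nu]_x (cabs (cexpi (u * xi x) - 1) * cabs (f x))%:E <= (`|c3| * `|u| * nB f)%:E)%E.
  by move=> ud; apply: twist_small_scaled => //; exact: H3.
have {H4} [a [b [/andP[a0 b0] [kappa [c4 [kappa1 [c40 H4]]]]]]] := H4.
(* [kappa] is nonnegative since at [t = 0] it dominates an essential spectral radius, an infimum of
   nonnegative numbers. *)
have kappa01 : 0 <= kappa < 1.
  have [|_ _ ess] := H4 0; first by rewrite a0 b0.
  by rewrite kappa1 andbT (le_trans _ ess)// ess_spectral_radius_ge0.
pose d4 := Num.min (- a) b.
have d40 : 0 < d4 by rewrite lt_min oppr_gt0 a0 b0.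
have d4ab u : `|u| < d4 -> a < u < b.
  by rewrite lt_min !ltr_norml opprK => /andP[/andP[-> _] /andP[_ ->]].
have HT u : `|u| < d4 -> bounded_op B nB (kopt Q xi u) by move=> /d4ab/H4[].
have DF u : `|u| < d4 -> forall n f, (0 < n)%N -> B f -> nB (iter n (kopt Q xi u) f) <=
    c4 * kappa ^+ n * nB f + c4 * Rintegral nu setT (fun x => cabs (f x)).
  by move=> /d4ab/H4[].
have emb' f : B f -> (normL1 nu f <= (`|c1| * nB f)%:E)%E.
  move=> Bf; apply: (le_trans (emb f Bf)).
  by rewrite lee_fin ler_wpM2r ?nB0// ler_norm.
have Qc' f : B f -> nB (kop Q f) <= `|qB| * nB f.
  by move=> Bf; apply: (le_trans (Qc f Bf)); rewrite ler_wpM2r ?nB0// ler_norm.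
have [delta [c [K [delta0 c0' K0 decay]]]] := charfun_gaussian_decay Hinv Hxi_meas HB BQ B1
  (normr_ge0 c1) emb' (normr_ge0 qB) QB Qc' (geometric_mixing HB k01 c00 Hmix)
  (normr_ge0 c3) d30 HF3 kappa01 c40 d40 HT DF C0 u50 Hsigma2_pos CF.
pose u1 := Num.min delta u5.
have u10 : 0 < u1 by rewrite lt_min delta0.
have small u n : `|u| <= u1 -> cabs (cint nu (iter n (kopt Q xi u) (fun _ => 1)) -
    (expR (- (n%:R * (u ^+ 2 / 2 * sigma2))))%:C) <= C * (`|u| + n%:R * `|u| ^+ 3).
  by rewrite le_min => /andP[_]; exact: CF.
have decay1 u n : `|u| <= u1 -> cabs (cint nu (iter n (kopt Q xi u) (fun _ => 1))) <=
    K * expR (- (c * (n%:R * u ^+ 2))).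
  by rewrite le_min => /andP[+ _]; exact: decay.
have mS n : measurable_fun setT (partial_sum X xi n) by exact: (measurable_partial_sum HX).
have iS n : P.-integrable setT (EFin \o partial_sum X xi n).
  exact: (integrable_partial_sum HX Hinv).
have Sa n u := charfun_partial_sum HX Hxi_meas u n.
have rate s tau s0 tau1 := @kolmogorov_rate _ _ _ _ _ _ mS iS Sa _ _ _ _ _ Hsigma2_pos C0
  u10 c0' K0 small decay1 s tau s0 tau1.
pose sg := Num.sqrt sigma2.
have sg0 : 0 < sg by rewrite sqrtr_gt0.
have rt0 n : (0 < n)%N -> 0 < Num.sqrt n%:R :> R by move=> n0; rewrite sqrtr_gt0 ltr0n.
split.
  apply: conv_in_law_cdf; first by move=> n; exact: measurable_funM.
  (* Convergence in law needs no sharp rate: [tau = 1 / 2] gives [M * n^(-1/4)], which is below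
     [eps] once [n >= v ^+ 4]. *)
  move=> eps eps0; have [M [M0 hM]] := rate sg (1 / 2) sg0 ltac:(lra).
  pose v := (M + 1) / eps.
  have v0 : 0 < v by rewrite divr_gt0// ltr_wpDl.
  exists (Num.truncn (v ^+ 4)).+1 => n x nN.
  have n0 : (0 < n)%N by exact: leq_trans nN.
  have vn : v ^+ 4 <= n%:R.
    have /andP[_ /ltW h] := truncn_itv (exprn_ge0 4 (ltW v0)).
    by rewrite (le_trans h)// ler_nat.
  have vn4 : v <= n%:R `^ (1 / 2 / 2).
    have -> : v = (v ^+ 4) `^ (1 / 2 / 2).
      rewrite -powR_mulrn ?ltW// -powRrM (_ : 4 * (1 / 2 / 2) = 1) ?powRr1 ?ltW//.
      by field.
    by apply: ge0_ler_powR; rewrite ?nnegrE ?divr_ge0 ?exprn_ge0 ?(ltW v0).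
  have := hM n (x / sg) n0.
  have -> : sg * Num.sqrt n%:R * (x / sg) = x * Num.sqrt n%:R by field; rewrite gt_eqF.
  have -> : sg * (x / sg) = x by field; rewrite gt_eqF.
  have -> : rv_cdf P (partial_sum X xi n) (x * Num.sqrt n%:R) =
      rv_cdf P (fun z => partial_sum X xi n z / Num.sqrt n%:R) x.
    by congr (fine (P _)); apply/seteqP; split => z /=; rewrite ler_pdivrMr ?rt0.
  move=> /le_trans; apply; rewrite powRN ler_pdivrMr ?(lt_le_trans v0)//.
  apply: (@le_trans _ _ (eps * v)); last by rewrite ler_pM2l.
  by rewrite /v mulrC divfK ?gt_eqF// lerDl.
move=> tau tau1; have [M [M0 hM]] := rate 1 tau ltr01 tau1.
exists M, 1%N => n n0 x; have := hM n x n0.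
have -> : rv_cdf P (partial_sum X xi n) (sg * Num.sqrt n%:R * x) =
    fine (P [set w | partial_sum X xi n w / (sg * Num.sqrt n%:R) <= x]).
  congr (fine (P _)); apply/seteqP; split => z /=.
    by rewrite ler_pdivrMr ?mulr_gt0 ?rt0// mulrC.
  by rewrite ler_pdivrMr ?mulr_gt0 ?rt0// mulrC.
by rewrite mul1r.
Qed.
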